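(* Let $H$ be a cocommutative Hopf algebra over a field $\mathbf k$ of characteristic $0$. There is an isomorphism of vector spaces $$\mathscr H_2(H)\cong\frac{\overline{H^{\otimes 2}}}{\langle \mathrm{Id}-\tau,\ \mathrm{Id}+\delta,\ \mathrm{Id}+\gamma+\gamma^2\rangle}.$$ That is, $\mathscr H_2(H)$ is the quotient of $\overline{H^{\otimes2}}$ by the relations, for all $a,b\in H$: (1) $a\otimes b=b\otimes a$; (2) $a\otimes b=-S(a)\otimes b$; (3) $a\otimes b+S(a_{(1)})b\otimes S(a_{(2)})+S(b_{(1)})\otimes S(b_{(2)})a=0$.
   Context: $H$ has coproduct $\Delta$ (Sweedler notation), unit $\eta$, counit $\epsilon$, antipode $S$. $H$ acts on $H^{\otimes n}$ by conjugation: $h\circledast(h_1\otimes\cdots\otimes h_n)=h_{(1)}h_1S(h_{(2)})\otimes\cdots\otimes h_{(2n-1)}h_nS(h_{(2n)})$, and $\overline{H^{\otimes n}}$ is the quotient of $H^{\otimes n}$ by the span of all $(h-\eta\epsilon(h))\circledast(h_1\otimes\cdots\otimes h_n)$. On $\overline{H^{\otimes2}}$ (operators acting on the right): $(a\otimes b)\tau=b\otimes a$, $(a\otimes b)\delta=S(a)\otimes b$, $(a\otimes b)\gamma=S(b_{(1)})\otimes aS(b_{(2)})$. $\langle r_1,\dots,r_j\rangle$ denotes the sum of the images of the operators $r_i$. Definition of $\mathscr H_n(H)$. For a cyclic operad $\mathcal O$, $\mathcal O((n))=\mathcal O[n-1]$ denotes the operations with $n$ input/output slots, a $\Sigma_n$-module.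 $\mathsf{Lie}((n))$ is spanned by vertex-oriented trivalent trees with $n$ labeled leaves modulo antisymmetry and IHX relations. $H$ is regarded as a cyclic operad with elements only of arity $1$, composition given by multiplication and the generator of $\Sigma_2$ acting by $S$. The cyclic operad $H\mathsf{Lie}$ is the quotient of the operad freely generated by $H$ and $\mathsf{Lie}$ (units identified) by the relation that $h\in H$ composed with the output of $o\in\mathsf{Lie}[n]$ equals $o$ with $h_{(1)},\dots,h_{(n)}$ composed with its $n$ inputs. The graph complex $\mathcal G_{H\mathsf{Lie}}$ is spanned by oriented finite graphs without univalent or isolated vertices (bivalent vertices allowed), each vertex $v$ decorated by an element of $H\mathsf{Lie}((|v|))$ with slots identified with the adjacent half-edges, multilinearly in the decorations; an orientation is an ordering of the vertices and a direction of each edge, an odd change giving a sign. It is graded by the number of vertices, and $\partial$ is the sum over non-loop edges of contracting the edge and composing the decorations. $\mathcal G^{(n)}_{H\mathsf{Lie}}$ is spanned by connected graphs of rank (first Betti number) $n$. $\overline{\mathcal G^{(n)}_{H\mathsf{Lie}}}$ is the quotient complex in which elements of $H$ may slide along an edge, from the slot at one end to the slot at the other end. Then $\mathscr H_n(H)=H_1(\overline{\mathcal G^{(n)}_{H\mathsf{Lie}}})$. *)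

(* Defs.v *)
From HB Require Import structures.
From mathcomp Require Import all_boot all_order all_algebra.
From mathcomp Require Import generic_quotient ring_quotient.
From mathcomp Require Import boolp classical_sets.
From mathcomp Require Import freeg.

Set Implicit Arguments.
Unset Strict Implicit.
Unset Printing Implicit Defensive.

Import GRing.Theory.
Local Open Scope ring_scope.
Local Open Scope classical_set_scope.
Local Open Scope quotient_scope.

Section Span.
Variables (k : fieldType) (V : lmodType k).
Implicit Type A : set V.

Definition lspan A : {pred V} := fun x =>
  `[< exists2 s : seq (k * V), (forall p, p \in s -> A p.2) &
      x = \sum_(p <- s) p.1 *: p.2 >].

Lemma lspan_submod_closed A : submod_closed (lspan A).
Proof.
split=> [|c x y /asboolP[s sA ->] /asboolP[t tA ->]].
  by apply/asboolP; exists [::] => //; rewrite big_nil.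
apply/asboolP; exists ([seq (c * p.1, p.2) | p <- s] ++ t) => [p|].
  by rewrite mem_cat => /orP[/mapP[q qs ->]|/tA//]; exact: (sA q qs).
rewrite big_cat big_map scaler_sumr; congr (_ + _).
by apply: eq_bigr => p _; rewrite scalerA.
Qed.

HB.instance Definition _ A :=
  GRing.isSubmodClosed.Build k V (lspan A) (lspan_submod_closed A).

Lemma sub_lspan A x : A x -> x \in lspan A.
Proof.
move=> Ax; apply/asboolP; exists [:: (1, x)] => [p|].
  by rewrite inE => /eqP->.
by rewrite big_seq1 scale1r.
Qed.

Definition quotmod A := {ideal_quot (lspan A)}.
HB.instance Definition _ A := Choice.on (quotmod A).
HB.instance Definition _ A := GRing.Zmodule.on (quotmod A).
HB.instance Definition _ A := Quotient.on (quotmod A).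

Lemma quotmodP A (x y : V) :
  reflect (\pi_(quotmod A) x = \pi_(quotmod A) y) (x - y \in lspan A).
Proof. by rewrite Quotient.idealrBE; apply: eqP. Qed.

Lemma quotmodD A (x y : V) :
  \pi_(quotmod A) (x + y) = \pi_(quotmod A) x + \pi_(quotmod A) y.
Proof. exact: (@Quotient.pi_add V (lspan A)). Qed.

Definition quotmod_scale A (c : k) (x : quotmod A) : quotmod A :=
  \pi_(quotmod A) (c *: repr x).

Lemma quotmod_scaleE A c (x : V) :
  quotmod_scale c (\pi_(quotmod A) x) = \pi_(quotmod A) (c *: x).
Proof.
apply/quotmodP; rewrite -scalerBr rpredZ //; apply/quotmodP.
by rewrite reprK.
Qed.

Lemma quotmod_scaleA A c d (x : quotmod A) :
  quotmod_scale c (quotmod_scale d x) = quotmod_scale (c * d) x.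
Proof. by rewrite -[x]reprK !quotmod_scaleE reprK scalerA. Qed.

Lemma quotmod_scale1 A : left_id 1 (@quotmod_scale A).
Proof. by move=> x; rewrite -[x]reprK quotmod_scaleE scale1r. Qed.

Lemma quotmod_scaleDr A : right_distributive (@quotmod_scale A) +%R.
Proof.
move=> c x y; rewrite -[x]reprK -[y]reprK -quotmodD !quotmod_scaleE.
by rewrite scalerDr quotmodD.
Qed.

Lemma quotmod_scaleDl A (x : quotmod A) :
  {morph (@quotmod_scale A)^~ x : c d / c + d}.
Proof.
by move=> c d; rewrite -[x]reprK !quotmod_scaleE scalerDl quotmodD.
Qed.

HB.instance Definition _ A := GRing.Zmodule_isLmodule.Build k (quotmod A)
  (@quotmod_scaleA A) (@quotmod_scale1 A) (@quotmod_scaleDr A)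
  (@quotmod_scaleDl A).

End Span.

Arguments lspan {k V} A.
Arguments quotmod {k V} A.

Lemma fglift_is_linear (k : fieldType) (K : choiceType) (M : lmodType k)
  (f : K -> M) : linear (fglift f : {freeg K / k} -> M).
Proof.
set g : {freeg K / k} -> M := fglift f.
have gB D E : g (D - E) = g D - g E by exact: lift_is_additive.
have g0 : g 0 = 0 by rewrite -(subrr 0) gB subrr.
have gD : {morph g : D E / D + E}.
  by move=> D E; rewrite -[E in LHS]opprK gB -[- E]sub0r gB g0 sub0r opprK.
move=> c D E; rewrite gD; congr (_ + _); rewrite -[D]freeg_sumE.
rewrite scaler_sumr !(big_morph _ gD g0) scaler_sumr.
apply: eq_bigr => z _; suff -> : c *: << coeff z D *g z >> =
    << c * coeff z D *g z >> :> {freeg K / k} by rewrite /g !liftU scalerA.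
by apply/eqP/freeg_eqP => x; rewrite coeffZ !coeffU mulrA.
Qed.

HB.instance Definition _ (k : fieldType) (K : choiceType) (M : lmodType k)
  (f : K -> M) := GRing.isLinear.Build k {freeg K / k} M _ (fglift f)
    (fglift_is_linear f).

Section TensorPower.
Variables (k : fieldType) (V : lmodType k).

Definition tupd n (t : n.-tuple V) (i : 'I_n) (a : V) : n.-tuple V :=
  [tuple if j == i then a else tnth t j | j < n].

Definition multilinear_rel n : set {freeg (n.-tuple V) / k} :=
  [set x | exists t i c a b,
     x = << tupd t i (c *: a + b) >> - c *: << tupd t i a >>
         - << tupd t i b >>].

Definition tpow n := quotmod (@multilinear_rel n).
HB.instance Definition _ n := GRing.Lmodule.on (tpow n).
HB.instance Definition _ n := Quotient.on (tpow n).

Definition pure n (t : n.-tuple V) : tpow n := \pi_(tpow n) << t >>.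

(* The linear map sending v_1 (x) ... (x) v_n to f [v_1, ..., v_n]; the
   formula makes sense for every f but is independent of the representative
   only when f is multilinear, see mext_pi. *)
Definition mext n (M : lmodType k) (f : n.-tuple V -> M) (x : tpow n) : M :=
  fglift f (repr x).

Definition multilinear n (M : lmodType k) (f : n.-tuple V -> M) :=
  forall t i c a b,
    f (tupd t i (c *: a + b)) = c *: f (tupd t i a) + f (tupd t i b).

Lemma mext_pi n (M : lmodType k) (f : n.-tuple V -> M)
    (D : {freeg (n.-tuple V) / k}) :
  multilinear f -> mext f (\pi_(tpow n) D) = fglift f D.
Proof.
pose g : {linear {freeg (n.-tuple V) / k} -> M} := fglift f.
have gU t : g << t >> = f t by rewrite /g /= liftU scale1r.
move=> flin; suff g0 x : x \in lspan (@multilinear_rel n) -> g x = 0.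
  apply/eqP; rewrite -subr_eq0; apply/eqP; rewrite -[LHS](linearB g).
  by apply/g0/quotmodP; rewrite reprK.
move=> /asboolP[s sA ->]; rewrite linear_sum big_seq big1// => p /sA.
case=> t [i [c [a [b ->]]]]; rewrite (linearZ_LR g) !(linearB g).
by rewrite (linearZ_LR g) !gU flin addrAC addrK subrr scaler0.
Qed.

Definition tens (a b : V) : tpow 2 := pure [tuple a; b].

(* sum over x of f x_(1) x_(2), in Sweedler notation *)
Definition sweedler (M : lmodType k) (f : V -> V -> M) (x : tpow 2) : M :=
  mext (fun w : 2.-tuple V => f (tnth w 0) (tnth w 1)) x.

End TensorPower.

Record hopfAlgebra (k : fieldType) := HopfAlgebra {
  hopf_alg :> algType k;
  Delta : {linear hopf_alg -> tpow hopf_alg 2};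
  counit : {lrmorphism hopf_alg -> k | *%R};
  antipode : {linear hopf_alg -> hopf_alg};
  Delta1 : Delta 1 = tens 1 1;
  DeltaM : forall a b, Delta (a * b) =
    sweedler (fun a1 a2 => sweedler (fun b1 b2 =>
      tens (a1 * b1) (a2 * b2)) (Delta b)) (Delta a);
  coassoc : forall h,
    sweedler (fun a b =>
      sweedler (fun c d => pure [tuple c; d; b]) (Delta a)) (Delta h) =
    sweedler (fun a b =>
      sweedler (fun c d => pure [tuple a; c; d]) (Delta b)) (Delta h);
  counitl : forall h, sweedler (fun a b => counit a *: b) (Delta h) = h;
  counitr : forall h, sweedler (fun a b => counit b *: a) (Delta h) = h;
  antipodel : forall h,
    sweedler (fun a b => antipode a * b) (Delta h) = (counit h)%:A;
  antipoder : forall h,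
    sweedler (fun a b => a * antipode b) (Delta h) = (counit h)%:A
}.

Arguments Delta {k H} : rename.
Arguments counit {k H} : rename.
Arguments antipode {k H} : rename.

Definition cocommutative (k : fieldType) (H : hopfAlgebra k) : Prop :=
  forall h : H, sweedler (fun a b => tens b a) (Delta h) = Delta h.

Section HopfLie.
Variables (k : fieldType) (H : hopfAlgebra k).
Local Notation S := (@antipode k H).
Local Notation eps := (@counit k H).

(* h_(1) (x) ... (x) h_(n) *)
Fixpoint iterDelta n (h : H) : tpow H n :=
  match n with
  | 0 => eps h *: pure [tuple]
  | m.+1 => sweedler (fun a b =>
      mext (fun w : m.-tuple H => pure [tuple of a :: w]) (iterDelta m b))
      (Delta h)
  end.

Definition conjugation n (h : H) (t : n.-tuple H) : tpow H n :=
  mext (fun w : n.*2.-tuple H =>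
    pure [tuple w`_(i.*2) * tnth t i * S w`_(i.*2.+1) | i < n])
    (iterDelta n.*2 h).

Definition conj_rel n : set (tpow H n) :=
  [set x | exists h t, x = conjugation (h - (eps h)%:A) t].

Definition Hbar n := quotmod (@conj_rel n).
HB.instance Definition _ n := GRing.Lmodule.on (Hbar n).
HB.instance Definition _ n := Quotient.on (Hbar n).

Definition tau_tens : tpow H 2 -> tpow H 2 := sweedler (fun a b => tens b a).
Definition delta_tens : tpow H 2 -> tpow H 2 :=
  sweedler (fun a b => tens (S a) b).
Definition gamma_tens : tpow H 2 -> tpow H 2 :=
  sweedler (fun a b =>
    sweedler (fun b1 b2 => tens (S b1) (a * S b2)) (Delta b)).

(* tau, delta and gamma commute with conjugation when H is cocommutative, so
   that the maps they induce do not depend on the representative. *)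
Definition induced (f : tpow H 2 -> tpow H 2) (x : Hbar 2) : Hbar 2 :=
  \pi_(Hbar 2) (f (repr x)).

Definition tau := induced tau_tens.
Definition delta := induced delta_tens.
Definition gamma := induced gamma_tens.

(* The span of this set is <Id - tau, Id + delta, Id + gamma + gamma^2>. *)
Definition operator_images : set (Hbar 2) :=
  range (fun x => x - tau x) `|` range (fun x => x + delta x)
  `|` range (fun x => x + gamma x + gamma (gamma x)).

Definition explicit_relations : set (Hbar 2) :=
  [set x | exists a b : H,
     [\/ x = \pi_(Hbar 2) (tens a b) - \pi_(Hbar 2) (tens b a),
         x = \pi_(Hbar 2) (tens a b) + \pi_(Hbar 2) (tens (S a) b) |
         x = \pi_(Hbar 2) (tens a b)
           + \pi_(Hbar 2) (sweedler (fun a1 a2 => tens (S a1 * b) (S a2)) (Delta a))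
           + \pi_(Hbar 2) (sweedler (fun b1 b2 => tens (S b1) (S b2 * a)) (Delta b))]].

(* Rooted trees with slots labelled by natural numbers, made of oriented
   trivalent vertices and of bivalent vertices carrying an element of H. Such
   trees are the composites of elements of H with trees in Lie, so that they
   span the cyclic operad freely generated by H and Lie. The root of Bead h t
   is the output of h, whose input is glued to the root of t. The cyclic order
   at the trivalent vertex of Br s t is (s, t, root). *)
Inductive term :=
  | Slot of nat
  | Bead of H & term
  | Br of term & term.

HB.instance Definition _ := gen_eqMixin term.
HB.instance Definition _ := gen_choiceMixin term.

(* (s, t) is the unrooted tree obtained by joining the roots of s and t. Thus
   an unrooted tree is encoded together with one of its edges; the
   constructors HLie_flip, HLie_shift and HLie_antipode below let this edge
   move freely. *)
Definition tree : Type := (term * term)%type.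

Fixpoint term_slots (t : term) : seq nat :=
  match t with
  | Slot x => [:: x]
  | Bead _ s => term_slots s
  | Br s u => term_slots s ++ term_slots u
  end.

Definition slots (T : tree) : seq nat := term_slots T.1 ++ term_slots T.2.

(* Rooted planar trivalent trees, which span Lie[n] up to the labelling of
   the inputs. *)
Inductive lie_shape := Input | Bracket of lie_shape & lie_shape.

Fixpoint arity (o : lie_shape) : nat :=
  match o with Input => 1 | Bracket p q => arity p + arity q end.

Fixpoint graft (o : lie_shape) (ts : seq term) : term :=
  match o with
  | Input => head (Slot 0) ts
  | Bracket p q => Br (graft p (take (arity p) ts)) (graft q (drop (arity p) ts))
  end.

Definition beads (hs : seq H) (ts : seq term) : seq term :=
  [seq Bead p.1 p.2 | p <- zip hs ts].

(* HLie((X)) is the span of the trees whose slots are the elements of X, each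
   occurring once, modulo these relations. They need only be imposed next to
   the distinguished edge, since it can be any edge of the tree. *)
Inductive HLie_rel : {freeg tree / k} -> Prop :=
  | HLie_flip s t : HLie_rel (<< (s, t) >> - << (t, s) >>)
  | HLie_shift s t u : HLie_rel (<< (Br s t, u) >> - << (s, Br t u) >>)
  (* relations of Lie *)
  | HLie_antisym s t u : HLie_rel (<< (Br s t, u) >> + << (Br t s, u) >>)
  | HLie_IHX s t u v :
      HLie_rel (<< (Br (Br s t) u, v) >> + << (Br (Br t u) s, v) >>
                + << (Br (Br u s) t, v) >>)
  (* relations of H; HLie_one identifies the units of H and Lie *)
  | HLie_linear c g h t u :
      HLie_rel (<< (Bead (c *: g + h) t, u) >> - c *: << (Bead g t, u) >>
                - << (Bead h t, u) >>)
  | HLie_mul g h t u :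
      HLie_rel (<< (Bead g (Bead h t), u) >> - << (Bead (g * h) t, u) >>)
  | HLie_one t u : HLie_rel (<< (Bead 1 t, u) >> - << (t, u) >>)
  | HLie_antipode h t u :
      HLie_rel (<< (Bead h t, u) >> - << (t, Bead (S h) u) >>)
  (* mixed relation; by HLie_linear the span of the relations does not depend
     on the expression of h_(1) (x) ... (x) h_(n) chosen by mext *)
  | HLie_distr h o ts u : size ts = arity o ->
      HLie_rel (<< (Bead h (graft o ts), u) >>
                - mext (fun w : (arity o).-tuple H =>
                          << (graft o (beads w ts), u) >>)
                       (iterDelta (arity o) h)).

(* reroot x s c is the tree (s, c) viewed from its slot x, where x occurs
   in s. *)
Fixpoint reroot (x : nat) (s c : term) : term :=
  match s with
  | Slot _ => c
  | Bead h t => reroot x t (Bead (S h) c)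
  | Br t u => if x \in term_slots t then reroot x t (Br u c)
              else reroot x u (Br c t)
  end.

Definition root_at (x : nat) (T : tree) : term :=
  if x \in term_slots T.1 then reroot x T.1 T.2 else reroot x T.2 T.1.

(* The slots x of T and y of U are glued into the distinguished edge. *)
Definition compose (x y : nat) (T U : tree) : tree := (root_at x T, root_at y U).

(* An oriented graph: the ordered list of its vertices, each of them decorated
   by a tree whose slots are the adjacent half-edges, and the list of its
   directed edges, which are pairs of half-edges. As the decorations are
   multilinear and trees span HLie, decorating by trees is enough once
   HLie_rel is imposed at each vertex. *)
Definition graph := (seq tree * seq (nat * nat))%type.

Definition half_edges (G : graph) : seq nat := flatten (map slots G.1).

Definition edge_ends (G : graph) : seq nat :=
  flatten [seq [:: e.1; e.2] | e <- G.2].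

Definition adjacent (G : graph) (i j : 'I_(size G.1)) : bool :=
  let at_vertex x (l : 'I_(size G.1)) := x \in slots (tnth (in_tuple G.1) l) in
  has (fun e => at_vertex e.1 i && at_vertex e.2 j
                || at_vertex e.1 j && at_vertex e.2 i) G.2.

Definition connected (G : graph) : bool :=
  (0 < size G.1)%N && [forall i, forall j, connect (@adjacent G) i j].

Definition is_graph (n v : nat) (G : graph) : bool :=
  [&& uniq (half_edges G), perm_eq (edge_ends G) (half_edges G),
      all (fun T => 1 < size (slots T))%N G.1, connected G,
      (size G.2).+1 == (n + size G.1)%N & size G.1 == v].

(* chains of connected graphs of rank n with v vertices, before imposing the
   relations *)
Definition graph_span (n v : nat) : set {freeg graph / k} :=
  [set x | {in dom x, forall G, is_graph n v G}].

Fixpoint rename_term (f : nat -> nat) (t : term) : term :=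
  match t with
  | Slot x => Slot (f x)
  | Bead h s => Bead h (rename_term f s)
  | Br s u => Br (rename_term f s) (rename_term f u)
  end.

Definition rename (f : nat -> nat) (G : graph) : graph :=
  ([seq (rename_term f T.1, rename_term f T.2) | T <- G.1],
   [seq (f e.1, f e.2) | e <- G.2]).

Inductive graph_rel : {freeg graph / k} -> Prop :=
  | graph_iso f G : injective f -> graph_rel (<< G >> - << rename f G >>)
  | graph_edges vs es es' : perm_eq es es' ->
      graph_rel (<< (vs, es) >> - << (vs, es') >>)
  | graph_swap vs T U ws es :
      graph_rel (<< (vs ++ T :: U :: ws, es) >>
                 + << (vs ++ U :: T :: ws, es) >>)
  | graph_reverse vs es x y es' :
      graph_rel (<< (vs, es ++ (x, y) :: es') >>
                 + << (vs, es ++ (y, x) :: es') >>)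
  | graph_vertex vs ws es r : HLie_rel r ->
      graph_rel (fglift (fun T => << (vs ++ T :: ws, es) >>) r).

(* bead_at h x composes the input x with h: the output of h is glued to the
   slot x, the input of h being the new slot. *)
Fixpoint bead_at (h : H) (x : nat) (t : term) : term :=
  match t with
  | Slot y => if y == x then Bead h (Slot y) else Slot y
  | Bead g s => Bead g (bead_at h x s)
  | Br s u => Br (bead_at h x s) (bead_at h x u)
  end.

Definition graph_bead_at (h : H) (x : nat) (G : graph) : graph :=
  ([seq (bead_at h x T.1, bead_at h x T.2) | T <- G.1], G.2).

(* An element of H directed towards the vertex at one end of an edge is, once
   it has been moved to the other end, directed away from the vertex there,
   hence the antipode. *)
Inductive slide_rel : {freeg graph / k} -> Prop :=
  | slide h x y G : (x, y) \in G.2 ->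
      slide_rel (<< graph_bead_at h x G >> - << graph_bead_at (S h) y G >>).

(* chains of rank n with v vertices that vanish in the quotient complex *)
Definition chain_rel (n v : nat) : set {freeg graph / k} :=
  (graph_rel `|` slide_rel) `&` graph_span n v.

Definition vertex_of (G : graph) (x : nat) : nat :=
  find (fun T => x \in slots T) G.1.

(* Contraction of the edge e, from the i-th to the j-th vertex. The orientation
   is first changed so that these are the first and the second vertex, which
   is the purpose of contract_sign; the new vertex then comes first. *)
Definition contract (G : graph) (e : nat * nat) : graph :=
  let i := vertex_of G e.1 in
  let j := vertex_of G e.2 in
  let v := nth (Slot 0, Slot 0) G.1 in
  (compose e.1 e.2 (v i) (v j)
     :: [seq v l | l <- iota 0 (size G.1) & (l != i) && (l != j)],
   rem e G.2).

Definition contract_sign (G : graph) (e : nat * nat) : k :=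
  let i := vertex_of G e.1 in
  let j := vertex_of G e.2 in
  (-1) ^+ (i + j + (i < j))%N.

Definition boundary : {freeg graph / k} -> {freeg graph / k} :=
  fglift (fun G : graph =>
    \sum_(e <- G.2 | vertex_of G e.1 != vertex_of G e.2)
      contract_sign G e *: << contract G e >>).

HB.instance Definition _ := GRing.Linear.on boundary.

(* A chain before imposing the relations represents a cycle of the quotient
   complex when its boundary vanishes there. *)
Definition is_cycle (n v : nat) : {pred {freeg graph / k}} := fun x =>
  `[< graph_span n v x >] && (boundary x \in lspan (chain_rel n v.-1)).

Lemma is_cycle_submod_closed n v : submod_closed (is_cycle n v).
Proof.
split=> [|c x y /andP[/asboolP gx dx] /andP[/asboolP gy dy]].
  by apply/andP; split; [apply/asboolP => G; rewrite dom0|rewrite linear0 rpred0].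
apply/andP; split; last by rewrite linearP rpredD// rpredZ.
apply/asboolP => G /domD_subset; rewrite mem_cat => /orP[/domZ_subset|].
  exact: gx.
exact: gy.
Qed.

HB.instance Definition _ n v := GRing.isSubmodClosed.Build k {freeg graph / k}
  (is_cycle n v) (is_cycle_submod_closed n v).

Record cycles (n v : nat) := Cycle {
  chain_of_cycle : {freeg graph / k};
  _ : chain_of_cycle \in is_cycle n v
}.

HB.instance Definition _ n v := [isSub for @chain_of_cycle n v].
HB.instance Definition _ n v := [Choice of cycles n v by <:].
HB.instance Definition _ n v := [SubChoice_isSubLmodule of cycles n v by <:].

Definition boundaries (n v : nat) : set (cycles n v) :=
  [set z | chain_of_cycle z \in
     lspan (chain_rel n v `|` boundary @` graph_span n v.+1)].

Definition graph_homology (n v : nat) := quotmod (@boundaries n v).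
HB.instance Definition _ n v := GRing.Lmodule.on (graph_homology n v).

End HopfLie.

(* the space denoted by a script H_n(H) *)
Definition scrH (k : fieldType) (n : nat) (H : hopfAlgebra k) : lmodType k :=
  graph_homology H n 1.

(* Main.v *)
(* A tree decorated by H is evaluated in the tensor algebra on the letters (slot, bead), with
   brackets sent to commutators. Pairing with the cyclic weight carried by the words in which
   the ends of the two edges alternate, with value hol(e) (x) hol(e') for hol(x, y) =
   h_y S(h_x), defines a map from one-vertex graphs of rank two to the quotient of the
   coinvariants. It respects the relations of HLie, because the weight is cyclic and
   invariant under conjugation, and it kills the boundaries of two-vertex graphs: theta
   graphs give relation (3), dumbbells give 0, and the two terms of a graph with a bivalent
   vertex cancel after sliding. Conversely, contracting a dumbbell shows that trees
   bracketing the two ends of one edge vanish in homology; after pushing beads to the leaves,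
   IHX and antisymmetry reduce every graph to the class of one tree decorated by a, b, which
   satisfies the three relations and has weight 2 a (x) b. As 2 is invertible, the two maps
   are inverse to each other up to this factor. *)
From HB Require Import structures.
Require Import Defs.
From mathcomp Require Import all_boot all_order all_algebra.
From mathcomp Require Import generic_quotient ring_quotient.
From mathcomp Require Import boolp classical_sets.
From mathcomp Require Import freeg.

Set Implicit Arguments.
Unset Strict Implicit.
Unset Printing Implicit Defensive.

Import GRing.Theory.
Local Open Scope ring_scope.
Local Open Scope classical_set_scope.
Local Open Scope quotient_scope.

(** HLie is given by generators and relations, while rerooting and contraction are defined on trees
    only. So a map out of HLie is kept as a function on trees whose linear extension kills the
    relations, and one reduction to normal trees serves both for the weight and for the classes in
    homology. The shape of the weight is forced. Reversing an edge turns its holonomy g into S(g)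
    and the orientation into its opposite, which is relation (2); exchanging the edges is relation
    (1); H acting on all letters conjugates both holonomies at once, whence the coinvariants.
    Rotating a word of four letters exchanges its two diagonals and reverses one of them, so
    relations (1) and (2) are what makes the weight cyclic. If x, y and z, w are the ends of the
    edges, no word of [x,y][z,w] alternates, while two of the four words of [x,z][y,w] do: this is
    the origin of the 2. *)

Lemma pred0_submod_closed (k : fieldType) (M : lmodType k) :
  submod_closed (pred1 (0 : M)).
Proof. by split=> [|c a b /eqP-> /eqP->]; rewrite inE // scaler0 addr0. Qed.

(** * Linear maps out of spans, quotients and free modules *)

Section Linear.
Variables (k : fieldType) (V M : lmodType k) (f : V -> M).
Hypothesis flin : linear f.

(** Maps stay plain functions with a linearity hypothesis, since many carry parameters or pass
    through chosen representatives. Packing one locally makes the library lemmas on linear maps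
    available. *)
Lemma linear_packed : exists F : {linear V -> M}, F = f :> (V -> M).
Proof.
pose F : {linear V -> M} := HB.pack_for {linear V -> M} f (GRing.isLinear.Build _ _ _ _ f flin).
by exists F.
Qed.

Lemma lin0 : f 0 = 0.
Proof. by have [F <-] := linear_packed; rewrite linear0. Qed.

Lemma linD a b : f (a + b) = f a + f b.
Proof. by have [F <-] := linear_packed; rewrite linearD. Qed.

Lemma linN a : f (- a) = - f a.
Proof. by have [F <-] := linear_packed; rewrite linearN. Qed.

Lemma linB a b : f (a - b) = f a - f b.
Proof. by have [F <-] := linear_packed; rewrite linearB. Qed.

Lemma linZ c a : f (c *: a) = c *: f a.
Proof. by have [F <-] := linear_packed; rewrite linearZ. Qed.

Lemma lin_sum I (r : seq I) (P : pred I) (F : I -> V) :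
  f (\sum_(i <- r | P i) F i) = \sum_(i <- r | P i) f (F i).
Proof. by have [G <-] := linear_packed; rewrite linear_sum. Qed.

(** An arbitrary submodule [Z] serves two purposes: zero for vanishing statements, a span for
    inclusions between spans. *)
Lemma lspan_rect (A : set V) (Z : {pred M}) :
  submod_closed Z -> (forall x, A x -> f x \in Z) ->
  forall x, x \in lspan A -> f x \in Z.
Proof.
move=> [Z0 ZP] AZ x /asboolP[s sA ->]; rewrite lin_sum.
elim: s sA => [|p s IHs] sA; first by rewrite big_nil.
rewrite big_cons linZ; apply: ZP; first by apply/AZ/sA; rewrite mem_head.
by apply: IHs => q qs; apply: sA; rewrite in_cons qs orbT.
Qed.

Lemma lspan_eq0 (A : set V) :
  (forall x, A x -> f x = 0) -> forall x, x \in lspan A -> f x = 0.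
Proof.
move=> A0 x xA; apply/eqP.
by apply: (lspan_rect (@pred0_submod_closed k M)) xA => y /A0/eqP.
Qed.

End Linear.

Lemma lspan_sub (k : fieldType) (V : lmodType k) (A B : set V) :
  (forall x, A x -> x \in lspan B) -> {subset lspan A <= lspan B}.
Proof.
by move=> AB x; apply: (@lspan_rect _ _ _ id) => //; exact: lspan_submod_closed.
Qed.

Section Quotient.
Variables (k : fieldType) (V M : lmodType k) (A : set V).

Lemma pi_linear : linear (\pi_(quotmod A)).
Proof. by move=> c a b; rewrite quotmodD -quotmod_scaleE. Qed.

Lemma pi_eq0 x : (\pi_(quotmod A) x == 0) = (x \in lspan A).
Proof.
have -> : 0 = \pi_(quotmod A) 0 by rewrite (lin0 pi_linear).
by rewrite -[in RHS](subr0 x); apply/eqP/idP => /quotmodP.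
Qed.

Lemma pi0 x : A x -> \pi_(quotmod A) x = 0.
Proof. by move=> Ax; apply/eqP; rewrite pi_eq0 sub_lspan. Qed.

(** Evaluation at the chosen representative. It factors [f] through the quotient once [f] is linear
    and kills [A], see [qliftE]. *)
Definition qlift (f : V -> M) (x : quotmod A) : M := f (repr x).

Variable f : V -> M.
Hypotheses (flin : linear f) (fA : forall x, A x -> f x = 0).

Lemma qliftE x : qlift f (\pi_(quotmod A) x) = f x.
Proof.
apply/eqP; rewrite -subr_eq0 -(linB flin); apply/eqP.
by apply: (lspan_eq0 flin fA); apply/quotmodP; rewrite reprK.
Qed.

Lemma qlift_linear : linear (qlift f).
Proof.
by move=> c a b; rewrite -[a]reprK -[b]reprK -pi_linear !qliftE flin.
Qed.

End Quotient.

Lemma freegUZ (k : fieldType) (K : choiceType) (c : k) (z : K) :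
  << c *g z >> = c *: << z >> :> {freeg K / k}.
Proof. by apply/eqP/freeg_eqP => x; rewrite coeffZ !coeffU mul1r. Qed.

Section Freeg.
Variables (k : fieldType) (K : choiceType) (M : lmodType k).
Implicit Type f : K -> M.

Lemma fgliftU f x : fglift f (<< x >> : {freeg K / k}) = f x.
Proof. by rewrite liftU scale1r. Qed.

Lemma fglift_lin f : linear (fglift f : {freeg K / k} -> M).
Proof. exact: fglift_is_linear. Qed.

Lemma fgliftE f (D : {freeg K / k}) :
  fglift f D = \sum_(z <- dom D) coeff z D *: f z.
Proof.
rewrite -{1}[D]freeg_sumE (lin_sum (fglift_lin f)).
by apply: eq_bigr => z _; rewrite liftU.
Qed.

Lemma eq_fglift f g (D : {freeg K / k}) :
  {in dom D, f =1 g} -> fglift f D = fglift g D.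
Proof.
by move=> fg; rewrite !fgliftE; apply: eq_big_seq => z /fg->.
Qed.

End Freeg.

Section FreegMorphisms.
Variables (k : fieldType) (K : choiceType) (M : lmodType k).
Implicit Type f : K -> M.

Lemma fglift_comp (N : lmodType k) (g : M -> N) f (D : {freeg K / k}) :
  linear g -> g (fglift f D) = fglift (g \o f) D.
Proof.
move=> gl; rewrite !fgliftE (lin_sum gl).
by apply: eq_bigr => z _; rewrite (linZ gl).
Qed.

Lemma freeg_linear_ext (f g : {freeg K / k} -> M) :
  linear f -> linear g -> (forall x, f << x >> = g << x >>) -> f =1 g.
Proof.
move=> fl gl fg D; rewrite -[D]freeg_sumE !lin_sum //; apply: eq_bigr => z _.
by rewrite freegUZ !linZ ?fg.
Qed.

End FreegMorphisms.

(** * Tensor powers and multilinear maps *)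

Section TensorPower.
Variables (k : fieldType) (V : lmodType k).

Lemma pure_multilinear n : multilinear (@pure k V n).
Proof.
move=> t i c a b; rewrite /pure -(pi_linear (@multilinear_rel k V n)).
apply/quotmodP/sub_lspan; exists t, i, c, a, b.
by rewrite opprD addrA.
Qed.

Lemma mextE n (M : lmodType k) (f : n.-tuple V -> M) t :
  multilinear f -> mext f (pure t) = f t.
Proof. by move=> fl; rewrite mext_pi // fgliftU. Qed.

Lemma mext_linear n (M : lmodType k) (f : n.-tuple V -> M) :
  multilinear f -> linear (mext f).
Proof.
move=> fl c x y; rewrite -[x]reprK -[y]reprK.
by rewrite -(pi_linear (@multilinear_rel k V n)) !mext_pi // fglift_lin.
Qed.

Lemma tpow_linear_ext n (M : lmodType k) (f g : tpow V n -> M) :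
  linear f -> linear g -> (forall t, f (pure t) = g (pure t)) -> f =1 g.
Proof.
move=> fl gl fg x; rewrite -[x]reprK.
have pl := pi_linear (@multilinear_rel k V n).
apply: (freeg_linear_ext (f := fun D => f (\pi_(tpow V n) D))
  (g := fun D => g (\pi_(tpow V n) D))) => [c a b|c a b|t].
- by rewrite pl fl.
- by rewrite pl gl.
- exact: fg.
Qed.

Lemma mext_comp n (M N : lmodType k) (g : M -> N) (f : n.-tuple V -> M) x :
  linear g -> g (mext f x) = mext (g \o f) x.
Proof. exact: fglift_comp. Qed.

End TensorPower.

Lemma tuple2_eta (T : Type) (t : 2.-tuple T) : t = [tuple tnth t 0; tnth t 1].
Proof.
by apply: eq_from_tnth; case=> -[|[|//]] i /=; congr tnth; apply: val_inj.
Qed.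

Section Multilinear.
Variables (k : fieldType) (V M : lmodType k).

Definition bilin (f : V -> V -> M) :=
  (forall b, linear (fun a => f a b)) /\ (forall a, linear (f a)).

Definition trilin (f : V -> V -> V -> M) :=
  [/\ forall b c, linear (fun a => f a b c), forall a c, linear (fun b => f a b c)
    & forall a b, linear (f a b)].

Definition quadrilin (f : V -> V -> V -> V -> M) :=
  [/\ forall b c d, linear (fun a => f a b c d),
      forall a c d, linear (fun b => f a b c d),
      forall a b d, linear (fun c => f a b c d)
    & forall a b c, linear (f a b c)].

Lemma bilin_multilinear f : bilin f ->
  multilinear (fun w : 2.-tuple V => f (tnth w 0) (tnth w 1)).
Proof.
case=> f1 f2 t i c a b; rewrite !tnth_mktuple.
by case: i => [[|[|//]] Hi]; rewrite /= ?f1 ?f2.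
Qed.

Lemma trilin_multilinear f : trilin f ->
  multilinear (fun w : 3.-tuple V => f (tnth w 0) (tnth w 1) (tnth w 2)).
Proof.
case=> f1 f2 f3 t i c a b; rewrite !tnth_mktuple.
by case: i => [[|[|[|//]]] Hi]; rewrite /= ?f1 ?f2 ?f3.
Qed.

End Multilinear.

Section LinearRules.
Variables (k : fieldType).

Lemma linear_idfun (V : lmodType k) : linear (fun x : V => x).
Proof. by []. Qed.

Lemma linear_cst0 (V M : lmodType k) : linear (fun _ : V => 0 : M).
Proof. by move=> c a b; rewrite scaler0 addr0. Qed.

Lemma linear_comp (V W M : lmodType k) (f : W -> M) (g : V -> W) :
  linear f -> linear g -> linear (fun x => f (g x)).
Proof. by move=> fl gl c a b; rewrite gl fl. Qed.

Lemma linear_scale (V M : lmodType k) c (f : V -> M) :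
  linear f -> linear (fun x => c *: f x).
Proof. by move=> fl d a b; rewrite fl scalerDr !scalerA mulrC. Qed.

Lemma linear_add (V M : lmodType k) (f g : V -> M) :
  linear f -> linear g -> linear (fun x => f x + g x).
Proof. by move=> fl gl d a b; rewrite fl gl scalerDr addrACA. Qed.

Lemma linear_opp (V M : lmodType k) (f : V -> M) :
  linear f -> linear (fun x => - f x).
Proof. by move=> fl d a b; rewrite fl opprD scalerN. Qed.

Lemma linear_bigsum (V M : lmodType k) I (r : seq I) (f : V -> I -> M) :
  (forall i, linear (f^~ i)) -> linear (fun x => \sum_(i <- r) f x i).
Proof.
move=> fl d a b; rewrite scaler_sumr -big_split; apply: eq_bigr => i _.
exact: fl.
Qed.

Lemma linear_mull (V : lmodType k) (A : algType k) (f : V -> A) c :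
  linear f -> linear (fun x => f x * c).
Proof. by move=> fl d a b; rewrite fl mulrDl scalerAl. Qed.

Lemma linear_mulr (V : lmodType k) (A : algType k) (f : V -> A) c :
  linear f -> linear (fun x => c * f x).
Proof. by move=> fl d a b; rewrite fl mulrDr scalerAr. Qed.

Lemma linear_bilin1 (V W M : lmodType k) (F : W -> W -> M) (g : V -> W) b :
  bilin F -> linear g -> linear (fun x => F (g x) b).
Proof. by move=> [F1 _] gl; apply: (linear_comp (F1 b) gl). Qed.

Lemma linear_bilin2 (V W M : lmodType k) (F : W -> W -> M) (g : V -> W) a :
  bilin F -> linear g -> linear (fun x => F a (g x)).
Proof. by move=> [_ F2] gl; apply: (linear_comp (F2 a) gl). Qed.

Lemma linear_trilin1 (V W M : lmodType k) (F : W -> W -> W -> M)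
  (g : V -> W) b c :
  trilin F -> linear g -> linear (fun x => F (g x) b c).
Proof. by move=> [F1 _ _] gl; apply: (linear_comp (F1 b c) gl). Qed.

Lemma linear_trilin2 (V W M : lmodType k) (F : W -> W -> W -> M)
  (g : V -> W) a c :
  trilin F -> linear g -> linear (fun x => F a (g x) c).
Proof. by move=> [_ F2 _] gl; apply: (linear_comp (F2 a c) gl). Qed.

Lemma linear_trilin3 (V W M : lmodType k) (F : W -> W -> W -> M)
  (g : V -> W) a b :
  trilin F -> linear g -> linear (fun x => F a b (g x)).
Proof. by move=> [_ _ F3] gl; apply: (linear_comp (F3 a b) gl). Qed.

Lemma linear_quadrilin1 (V W M : lmodType k) (F : W -> W -> W -> W -> M)
  (g : V -> W) b c d :
  quadrilin F -> linear g -> linear (fun x => F (g x) b c d).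
Proof. by move=> [F1 _ _ _] gl; apply: (linear_comp (F1 b c d) gl). Qed.

Lemma linear_quadrilin2 (V W M : lmodType k) (F : W -> W -> W -> W -> M)
  (g : V -> W) a c d :
  quadrilin F -> linear g -> linear (fun x => F a (g x) c d).
Proof. by move=> [_ F2 _ _] gl; apply: (linear_comp (F2 a c d) gl). Qed.

Lemma linear_quadrilin3 (V W M : lmodType k) (F : W -> W -> W -> W -> M)
  (g : V -> W) a b d :
  quadrilin F -> linear g -> linear (fun x => F a b (g x) d).
Proof. by move=> [_ _ F3 _] gl; apply: (linear_comp (F3 a b d) gl). Qed.

Lemma linear_quadrilin4 (V W M : lmodType k) (F : W -> W -> W -> W -> M)
  (g : V -> W) a b c :
  quadrilin F -> linear g -> linear (fun x => F a b c (g x)).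
Proof. by move=> [_ _ _ F4] gl; apply: (linear_comp (F4 a b c) gl). Qed.

End LinearRules.

(** * Sweedler calculus *)

Section Sweedler.
Variables (k : fieldType) (H : hopfAlgebra k).
Local Notation S := (@antipode k H).
Local Notation eps := (@counit k H).

(* A chosen expression of [Delta h] as a finite sum of pure tensors: Sweedler sums
   become sums over a sequence, which can be exchanged and rewritten under. *)
Definition delta_seq (h : H) : seq (H * H) :=
  [seq (coeff z (repr (Delta h)) *: tnth z 0, tnth z 1)
     | z : 2.-tuple H <- dom (repr (Delta h))].

Definition sw (M : lmodType k) (f : H -> H -> M) (h : H) : M :=
  \sum_(p <- delta_seq h) f p.1 p.2.

Lemma linear_antipode (V : lmodType k) (f : V -> H) :
  linear f -> linear (fun x => S (f x)).
Proof. by move=> fl c a b; rewrite fl linearP. Qed.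

Lemma linear_counit (V M : lmodType k) (f : V -> H) (m : M) :
  linear f -> linear (fun x => eps (f x) *: m).
Proof. by move=> fl c a b; rewrite fl linearP scalerDl scalerA. Qed.

Lemma linear_sw (V M : lmodType k) (f : V -> H -> H -> M) h :
  (forall a b, linear (fun x => f x a b)) -> linear (fun x => sw (f x) h).
Proof. by move=> fl; apply: linear_bigsum => p; apply: fl. Qed.

(** The coefficients in [delta_seq] sit on the first tensor factor, so linearity in the first
    argument moves them out. *)
Lemma sweedlerE (M : lmodType k) (f : H -> H -> M) h :
  (forall b, linear (f^~ b)) -> sweedler f (Delta h) = sw f h.
Proof.
move=> f1; rewrite /sweedler /mext fgliftE [RHS]big_map.
by apply: eq_bigr => z _; rewrite (linZ (f1 _)).
Qed.

Lemma bilin_tens : bilin (@tens k H).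
Proof.
split=> [b c a a'|a c b b']; rewrite /tens.
  have := @pure_multilinear k H 2 [tuple a; b] 0 c a a'.
  by congr (_ = _ *: _ + _); congr pure; apply: eq_from_tnth;
    case=> -[|[|//]] i; rewrite tnth_mktuple.
have := @pure_multilinear k H 2 [tuple a; b] 1 c b b'.
by congr (_ = _ *: _ + _); congr pure; apply: eq_from_tnth;
  case=> -[|[|//]] i; rewrite tnth_mktuple.
Qed.

Lemma sweedler_tens (M : lmodType k) (f : H -> H -> M) a b :
  bilin f -> sweedler f (tens a b) = f a b.
Proof. by move=> /bilin_multilinear fl; rewrite /sweedler mextE. Qed.

Lemma sweedler_linear (M : lmodType k) (f : H -> H -> M) :
  bilin f -> linear (sweedler f).
Proof. by move=> /bilin_multilinear; apply: mext_linear. Qed.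

Lemma linear_sw_arg (V M : lmodType k) (f : H -> H -> M) (g : V -> H) :
  bilin f -> linear g -> linear (fun x => sw f (g x)).
Proof.
move=> fl gl c a b; rewrite -!sweedlerE; try exact: fl.1.
by rewrite gl linearP sweedler_linear.
Qed.

Lemma eq_sw (M : lmodType k) (f g : H -> H -> M) h :
  (forall a b, f a b = g a b) -> sw f h = sw g h.
Proof. by move=> fg; apply: eq_bigr => p _; rewrite fg. Qed.

Lemma sw_comp (M N : lmodType k) (g : M -> N) (f : H -> H -> M) h :
  linear g -> g (sw f h) = sw (fun a b => g (f a b)) h.
Proof. by move=> gl; rewrite /sw (lin_sum gl). Qed.

Lemma sw_exchange (M : lmodType k) (f : H -> H -> H -> H -> M) g h :
  sw (fun a b => sw (fun c d => f a b c d) h) g =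
  sw (fun c d => sw (fun a b => f a b c d) g) h.
Proof. exact: exchange_big. Qed.

End Sweedler.

(** The rules peel the outermost operation off [fun x => ...] by higher-order matching; the last
    case eta-expands a partial application so that the other patterns can see it. *)
Ltac linear_step :=
  match goal with
  | |- forall _, _ => intro
  | |- bilin _ => split
  | |- trilin _ => split
  | |- quadrilin _ => split
  | |- GRing.linear_for _ _ => assumption
  | |- GRing.linear_for _ (fun _ => 0) => exact: linear_cst0
  | |- GRing.linear_for _ (fun x => x) => exact: linear_idfun
  | F2 : bilin ?F |- GRing.linear_for _ (?F _) => exact: F2.2
  | F2 : trilin ?F |- GRing.linear_for _ (?F _ _) => case: F2
  | |- GRing.linear_for _ (fun x => sw (@?f x) ?h) =>
      refine (linear_sw (f := f) h _)
  | |- GRing.linear_for _ (fun x => sw ?f (@?g x)) =>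
      refine (linear_sw_arg (f := f) (g := g) _ _)
  | |- GRing.linear_for _ (fun x => @GRing.Linear.sort _ _ _ _ (@antipode _ _) (@?f x)) =>
      refine (linear_antipode (f := f) _)
  | |- GRing.linear_for _ (fun x => @GRing.mul _ (@?f x) ?c) =>
      refine (linear_mull (f := f) c _)
  | |- GRing.linear_for _ (fun x => @GRing.mul _ ?c (@?f x)) =>
      refine (linear_mulr (f := f) c _)
  | |- GRing.linear_for _ (fun x => @GRing.scale _ _ ?c (@?f x)) =>
      refine (linear_scale c (f := f) _)
  | |- GRing.linear_for _ (fun x => @GRing.scale _ _ (@GRing.LRMorphism.sort _ _ _ _ _ (@?f x)) ?c) =>
      refine (linear_counit (f := f) c _)
  | |- GRing.linear_for _ (fun x => @Algebra.add _ (@?f x) (@?g x)) =>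
      refine (linear_add (f := f) (g := g) _ _)
  | |- GRing.linear_for _ (fun x => @Algebra.opp _ (@?f x)) =>
      refine (linear_opp (f := f) _)
  | |- GRing.linear_for _ (fun x => tens (@?g x) ?b) =>
      refine (linear_bilin1 (g := g) b (bilin_tens _) _)
  | |- GRing.linear_for _ (fun x => tens ?a (@?g x)) =>
      refine (linear_bilin2 (g := g) a (bilin_tens _) _)
  | F2 : bilin ?F |- GRing.linear_for _ (fun x => ?F (@?g x) ?b) =>
      refine (linear_bilin1 (g := g) b F2 _)
  | F2 : bilin ?F |- GRing.linear_for _ (fun x => ?F ?a (@?g x)) =>
      refine (linear_bilin2 (g := g) a F2 _)
  | F3 : trilin ?F |- GRing.linear_for _ (fun x => ?F (@?g x) ?b ?c) =>
      refine (linear_trilin1 (g := g) b c F3 _)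
  | F3 : trilin ?F |- GRing.linear_for _ (fun x => ?F ?a (@?g x) ?c) =>
      refine (linear_trilin2 (g := g) a c F3 _)
  | F3 : trilin ?F |- GRing.linear_for _ (fun x => ?F ?a ?b (@?g x)) =>
      refine (linear_trilin3 (g := g) a b F3 _)
  | F4 : quadrilin ?F |- GRing.linear_for _ (fun x => ?F (@?g x) ?b ?c ?d) =>
      refine (linear_quadrilin1 (g := g) b c d F4 _)
  | F4 : quadrilin ?F |- GRing.linear_for _ (fun x => ?F ?a (@?g x) ?c ?d) =>
      refine (linear_quadrilin2 (g := g) a c d F4 _)
  | F4 : quadrilin ?F |- GRing.linear_for _ (fun x => ?F ?a ?b (@?g x) ?d) =>
      refine (linear_quadrilin3 (g := g) a b d F4 _)
  | F4 : quadrilin ?F |- GRing.linear_for _ (fun x => ?F ?a ?b ?c (@?g x)) =>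
      refine (linear_quadrilin4 (g := g) a b c F4 _)
  | F1 : GRing.linear_for _ ?F |- GRing.linear_for _ (fun x => ?F (@?g x)) =>
      refine (linear_comp (g := g) F1 _)
  | |- GRing.linear_for ?s ?f =>
      lazymatch f with
      | fun _ => _ => fail
      | _ => change (GRing.linear_for s (fun x => f x))
      end
  end.

Ltac linear_auto := repeat (cbv beta; linear_step); try done.

Section SweedlerAxioms.
Variables (k : fieldType) (H : hopfAlgebra k).
Local Notation S := (@antipode k H).
Local Notation eps := (@counit k H).
Variable M : lmodType k.
Implicit Types (f : H -> H -> M) (g : H -> M).

Lemma sw1 f : bilin f -> sw f 1 = f 1 1.
Proof.
by move=> fl; rewrite -sweedlerE ?Delta1 ?sweedler_tens //; exact: fl.1.
Qed.

Lemma swM f a b : bilin f ->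
  sw f (a * b) = sw (fun a1 a2 => sw (fun b1 b2 => f (a1 * b1) (a2 * b2)) b) a.
Proof.
move=> fl; rewrite -sweedlerE; last exact: fl.1.
rewrite DeltaM.
have -> : (fun a1 a2 => sweedler (fun b1 b2 => tens (a1 * b1) (a2 * b2)) (Delta b))
    = fun a1 a2 => sw (fun b1 b2 => tens (a1 * b1) (a2 * b2)) b.
  by apply/funext => a1; apply/funext => a2; rewrite sweedlerE //; linear_auto.
rewrite sweedlerE; last by linear_auto.
rewrite (sw_comp _ _ (sweedler_linear fl)); apply: eq_sw => a1 a2.
rewrite (sw_comp _ _ (sweedler_linear fl)); apply: eq_sw => b1 b2.
exact: sweedler_tens.
Qed.

Lemma swC f h : cocommutative H -> bilin f ->
  sw (fun a b => f b a) h = sw f h.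
Proof.
move=> cocomm fl; rewrite -[RHS]sweedlerE; last exact: fl.1.
rewrite -cocomm sweedlerE; last by linear_auto.
rewrite (sw_comp _ _ (sweedler_linear fl)); apply: eq_sw => a b.
by rewrite sweedler_tens.
Qed.

(** A trilinear [f] factors through the third tensor power, where coassociativity equates two
    elements; the nested sums are their images. *)
Lemma swA (f : H -> H -> H -> M) h : trilin f ->
  sw (fun a c => sw (fun a b => f a b c) a) h =
  sw (fun a b => sw (fun b c => f a b c) b) h.
Proof.
move=> fl.
have pl := mext_linear (trilin_multilinear fl).
have pE a b c : mext (fun w : 3.-tuple H => f (tnth w 0) (tnth w 1) (tnth w 2))
    (pure [tuple a; b; c]) = f a b c.
  by rewrite mextE //; exact: trilin_multilinear.
have p3 : trilin (fun a b c : H => pure [tuple a; b; c]).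
  split=> [b c d a a'|a c d b b'|a b d c c'].
  - have := @pure_multilinear k H 3 [tuple a; b; c] 0 d a a'.
    by congr (_ = _ *: _ + _); congr pure; apply: eq_from_tnth;
      case=> -[|[|[|//]]] i; rewrite tnth_mktuple.
  - have := @pure_multilinear k H 3 [tuple a; b; c] 1 d b b'.
    by congr (_ = _ *: _ + _); congr pure; apply: eq_from_tnth;
      case=> -[|[|[|//]]] i; rewrite tnth_mktuple.
  - have := @pure_multilinear k H 3 [tuple a; b; c] 2 d c c'.
    by congr (_ = _ *: _ + _); congr pure; apply: eq_from_tnth;
      case=> -[|[|[|//]]] i; rewrite tnth_mktuple.
have := congr1 (mext (fun w : 3.-tuple H => f (tnth w 0) (tnth w 1) (tnth w 2)))
  (coassoc h).
have -> : (fun a b => sweedler (fun c d : H => pure [tuple c; d; b]) (Delta a))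
    = fun a b => sw (fun c d : H => pure [tuple c; d; b]) a.
  apply/funext => a; apply/funext => b; rewrite sweedlerE // => d.
  exact: linear_trilin1 p3 (@linear_idfun _ _).
have -> : (fun a b => sweedler (fun c d : H => pure [tuple a; c; d]) (Delta b))
    = fun a b => sw (fun c d : H => pure [tuple a; c; d]) b.
  apply/funext => a; apply/funext => b; rewrite sweedlerE // => d.
  exact: linear_trilin2 p3 (@linear_idfun _ _).
case: (p3) => p31 p32 p33.
rewrite sweedlerE; last first.
  by move=> b; apply: linear_sw_arg; [split=> ?; [exact: p31|exact: p32]|].
rewrite sweedlerE; last by move=> b; apply: linear_sw => c d; apply: p31.
rewrite !(sw_comp _ _ pl); congr (_ = _); apply: eq_sw => a b;
  by rewrite (sw_comp _ _ pl); apply: eq_sw => c d; rewrite pE.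
Qed.

Lemma sw_counitl g h : linear g -> sw (fun a b => eps a *: g b) h = g h.
Proof.
move=> gl; rewrite -[in RHS](counitl h) sweedlerE; last by linear_auto.
by rewrite sw_comp //; apply: eq_sw => a b; rewrite (linZ gl).
Qed.

Lemma sw_counitr g h : linear g -> sw (fun a b => eps b *: g a) h = g h.
Proof.
move=> gl; rewrite -[in RHS](counitr h) sweedlerE; last by linear_auto.
by rewrite sw_comp //; apply: eq_sw => a b; rewrite (linZ gl).
Qed.

Lemma sw_antipodel g h : linear g -> sw (fun a b => g (S a * b)) h = eps h *: g 1.
Proof.
move=> gl; rewrite -(linZ gl) -antipodel sweedlerE; last by linear_auto.
by rewrite sw_comp.
Qed.

Lemma sw_antipoder g h : linear g -> sw (fun a b => g (a * S b)) h = eps h *: g 1.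
Proof.
move=> gl; rewrite -(linZ gl) -antipoder sweedlerE; last by linear_auto.
by rewrite sw_comp.
Qed.

End SweedlerAxioms.

Section HopfIdentities.
Variables (k : fieldType) (H : hopfAlgebra k).
Local Notation S := (@antipode k H).
Local Notation eps := (@counit k H).

Lemma antipode1 : S 1 = 1.
Proof.
have := sw_antipodel 1 (@linear_idfun k H); rewrite sw1; last by linear_auto.
by rewrite mulr1 rmorph1 scale1r.
Qed.

(** Uniqueness of convolution inverses. In [Y], the sum of S(b1) S(a1) a2 b2 S(a3 b3), cancelling on
    the right leaves S(b) S(a) and cancelling on the left leaves S(a b). *)
Lemma antipodeM a b : S (a * b) = S b * S a.
Proof.
pose Y := sw (fun a1 a' => sw (fun b1 b' => sw (fun a2 a3 => sw (fun b2 b3 =>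
  S b1 * S a1 * (a2 * b2) * S (a3 * b3)) b') a') b) a.
have <- : Y = S b * S a.
  rewrite -[RHS](sw_counitr (g := fun a => S b * S a)); last by linear_auto.
  apply: eq_sw => a1 a'.
  rewrite -[RHS](sw_counitr (g := fun b => eps a' *: (S b * S a1))); last by linear_auto.
  apply: eq_sw => b1 b'.
  under eq_sw => a2 a3 do under eq_sw => b2 b3 do rewrite -mulrA.
  rewrite -(swM (f := fun x y => S b1 * S a1 * (x * S y))); last by linear_auto.
  rewrite sw_antipoder; last by linear_auto.
  by rewrite mulr1 rmorphM /= mulrC scalerA.
(* Regroup by coassociativity so that S(a1) meets a2 and then S(b1) meets b2. *)
rewrite /Y; under eq_sw => a1 a' do rewrite sw_exchange.
rewrite -(swA (f := fun a1 a2 a3 => sw (fun b1 b' => sw (fun b2 b3 =>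
  S b1 * S a1 * (a2 * b2) * S (a3 * b3)) b') b)); last by linear_auto.
rewrite -[LHS](sw_counitl (g := fun a => S (a * b))); last by linear_auto.
apply: eq_sw => a' a3.
rewrite [RHS]sw_exchange.
under [RHS]eq_sw => b1 b' do rewrite sw_exchange.
rewrite -(swA (f := fun b1 b2 b3 => sw (fun a1 a2 =>
  S b1 * S a1 * (a2 * b2) * S (a3 * b3)) a')); last by linear_auto.
rewrite -[LHS](sw_counitl (g := fun b => eps a' *: S (a3 * b))); last by linear_auto.
apply: eq_sw => b' b3.
have E b1 b2 : sw (fun a1 a2 => S b1 * S a1 * (a2 * b2) * S (a3 * b3)) a' =
    eps a' *: (S b1 * b2 * S (a3 * b3)).
  under eq_sw => a1 a2.
    rewrite -!mulrA (mulrA (S a1)); over.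
  rewrite (sw_antipodel (g := fun x => S b1 * (x * (b2 * S (a3 * b3))))).
    by rewrite mul1r mulrA.
  by linear_auto.
under eq_sw => b1 b2 do rewrite E.
rewrite (sw_antipodel (g := fun x => eps a' *: (x * S (a3 * b3)))).
  by rewrite mul1r.
by linear_auto.
Qed.

Hypothesis cocomm : cocommutative H.

Lemma sw_nest (M : lmodType k) (f : H -> H -> H -> H -> M) h : quadrilin f ->
  sw (fun p q => sw (fun p1 p2 => sw (fun q1 q2 => f p1 p2 q1 q2) q) p) h =
  sw (fun p1 r => sw (fun s q2 => sw (fun p2 q1 => f p1 p2 q1 q2) s) r) h.
Proof.
move=> fl.
rewrite (swA (f := fun p1 p2 q => sw (fun q1 q2 => f p1 p2 q1 q2) q)); last first.
  by linear_auto.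
by apply: eq_sw => p1 r; rewrite (swA (f := f p1)) //; linear_auto.
Qed.

(** By [sw_nest] the two middle legs are the halves of one factor [s], so cocommutativity exchanges
    them. *)
Lemma sw_interchange (M : lmodType k) (f : H -> H -> H -> H -> M) h :
  quadrilin f ->
  sw (fun p q => sw (fun p1 p2 => sw (fun q1 q2 => f p1 p2 q1 q2) q) p) h =
  sw (fun p q => sw (fun p1 p2 => sw (fun q1 q2 => f p1 q1 p2 q2) q) p) h.
Proof.
move=> fl; rewrite sw_nest //.
rewrite (sw_nest (f := fun a b c d => f a c b d)) //; last by linear_auto.
apply: eq_sw => p1 r; apply: eq_sw => s q2.
by rewrite -swC //; linear_auto.
Qed.

(** Delta(S(h)) and S applied to both legs of Delta(h) are convolution inverses of Delta on opposite
    sides. [Y] is their triple product with Delta in the middle; x, y, z are its factors. *)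
Lemma antipode_Delta (M : lmodType k) (f : H -> H -> M) h : bilin f ->
  sw f (S h) = sw (fun a b => f (S a) (S b)) h.
Proof.
move=> fl.
pose Y := sw (fun h1 r => sw (fun h2 h3 => sw (fun x1 x2 => sw (fun y1 y2 =>
  sw (fun z1 z2 => f (x1 * y1 * S z1) (x2 * y2 * S z2)) h3) h2) (S h1)) r) h.
transitivity Y.
  rewrite -[LHS](sw_counitr (g := fun h => sw f (S h))); last by linear_auto.
  apply: eq_sw => h1 r.
  rewrite (sw_comp (g := fun m => eps r *: m)); last by linear_auto.
  rewrite [RHS]sw_exchange; apply: eq_sw => x1 x2.
  (* The antipode axiom needs y1 paired with z1 and y2 with z2; cocommutativity allows this
     pairing. *)
  rewrite (sw_interchange (f := fun y1 y2 z1 z2 =>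
    f (x1 * y1 * S z1) (x2 * y2 * S z2))); last by linear_auto.
  rewrite -[LHS](sw_counitl (g := fun r => eps r *: f x1 x2)); last by linear_auto.
  apply: eq_sw => p q; under [RHS]eq_sw => p1 p2.
    under eq_sw => q1 q2 do rewrite -!mulrA.
    rewrite (sw_antipoder (g := fun t => f (x1 * (p1 * S p2)) (x2 * t))).
      by rewrite mulr1; over.
    by linear_auto.
  rewrite (sw_antipoder (g := fun t => eps q *: f (x1 * t) x2)) ?mulr1 //.
  by linear_auto.
rewrite /Y -(swA (f := fun h1 h2 h3 => sw (fun x1 x2 => sw (fun y1 y2 =>
  sw (fun z1 z2 => f (x1 * y1 * S z1) (x2 * y2 * S z2)) h3) h2) (S h1))); last first.
  by linear_auto.
rewrite -[RHS](sw_counitl (g := fun h => sw (fun a b => f (S a) (S b)) h)); last first.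
  by linear_auto.
apply: eq_sw => s h3.
pose g a b := sw (fun z1 z2 => f (a * S z1) (b * S z2)) h3.
have gl : bilin g by rewrite /g; linear_auto.
under eq_sw => h1 h2 do rewrite -(swM _ _ gl).
rewrite (sw_antipodel (g := sw g)); last by linear_auto.
by rewrite sw1 // /g; under eq_sw => z1 z2 do rewrite !mul1r.
Qed.

(** In the sum of S(S(h1)) S(h2) h3 the last two factors cancel and leave S(S(h)). The first two
    form S(h2 S(h1)), which cocommutativity turns into a counit, leaving h. *)
Lemma antipodeK h : S (S h) = h.
Proof.
transitivity (sw (fun a r => sw (fun b c => S (S a) * S b * c) r) h).
  rewrite -[LHS](sw_counitr (g := fun h => S (S h))); last by linear_auto.
  apply: eq_sw => a r; under eq_sw => b c do rewrite -mulrA.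
  rewrite (sw_antipodel (g := fun x => S (S a) * x)) ?mulr1 //.
  by linear_auto.
rewrite -(swA (f := fun a b c => S (S a) * S b * c)); last by linear_auto.
rewrite -[RHS](sw_counitl (g := id)); last by linear_auto.
apply: eq_sw => a c.
under eq_sw => a1 a2 do rewrite -antipodeM.
rewrite (swC (f := fun a b => S (a * S b) * c)) //; last by linear_auto.
rewrite (sw_antipoder (g := fun x => S x * c)); last by linear_auto.
by rewrite antipode1 mul1r.
Qed.

End HopfIdentities.

Lemma tpow_rect (k : fieldType) (V M : lmodType k) n (g : tpow V n -> M)
  (Z : {pred M}) : linear g -> submod_closed Z ->
  (forall t, g (pure t) \in Z) -> forall x, g x \in Z.
Proof.
move=> gl [Z0 ZP] gZ x; rewrite -[x]reprK -[repr x]freeg_sumE.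
have pl := pi_linear (@multilinear_rel k V n).
rewrite (lin_sum pl) (lin_sum gl); elim: (dom _) => [|z s IHs].
  by rewrite big_nil.
by rewrite big_cons freegUZ (linZ pl) (linZ gl); apply: ZP => //; apply: gZ.
Qed.

Lemma linear_mext (k : fieldType) (U V M : lmodType k) n
  (f : U -> n.-tuple V -> M) x :
  (forall w, linear (f^~ w)) -> linear (fun u => mext (f u) x).
Proof.
move=> fl; have -> : (fun u => mext (f u) x) =
    fun u => \sum_(z <- dom (repr x)) coeff z (repr x) *: f u z.
  by apply/funext => u; rewrite /mext fgliftE.
by apply: linear_bigsum => z; apply: linear_scale.
Qed.

(** * Iterated coproducts and the conjugation action *)

Section IteratedCoproduct.
Variables (k : fieldType) (H : hopfAlgebra k).
Local Notation S := (@antipode k H).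
Local Notation eps := (@counit k H).

(** Multilinearity on lists of length [n]. Lists replace tuples because the legs of an iterated
    coproduct are split by concatenation. *)
Definition mlin (M : lmodType k) n (f : seq H -> M) :=
  forall s t, (size s + size t).+1 = n -> linear (fun a => f (s ++ a :: t)).

Fixpoint itsw (M : lmodType k) n (f : seq H -> M) (h : H) : M :=
  match n with
  | 0 => eps h *: f [::]
  | m.+1 => sw (fun a b => itsw m (fun w => f (a :: w)) b) h
  end.

Lemma mlin_cons (M : lmodType k) n (f : seq H -> M) a :
  mlin n.+1 f -> mlin n (fun w => f (a :: w)).
Proof. by move=> fl s t st; apply: (fl (a :: s) t); rewrite addSn st. Qed.

Lemma eq_itsw (M : lmodType k) n (f g : seq H -> M) h :
  (forall w, size w = n -> f w = g w) -> itsw n f h = itsw n g h.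
Proof.
elim: n f g h => [|n IHn] f g h fg /=; first by rewrite fg.
by apply: eq_sw => a b; apply: IHn => w wn; rewrite fg //= wn.
Qed.

Lemma linear_itsw_param (V M : lmodType k) n (f : V -> seq H -> M) h :
  (forall w, size w = n -> linear (f^~ w)) -> linear (fun x => itsw n (f x) h).
Proof.
elim: n f h => [|n IHn] f h fl /=; first by apply/linear_scale/fl.
by apply: linear_sw => a b; apply: IHn => w wn; apply: fl; rewrite /= wn.
Qed.

Lemma itsw_linear (M : lmodType k) n (f : seq H -> M) :
  mlin n f -> linear (itsw n f).
Proof.
elim: n f => [|n IHn] f fl /=; first exact/linear_counit/linear_idfun.
apply: linear_sw_arg (@linear_idfun _ _); split=> [b|a]; last exact/IHn/mlin_cons.
by apply: linear_itsw_param => w wn; apply: (fl [::] w); rewrite add0n wn.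
Qed.

Lemma mlin_multilinear (M : lmodType k) n (f : seq H -> M) (g : n.-tuple H -> M) :
  mlin n f -> (forall w : n.-tuple H, g w = f w) -> multilinear g.
Proof.
move=> fl gf t i c a b.
have st : size (take i t) = i by rewrite size_takel // size_tuple ltnW.
have sd : (i + size (drop i.+1 t)).+1 = n.
  by rewrite size_drop size_tuple -addSn subnKC.
suff E x : tupd t i x = take i t ++ x :: drop i.+1 t :> seq H.
  by rewrite !gf !E; apply: fl; rewrite st.
apply: (@eq_from_nth _ 0) => [|j]; first by rewrite size_tuple size_cat /= st addnS.
rewrite size_tuple => jn; rewrite -(tnth_nth _ _ (Ordinal jn)) tnth_mktuple.
rewrite nth_cat st -val_eqE /=; case: ltngtP => [ji|ij|->]; last by rewrite subnn.
  by rewrite nth_take // (tnth_nth 0).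
by rewrite (tnth_nth 0) /= -[in RHS](subnKC ij) addSn -addnS addKn /= nth_drop subnKC.
Qed.

Lemma pure_cons_linear n (w : n.-tuple H) :
  linear (fun a : H => pure [tuple of a :: w]).
Proof.
move=> c a b; have := @pure_multilinear k H n.+1 [tuple of 0 :: w] ord0 c a b.
by congr (_ = _ *: _ + _); congr pure; apply/val_inj => /=;
  rewrite enum_ordSl /= -map_comp; congr cons;
  rewrite -[RHS](map_tnth_enum w); apply: eq_map => i /=; rewrite tnthS.
Qed.

Lemma mext_iterDelta (M : lmodType k) n (f : seq H -> M) (g : n.-tuple H -> M) h :
  mlin n f -> (forall w : n.-tuple H, g w = f w) ->
  mext g (iterDelta n h) = itsw n f h.
Proof.
elim: n f g h => [|n IHn] f g h fl gf.
  have gl := mlin_multilinear fl gf.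
  by rewrite /= (linZ (mext_linear gl)) mextE // gf.
have gl := mlin_multilinear fl gf.
rewrite /= sweedlerE; last first.
  by move=> b; apply: linear_mext => w; apply: pure_cons_linear.
rewrite (sw_comp _ _ (mext_linear gl)); apply: eq_sw => a b.
rewrite mext_comp; last exact: mext_linear.
rewrite (IHn (fun w => f (a :: w))) //; first exact: mlin_cons.
by move=> w; rewrite /= mextE // gf.
Qed.

(** Generalized coassociativity; it splits a bead above a bracket into the parts that act on the two
    subtrees. *)
Lemma itsw_cat (M : lmodType k) p q (f : seq H -> M) h : mlin (p + q) f ->
  itsw (p + q) f h =
  sw (fun a b => itsw p (fun u => itsw q (fun v => f (u ++ v)) b) a) h.
Proof.
elim: p f h => [|p IHp] f h fl /=.
  by rewrite (sw_counitl _ (itsw_linear fl)).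
under eq_sw => a b do rewrite (IHp _ _ (mlin_cons a fl)).
rewrite (swA (f := fun a c d => itsw p (fun u => itsw q (fun v => f (a :: u ++ v)) d) c)) //.
split=> [c d|a d|a c].
- apply: linear_itsw_param => u us; apply: linear_itsw_param => v vs.
  by apply: (fl [::] (u ++ v)); rewrite add0n size_cat us vs.
- apply: itsw_linear => s t st; apply: linear_itsw_param => v vs c x y.
  rewrite -!catA; apply: (fl (a :: s) (t ++ v)).
  by rewrite /= size_cat vs -st !addSn addnA.
apply: linear_itsw_param => u us; apply: itsw_linear => s t st c' x y.
by rewrite !catA; apply: (fl (a :: u ++ s) t); rewrite /= size_cat us -st !addSn addnS addnA.
Qed.

Definition conj2 (M : lmodType k) (f : H -> H -> M) a b (h : H) : M :=
  sw (fun x y => sw (fun p q => sw (fun r s =>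
    f (p * a * S q) (r * b * S s)) y) x) h.

Definition conj_invariant (M : lmodType k) (f : H -> H -> M) :=
  forall h a b, conj2 f a b h = eps h *: f a b.

Lemma conj2_linear (M : lmodType k) (f : H -> H -> M) a b : bilin f ->
  linear (conj2 f a b).
Proof. by move=> fl; rewrite /conj2; linear_auto. Qed.

Lemma sweedler_conjugation (M : lmodType k) (f : H -> H -> M) a b h : bilin f ->
  sweedler f (conjugation h [tuple a; b]) = conj2 f a b h.
Proof.
move=> fl; rewrite /conjugation mext_comp; last exact: sweedler_linear.
pose g (w : seq H) := f (w`_0 * a * S w`_1) (w`_2 * b * S w`_3).
rewrite (@mext_iterDelta _ 4 g).
- rewrite /= /conj2 /g /=.
  rewrite (swA (f := fun p q y => sw (fun r s => f (p * a * S q) (r * b * S s)) y));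
    last by linear_auto.
  apply: eq_sw => p x; apply: eq_sw => q y; apply: eq_sw => r z.
  (* The iterated coproduct has a fifth leg, which carries only a counit. *)
  by rewrite (sw_counitr (g := fun s => f (p * a * S q) (r * b * S s))) //; linear_auto.
- case=> [|s0 [|s1 [|s2 [|s3 s]]]] [|t0 [|t1 [|t2 [|t3 t]]]] //= _; rewrite /g /=;
  by linear_auto.
move=> w /=; rewrite /sweedler mextE; last exact: bilin_multilinear.
by rewrite !tnth_mktuple.
Qed.

(** Conjugation by 1 is trivial, so [f] sends the relation of [h] to the defect of invariance
    [conj2 f a b h - eps h *: f a b]. *)
Lemma conj_rel_eq0 (M : lmodType k) (f : H -> H -> M) : bilin f ->
  conj_invariant f <-> forall x, @conj_rel k H 2 x -> sweedler f x = 0.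
Proof.
move=> fl.
have f1 a b : conj2 f a b 1 = f a b.
  by rewrite /conj2 !sw1 ?antipode1 ?mul1r ?mulr1 //; linear_auto.
have fE h a b : sweedler f (conjugation (h - (eps h)%:A) [tuple a; b]) =
    conj2 f a b h - eps h *: f a b.
  rewrite sweedler_conjugation // (linB (conj2_linear _ _ fl)).
  by rewrite (linZ (conj2_linear _ _ fl)) f1.
split=> [finv x [h [t ->]]|f0 h a b].
  by rewrite [t]tuple2_eta fE finv subrr.
by apply/eqP; rewrite -subr_eq0 -fE f0 //; exists h, [tuple a; b].
Qed.

End IteratedCoproduct.

(** * Conjugation coinvariants *)

Section Conjugation.
Variables (k : fieldType) (H : hopfAlgebra k).
Hypothesis cocomm : cocommutative H.
Local Notation S := (@antipode k H).
Local Notation eps := (@counit k H).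

Lemma sw_antipodelC (M : lmodType k) (g : H -> M) h : linear g ->
  sw (fun a b => g (S b * a)) h = eps h *: g 1.
Proof.
move=> gl; rewrite (swC (f := fun a b => g (S a * b))) //; last by linear_auto.
exact: sw_antipodel.
Qed.

Lemma sw_antipoderC (M : lmodType k) (g : H -> M) h : linear g ->
  sw (fun a b => g (b * S a)) h = eps h *: g 1.
Proof.
move=> gl; rewrite (swC (f := fun a b => g (a * S b))) //; last by linear_auto.
exact: sw_antipoder.
Qed.

Section Functional.
Variables (M : lmodType k) (f : H -> H -> M).
Hypothesis fl : bilin f.

Lemma conj2_interchange a b h :
  conj2 f a b h = sw (fun p q => sw (fun p1 p2 => sw (fun q1 q2 =>
    f (p1 * a * S q1) (p2 * b * S q2)) q) p) h.
Proof.
rewrite /conj2 (sw_interchange cocomm (f := fun p q r s =>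
  f (p * a * S q) (r * b * S s))) //.
by linear_auto.
Qed.

(** The trace property of [f] for the diagonal left and right multiplications on pairs: an
    equivalent of invariance with fewer legs to handle. *)
Definition balanced := forall c a b,
  sw (fun x y => f (x * a) (y * b)) c = sw (fun x y => f (a * x) (b * y)) c.

(** Forwards, c is split into p and q and invariance is applied to the conjugate by p of the pair
    multiplied on the right by q; there q cancels against the antipode of a leg of p. Backwards, the
    left factor p is moved to the right, where it meets S(q). *)
Lemma conj_balanced : conj_invariant f <-> balanced.
Proof.
split=> [finv c a b|fb c a b].
  transitivity (sw (fun p q => sw (fun q1 q2 => conj2 f (a * q1) (b * q2) p) q) c); last first.
    rewrite -[RHS](sw_counitl (g := fun c => sw (fun x y => f (a * x) (b * y)) c)); last first.
      by linear_auto.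
    apply: eq_sw => p q; rewrite sw_comp; last by linear_auto.
    by apply: eq_sw => q1 q2; rewrite finv.
  pose G x y r := sw (fun d q => sw (fun d1 d2 => sw (fun q1 q2 =>
    f (x * q1 * S d1) (y * q2 * S d2)) q) d) r.
  have GE x y r : G x y r = eps r *: f x y.
    rewrite /G (sw_interchange cocomm (f := fun d1 d2 q1 q2 =>
      f (x * q1 * S d1) (y * q2 * S d2))); last by linear_auto.
    rewrite -[RHS](sw_counitl (g := fun r => eps r *: f x y)); last by linear_auto.
    apply: eq_sw => d q; under eq_sw => d1 q1.
      under eq_sw => d2 q2 do rewrite -!mulrA.
      rewrite (sw_antipoderC (g := fun t => f (x * (q1 * S d1)) (y * t))).
        by rewrite mulr1; over.
      by linear_auto.
    rewrite (sw_antipoderC (g := fun t => eps q *: f (x * t) y)) ?mulr1 //.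
    by linear_auto.
  transitivity (sw (fun p r => sw (fun p1 p2 => G (p1 * a) (p2 * b) r) p) c).
    rewrite -[LHS](sw_counitr (g := fun c => sw (fun x y => f (x * a) (y * b)) c)); last first.
      by linear_auto.
    apply: eq_sw => p r; rewrite sw_comp; last by linear_auto.
    by apply: eq_sw => p1 p2; rewrite GE.
  under [RHS]eq_sw => p q.
    under eq_sw => q1 q2 do rewrite conj2_interchange.
    rewrite sw_exchange; over.
  rewrite [RHS](swA (f := fun r d q => sw (fun q1 q2 => sw (fun p1 p2 => sw (fun d1 d2 =>
    f (p1 * (a * q1) * S d1) (p2 * (b * q2) * S d2)) d) r) q)); last by linear_auto.
  apply: eq_sw => p r; rewrite sw_exchange; apply: eq_sw => d q.
  rewrite [RHS]sw_exchange; apply: eq_sw => p1 p2.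
  rewrite [RHS]sw_exchange; apply: eq_sw => d1 d2.
  by apply: eq_sw => q1 q2; rewrite !mulrA.
rewrite conj2_interchange.
under eq_sw => p q.
  under eq_sw => p1 p2 do under eq_sw => q1 q2 do rewrite -!mulrA.
  rewrite sw_exchange; under eq_sw => q1 q2 do rewrite fb.
  rewrite sw_exchange; over.
rewrite (sw_interchange cocomm (f := fun p1 p2 q1 q2 =>
  f (a * S q1 * p1) (b * S q2 * p2))); last by linear_auto.
rewrite -[RHS](sw_counitl (g := fun r => eps r *: f a b)); last by linear_auto.
apply: eq_sw => p q; under eq_sw => p1 q1.
  under eq_sw => p2 q2 do rewrite -!mulrA.
  rewrite (sw_antipodelC (g := fun t => f (a * (S q1 * p1)) (b * t))).
    by rewrite mulr1; over.
  by linear_auto.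
rewrite (sw_antipodelC (g := fun t => eps q *: f (a * t) b)) ?mulr1 //.
by linear_auto.
Qed.

End Functional.

Variables (M : lmodType k) (f : H -> H -> M).
Hypotheses (fl : bilin f) (finv : conj_invariant f).

Lemma conj_invariant_tau : conj_invariant (fun a b => f b a).
Proof.
move=> h a b; rewrite -finv -[RHS](swC (f := fun x y => sw (fun p q => sw (fun r s =>
  f (p * b * S q) (r * a * S s)) y) x)) //; last by linear_auto.
by apply: eq_sw => x y; rewrite sw_exchange.
Qed.

(** The antipode turns p a S(q) into q S(a) S(p), and cocommutativity exchanges p and q. *)
Lemma conj_invariant_delta : conj_invariant (fun a b => f (S a) b).
Proof.
move=> h a b; rewrite -finv; apply: eq_sw => x y.
rewrite -[RHS](swC (f := fun p q => sw (fun r s =>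
  f (p * S a * S q) (r * b * S s)) y)) //; last by linear_auto.
apply: eq_sw => p q; apply: eq_sw => r s.
by rewrite !antipodeM antipodeK // mulrA.
Qed.

(** In balanced form both sides reduce to [G]: two legs of c cancel on each of them, on the left
    side after one use of the balance of [f]. *)
Lemma conj_invariant_gamma :
  conj_invariant (fun a b => sw (fun b1 b2 => f (S b1) (a * S b2)) b).
Proof.
have fb : balanced f by apply/conj_balanced.
apply/conj_balanced; first by linear_auto.
move=> c a b; pose G := sw (fun b1 b2 => f (S c * S b1) (a * S b2)) b.
have E1 x y b1 b2 : sw (fun y1 y2 => f (S (y1 * b1)) (x * a * S (y2 * b2))) y =
    sw (fun y2 y1 => f (S y2 * S b1) (S y1 * x * (a * S b2))) y.
  under eq_sw => y1 y2 do rewrite !antipodeM mulrA.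
  rewrite -(antipode_Delta cocomm (f := fun d1 d2 =>
    f (S b1 * d1) (x * a * S b2 * d2))); last by linear_auto.
  rewrite -fb (antipode_Delta cocomm); last by linear_auto.
  by apply: eq_sw => y1 y2; rewrite !mulrA.
have E2 x y b1 b2 : sw (fun y1 y2 => f (S (b1 * y1)) (a * x * S (b2 * y2))) y =
    sw (fun y2 y1 => f (S y2 * S b1) (a * (x * S y1) * S b2)) y.
  by apply: eq_sw => y1 y2; rewrite !antipodeM !mulrA.
transitivity G.
  under eq_sw => x y do (rewrite swM; last by linear_auto).
  under eq_sw => x y do rewrite sw_exchange.
  rewrite sw_exchange; apply: eq_sw => b1 b2; under eq_sw => x y.
    rewrite E1 -swC //; last by linear_auto.
    over.
  rewrite -(swA (f := fun x q p => f (S p * S b1) (S q * x * (a * S b2)))); last first.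
    by linear_auto.
  rewrite -[RHS](sw_counitl (g := fun c => f (S c * S b1) (a * S b2))); last by linear_auto.
  apply: eq_sw => s p.
  rewrite (sw_antipodelC (g := fun t => f (S p * S b1) (t * (a * S b2)))) ?mul1r //.
  by linear_auto.
under [RHS]eq_sw => x y do (rewrite swM; last by linear_auto).
rewrite [RHS]sw_exchange; apply: eq_sw => b1 b2; under [RHS]eq_sw => x y.
  rewrite E2 -swC //; last by linear_auto.
  over.
rewrite -(swA (f := fun x q p => f (S p * S b1) (a * (x * S q) * S b2))); last first.
  by linear_auto.
rewrite -[LHS](sw_counitl (g := fun c => f (S c * S b1) (a * S b2))); last by linear_auto.
apply: eq_sw => s p.
rewrite (sw_antipoder (g := fun t => f (S p * S b1) (a * t * S b2))) ?mulr1 //.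
by linear_auto.
Qed.

End Conjugation.

(** * The operators on the coinvariants *)

Section Operators.
Variables (k : fieldType) (H : hopfAlgebra k).
Hypothesis cocomm : cocommutative H.
Local Notation S := (@antipode k H).

Definition hbar (a b : H) : Hbar H 2 := \pi_(Hbar H 2) (tens a b).

Lemma piHbar_linear : linear (\pi_(Hbar H 2) : tpow H 2 -> Hbar H 2).
Proof. exact: pi_linear. Qed.

Lemma bilin_hbar : bilin hbar.
Proof.
by have pl := piHbar_linear; rewrite /hbar; split=> [b|a];
  apply: (linear_comp pl); linear_auto.
Qed.

Lemma pi_sweedler (f : H -> H -> tpow H 2) x :
  \pi_(Hbar H 2) (sweedler f x) = sweedler (fun a b => \pi_(Hbar H 2) (f a b)) x.
Proof. exact: mext_comp piHbar_linear. Qed.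

Lemma hbar_inv : conj_invariant hbar.
Proof.
apply/conj_rel_eq0; first exact: bilin_hbar.
move=> x xA; rewrite -pi_sweedler.
suff -> : sweedler (@tens k H) x = x by apply: pi0.
apply: (tpow_linear_ext (g := id)) => // [|t].
  exact/sweedler_linear/bilin_tens.
by rewrite [t]tuple2_eta sweedler_tens //; apply: bilin_tens.
Qed.

Lemma tens_rect (M : lmodType k) (g : tpow H 2 -> M) (Z : {pred M}) :
  linear g -> submod_closed Z -> (forall a b, g (tens a b) \in Z) ->
  forall x, g x \in Z.
Proof.
by move=> gl Zs gZ; apply: tpow_rect => // t; rewrite [t]tuple2_eta; apply: gZ.
Qed.

Section Induced.
Variables (f : tpow H 2 -> tpow H 2) (g : H -> H -> Hbar H 2).
Hypotheses (gl : bilin g) (ginv : conj_invariant g).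
Hypothesis fg : forall x, \pi_(Hbar H 2) (f x) = sweedler g x.

(** [induced] applies [f] to a chosen representative; the invariance of [g] removes the dependence
    on the choice. *)
Lemma inducedE x : induced f (\pi_(Hbar H 2) x) = sweedler g x.
Proof.
rewrite -(qliftE (A := @conj_rel k H 2) (sweedler_linear gl)); last exact/conj_rel_eq0.
exact: fg.
Qed.

Lemma induced_linear : linear (induced f).
Proof.
move=> c x y; rewrite -[x]reprK -[y]reprK -piHbar_linear !inducedE.
exact: sweedler_linear.
Qed.

Lemma induced_hbar a b : induced f (hbar a b) = g a b.
Proof. by rewrite inducedE sweedler_tens. Qed.

End Induced.

Let hl := bilin_hbar.

Lemma tau_pi x : \pi_(Hbar H 2) (tau_tens x) = sweedler (fun a b => hbar b a) x.
Proof. exact: pi_sweedler. Qed.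

Lemma delta_pi x : \pi_(Hbar H 2) (delta_tens x) = sweedler (fun a b => hbar (S a) b) x.
Proof. exact: pi_sweedler. Qed.

Lemma gamma_pi x : \pi_(Hbar H 2) (gamma_tens x) =
  sweedler (fun a b => sw (fun b1 b2 => hbar (S b1) (a * S b2)) b) x.
Proof.
rewrite pi_sweedler; congr (sweedler _ x); apply/funext => a; apply/funext => b.
rewrite pi_sweedler sweedlerE // => b2.
by apply: (linear_comp piHbar_linear); linear_auto.
Qed.

Lemma tau_inv : conj_invariant (fun a b => hbar b a).
Proof. exact: conj_invariant_tau hbar_inv. Qed.

Lemma delta_inv : conj_invariant (fun a b => hbar (S a) b).
Proof. exact: conj_invariant_delta hbar_inv. Qed.

Lemma gamma_inv : conj_invariant (fun a b => sw (fun b1 b2 => hbar (S b1) (a * S b2)) b).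
Proof. exact: conj_invariant_gamma hbar_inv. Qed.

Lemma tau_linear : linear (@tau k H).
Proof. by apply: (induced_linear _ tau_inv tau_pi); linear_auto. Qed.

Lemma delta_linear : linear (@delta k H).
Proof. by apply: (induced_linear _ delta_inv delta_pi); linear_auto. Qed.

Lemma gamma_linear : linear (@gamma k H).
Proof. by apply: (induced_linear _ gamma_inv gamma_pi); linear_auto. Qed.

Lemma tau_hbar a b : tau (hbar a b) = hbar b a.
Proof. by apply: (induced_hbar _ tau_inv tau_pi); linear_auto. Qed.

Lemma delta_hbar a b : delta (hbar a b) = hbar (S a) b.
Proof. by apply: (induced_hbar _ delta_inv delta_pi); linear_auto. Qed.

Lemma balanced_hbar : balanced hbar.
Proof. exact/conj_balanced/hbar_inv. Qed.

Lemma gamma_hbar_right a b :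
  gamma (hbar a b) = sw (fun b1 b2 => hbar (S b1) (a * S b2)) b.
Proof. by apply: (induced_hbar _ gamma_inv gamma_pi); linear_auto. Qed.

(** The defining formula has a S(b2). Balance at S(b) moves this factor to the left of a, as in
    relation (3). *)
Lemma gamma_hbar a b : gamma (hbar a b) = sw (fun b1 b2 => hbar (S b1) (S b2 * a)) b.
Proof.
rewrite gamma_hbar_right.
have := balanced_hbar (S b) 1 a.
rewrite !antipode_Delta //; try by linear_auto.
by under eq_sw => x y do rewrite mulr1; move=> ->; apply: eq_sw => x y; rewrite mul1r.
Qed.

(** After two applications b occurs through three legs, one of them under S. Two cancel, and balance
    moves S(a) to the left of the remaining one. *)
Lemma gamma2_hbar a b :
  gamma (gamma (hbar a b)) = sw (fun a1 a2 => hbar (S a1 * b) (S a2)) a.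
Proof.
rewrite gamma_hbar_right (sw_comp _ _ gamma_linear).
transitivity (sw (fun b1 b2 => sw (fun a1 a2 => sw (fun b3 b4 =>
    hbar (b3 * S a1) (S b1 * b4 * S a2)) b2) a) b).
  apply: eq_sw => b1 b2; rewrite gamma_hbar_right swM; last by linear_auto.
  apply: eq_sw => a1 a2; rewrite (antipode_Delta cocomm); last by linear_auto.
  by apply: eq_sw => b3 b4; rewrite !antipodeM !antipodeK // mulrA.
under eq_sw => b1 b2 do rewrite sw_exchange.
transitivity (sw (fun a1 a2 => hbar (b * S a1) (S a2)) a); last first.
  have := balanced_hbar (S a) b 1; rewrite !antipode_Delta //; try by linear_auto.
  under eq_sw => x y do rewrite mulr1; move=> ->.
  by apply: eq_sw => x y; rewrite mul1r.
under eq_sw => b1 b2 do (rewrite -swC //; last by linear_auto).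
rewrite -(swA (f := fun b1 b4 b3 =>
  sw (fun a1 a2 => hbar (b3 * S a1) (S b1 * b4 * S a2)) a)); last by linear_auto.
rewrite -[RHS](sw_counitl (g := fun b => sw (fun a1 a2 => hbar (b * S a1) (S a2)) a)); last first.
  by linear_auto.
apply: eq_sw => b1 b2.
rewrite (sw_antipodel (g := fun t => sw (fun a1 a2 => hbar (b2 * S a1) (t * S a2)) a)).
  by congr (_ *: _); apply: eq_sw => a1 a2; rewrite mul1r.
by linear_auto.
Qed.

Lemma explicit_relation3 a b :
  \pi_(Hbar H 2) (tens a b)
    + \pi_(Hbar H 2) (sweedler (fun a1 a2 => tens (S a1 * b) (S a2)) (Delta a))
    + \pi_(Hbar H 2) (sweedler (fun b1 b2 => tens (S b1) (S b2 * a)) (Delta b)) =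
  hbar a b + gamma (gamma (hbar a b)) + gamma (hbar a b).
Proof.
rewrite gamma2_hbar gamma_hbar !sweedlerE; try by linear_auto.
by rewrite !(sw_comp _ _ piHbar_linear).
Qed.

Lemma lspan_operator_images :
  lspan (@operator_images k H) =i lspan (@explicit_relations k H).
Proof.
(* The generators in [operator_images] are images of arbitrary elements; by linearity pure tensors
   suffice. *)
have op_sub Phi : linear Phi ->
    (forall a b, Phi (hbar a b) \in lspan (@explicit_relations k H)) ->
    forall x, Phi x \in lspan (@explicit_relations k H).
  move=> Pl PZ x; rewrite -[x]reprK.
  apply: (tens_rect (g := fun t => Phi (\pi_(Hbar H 2) t))) => //.
    exact: linear_comp Pl piHbar_linear.
  exact: lspan_submod_closed.
have [[tl dl] gl] := (tau_linear, delta_linear, gamma_linear).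
move=> x; apply/idP/idP; apply: lspan_sub => {}x; last first.
  move=> [a [b []]] ->; apply: sub_lspan.
  - by left; left; exists (hbar a b) => //; rewrite tau_hbar.
  - by left; right; exists (hbar a b) => //; rewrite delta_hbar.
  by right; exists (hbar a b) => //; rewrite explicit_relation3 addrAC.
case=> [[]|] [y _ <-].
- apply: (op_sub (fun y => y - tau y)) => [|a b]; first by linear_auto.
  by rewrite tau_hbar; apply: sub_lspan; exists a, b; constructor 1.
- apply: (op_sub (fun y => y + delta y)) => [|a b]; first by linear_auto.
  by rewrite delta_hbar; apply: sub_lspan; exists a, b; constructor 2.
apply: (op_sub (fun y => y + gamma y + gamma (gamma y))) => [|a b].
  by linear_auto.
rewrite addrAC; apply: sub_lspan; exists a, b; constructor 3.
by rewrite explicit_relation3.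
Qed.

End Operators.

(** * Evaluation of decorated trees in a tensor algebra *)

Section Functionals.
Variables (k : fieldType) (W : Type) (M : lmodType k).

(** Elements of a tensor algebra are handled as functionals on test functions, in continuation
    style. This predicate says that such a functional is a finite combination of evaluations, which
    gives linearity and the exchange of two functionals. *)
Definition functional (L : (W -> M) -> M) :=
  exists l : seq (k * W), forall K, L K = \sum_(p <- l) p.1 *: K p.2.

Lemma functional_eval w : functional (fun K => K w).
Proof. by exists [:: (1, w)] => K; rewrite big_seq1 scale1r. Qed.

Lemma functional_add L L' : functional L -> functional L' ->
  functional (fun K => L K + L' K).
Proof.
by case=> l lE [l' lE']; exists (l ++ l') => K; rewrite big_cat lE lE'.
Qed.

Lemma functional_scale c L : functional L -> functional (fun K => c *: L K).
Proof.
case=> l lE; exists [seq (c * p.1, p.2) | p <- l] => K.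
by rewrite lE big_map scaler_sumr; apply: eq_bigr => p _; rewrite scalerA.
Qed.

Lemma functional_sum I (r : seq I) (L : I -> (W -> M) -> M) :
  (forall i, functional (L i)) -> functional (fun K => \sum_(i <- r) L i K).
Proof.
move=> Lf; elim: r => [|i r IHr].
  by exists [::] => K; rewrite !big_nil.
case: (functional_add (Lf i) IHr) => l lE; exists l => K.
by rewrite big_cons lE.
Qed.

Lemma functional_bind (U : Type) (L : (U -> M) -> M) (L' : U -> (W -> M) -> M) :
  (exists l : seq (k * U), forall K, L K = \sum_(p <- l) p.1 *: K p.2) ->
  (forall u, functional (L' u)) -> functional (fun K => L (fun u => L' u K)).
Proof.
move=> [l lE] Lf'.
have [l' lE'] := functional_sum l (fun p => functional_scale p.1 (Lf' p.2)).
by exists l' => K; rewrite lE lE'.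
Qed.

Variable L : (W -> M) -> M.
Hypothesis Lf : functional L.

Lemma functional0 : L (fun=> 0) = 0.
Proof. by case: Lf => l ->; apply: big1 => p _; rewrite scaler0. Qed.

Lemma functionalD K K' : L (fun w => K w + K' w) = L K + L K'.
Proof.
case: Lf => l lE; rewrite !lE -big_split.
by apply: eq_bigr => p _; rewrite scalerDr.
Qed.

Lemma functionalZ c K : L (fun w => c *: K w) = c *: L K.
Proof.
case: Lf => l lE; rewrite !lE scaler_sumr.
by apply: eq_bigr => p _; rewrite !scalerA mulrC.
Qed.

Lemma functionalN K : L (fun w => - K w) = - L K.
Proof.
rewrite -scaleN1r -functionalZ; congr L.
by apply/funext => w; rewrite scaleN1r.
Qed.

Lemma functionalB K K' : L (fun w => K w - K' w) = L K - L K'.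
Proof. by rewrite functionalD functionalN. Qed.

Lemma functional_bigsum I (r : seq I) (K : I -> W -> M) :
  L (fun w => \sum_(i <- r) K i w) = \sum_(i <- r) L (K i).
Proof.
case: Lf => l lE; rewrite lE; under [RHS]eq_bigr => i _ do rewrite lE.
by rewrite exchange_big; apply: eq_bigr => p _; rewrite scaler_sumr.
Qed.

Lemma functional_linear (V : lmodType k) (K : V -> W -> M) :
  (forall w, linear (K^~ w)) -> linear (fun x => L (K x)).
Proof.
move=> Kl c a b; rewrite -functionalZ -functionalD.
by congr L; apply/funext => w; apply: Kl.
Qed.

Lemma functional_exchange (U : Type) (L' : (U -> M) -> M) (K : W -> U -> M) :
  (exists l : seq (k * U), forall K, L' K = \sum_(p <- l) p.1 *: K p.2) ->
  L (fun w => L' (K w)) = L' (fun u => L (K^~ u)).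
Proof.
move=> [l' lE']; case: Lf => l lE; rewrite lE lE'.
under eq_bigr => p _ do rewrite lE' scaler_sumr.
under [RHS]eq_bigr => p _ do rewrite lE scaler_sumr.
rewrite exchange_big; apply: eq_bigr => p _; apply: eq_bigr => q _.
by rewrite !scalerA mulrC.
Qed.

End Functionals.

Lemma functional_sw (k : fieldType) (H : hopfAlgebra k) (W : Type)
  (M : lmodType k) (L : (W -> M) -> M) (K : H -> H -> W -> M) h :
  functional L ->
  L (fun w => sw (fun a b => K a b w) h) = sw (fun a b => L (K a b)) h.
Proof. by move=> Lf; rewrite /sw functional_bigsum. Qed.

Section Evaluation.
Variables (k : fieldType) (H : hopfAlgebra k).
Hypothesis cocomm : cocommutative H.
Local Notation eps := (@counit k H).
Variable M : lmodType k.
Local Notation word := (seq (nat * H)).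
Implicit Types (K : word -> M) (t : term H) (g h : H) (w v : word).

(* [ev t h K] is the value of [K] on [h] acting on [t], where [t] is read in the tensor
   algebra on the letters (slot, bead) with [Br] the commutator; [act w g K] is the value
   of [K] on [g] acting diagonally on [w]. *)
Fixpoint ev t h K : M :=
  match t with
  | Slot x => K [:: (x, h)]
  | Bead g t => ev t (h * g) K
  | Br t u => sw (fun a b => ev t a (fun w => ev u b (fun v =>
                 K (w ++ v) - K (v ++ w)))) h
  end.

Fixpoint act w g K : M :=
  match w with
  | [::] => eps g *: K [::]
  | p :: v => sw (fun a b => act v b (fun v' => K ((p.1, a * p.2) :: v'))) g
  end.

Definition letter_linear K := forall w p v, linear (fun a => K (w ++ (p, a) :: v)).

Lemma functional_ev t h : functional (ev t h).
Proof.
elim: t h => [x|g t IHt|t IHt u IHu] h /=.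
- exact: functional_eval.
- exact: IHt.
apply: functional_sum => p; apply: functional_bind; [exact: IHt|move=> w].
apply: (functional_bind (L' := fun v K => K (w ++ v) - K (v ++ w))); first exact: IHu.
move=> v.
apply: functional_add; first exact: functional_eval.
case: (functional_scale (-1) (functional_eval M (v ++ w))) => l lE.
by exists l => K; rewrite -lE scaleN1r.
Qed.

Lemma functional_act w g : functional (act w g).
Proof.
elim: w g => [|p w IHw] g /=; first exact/functional_scale/functional_eval.
apply: functional_sum => q.
apply: (functional_bind (L' := fun v K => K ((p.1, q.1 * p.2) :: v))).
  exact: IHw.
by move=> v; apply: functional_eval.
Qed.

(** Every word in the expansion of [t] is an arrangement of its slots. This gives access to the
    distinctness of slots when weights are compared. *)
Lemma eq_ev t h K K' :
  (forall w, perm_eq (map fst w) (term_slots t) -> K w = K' w) ->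
  ev t h K = ev t h K'.
Proof.
elim: t h K K' => [x|g t IHt|t IHt u IHu] h K K' KK' /=.
- exact: KK'.
- exact: IHt.
apply: eq_sw => a b; apply: IHt => w wt; apply: IHu => v vu.
rewrite !KK' //= map_cat; last exact: perm_cat.
by rewrite perm_catC; apply: perm_cat.
Qed.

Lemma letter_linear_catr K v : letter_linear K ->
  letter_linear (fun w => K (w ++ v)).
Proof.
move=> Kl w p w' c a b; rewrite -!catA !cat_cons; exact: Kl.
Qed.

Lemma letter_linear_catl K v : letter_linear K ->
  letter_linear (fun w => K (v ++ w)).
Proof. move=> Kl w p w' c a b; rewrite !catA; exact: Kl. Qed.

Lemma letter_linear_comm K w : letter_linear K ->
  letter_linear (fun v => K (w ++ v) - K (v ++ w)).
Proof.
move=> Kl v p v'; apply: linear_add; [|apply: linear_opp].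
  exact: (letter_linear_catl w Kl).
exact: (letter_linear_catr w Kl).
Qed.

Lemma letter_linear_ev_comm K u b : letter_linear K ->
  letter_linear (fun w => ev u b (fun v => K (w ++ v) - K (v ++ w))).
Proof.
move=> Kl w p w'; apply: (functional_linear (functional_ev u b)) => v.
apply: linear_add; [|apply: linear_opp].
  exact: (letter_linear_catr v Kl).
exact: (letter_linear_catl v Kl).
Qed.

Lemma letter_linear_ev K u b : letter_linear K ->
  letter_linear (fun w => ev u b (fun v => K (w ++ v))).
Proof.
move=> Kl w p w'; apply: (functional_linear (functional_ev u b)) => v.
exact: (letter_linear_catr v Kl).
Qed.

Lemma ev_linear t K : letter_linear K -> linear (fun h => ev t h K).
Proof.
elim: t K => [x|g t IHt|t IHt u IHu] K Kl /=.
- exact: (Kl [::] x [::]).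
- by apply: (linear_comp (IHt K Kl)); linear_auto.
apply: linear_sw_arg (@linear_idfun _ _); split=> [b|a].
  exact/IHt/letter_linear_ev_comm.
apply: (functional_linear (functional_ev t a)) => w.
exact/IHu/letter_linear_comm.
Qed.

Lemma act_linear w K : letter_linear K -> linear (fun g => act w g K).
Proof.
elim: w K => [|p w IHw] K Kl /=; first exact: linear_counit.
apply: linear_sw_arg (@linear_idfun _ _); split=> [b|a].
  apply: (functional_linear (functional_act w b)) => v.
  by apply: (linear_comp (Kl [::] p.1 v)); linear_auto.
by apply: IHw; apply: (letter_linear_catl [:: _]).
Qed.

Lemma act1 w K : letter_linear K -> act w 1 K = K w.
Proof.
elim: w K => [|p w IHw] K Kl /=; first by rewrite rmorph1 scale1r.
rewrite sw1.
  rewrite IHw; last by apply: (letter_linear_catl [:: _]).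
  by rewrite mul1r; case: p.
split=> [b|a].
  apply: (functional_linear (functional_act w b)) => v.
  by apply: (linear_comp (Kl [::] p.1 v)); linear_auto.
by apply: act_linear; apply: (letter_linear_catl [:: _]).
Qed.

Lemma act_cat w' v g K : letter_linear K ->
  act (w' ++ v) g K = sw (fun a b => act w' a (fun u' => act v b (fun v' =>
    K (u' ++ v')))) g.
Proof.
elim: w' K g => [|p u IHu] K g Kl /=.
  by rewrite (sw_counitl (g := fun b => act v b K)) //; apply: act_linear.
have Kp a : letter_linear (fun w => K ((p.1, a * p.2) :: w)).
  exact: (letter_linear_catl [:: _]).
under eq_sw => a b do rewrite IHu //.
rewrite (swA (f := fun a c d => act u c (fun u' => act v d (fun v' =>
  K ((p.1, a * p.2) :: u' ++ v'))))) //; split=> [c d|a d|a c].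
- apply: (functional_linear (functional_act u c)) => u'.
  apply: (functional_linear (functional_act v d)) => v'.
  by apply: (linear_comp (Kl [::] p.1 (u' ++ v'))); linear_auto.
- apply: act_linear => w q w''; apply: (functional_linear (functional_act v d)) => v'.
  exact: (letter_linear_catr v' (Kp a) w q w'').
apply: (functional_linear (functional_act u c)) => u'.
by apply: act_linear; apply: (letter_linear_catl u' (Kp a)).
Qed.

Lemma act_mul w g h K : letter_linear K ->
  act w (g * h) K = act w h (fun w' => act w' g K).
Proof.
elim: w K g h => [|p w IHw] K g h Kl /=.
  by rewrite rmorphM /= scalerA mulrC.
have Kp a : letter_linear (fun v => K ((p.1, a * p.2) :: v)).
  exact: (letter_linear_catl [:: _]).
have Kb : bilin (fun a b => act w b (fun v => K ((p.1, a * p.2) :: v))).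
  split=> [b|a]; last exact: act_linear.
  apply: (functional_linear (functional_act w b)) => v.
  by apply: (linear_comp (Kl [::] p.1 v)); linear_auto.
rewrite swM // sw_exchange; apply: eq_sw => h1 h2 /=.
rewrite /sw (functional_bigsum (functional_act w h2)); apply: eq_bigr => q _.
by rewrite IHw //; congr (act w h2); apply/funext => v; rewrite mulrA.
Qed.

(** The tensor algebra is an H-module algebra. The summand [v ++ w] of the commutator receives the
    legs of g in the opposite order, which cocommutativity repairs. *)
Lemma ev_act t g h K : letter_linear K ->
  ev t (g * h) K = ev t h (fun w => act w g K).
Proof.
elim: t g h K => [x|b t IHt|t IHt u IHu] g h K Kl /=.
- rewrite -[LHS](sw_counitr (g := fun a => K [:: (x, a * h)])) //.
  by apply: (linear_comp (Kl [::] x [::])); linear_auto.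
- by rewrite -mulrA IHt.
have Kr w := letter_linear_comm w Kl.
have Kc b := letter_linear_ev_comm u b Kl.
rewrite swM; last first.
  split=> [b|a]; first exact: ev_linear.
  apply: (functional_linear (functional_ev t a)) => w; exact: ev_linear.
rewrite sw_exchange; apply: eq_sw => h1 h2.
transitivity (ev t h1 (fun w => ev u h2 (fun v => sw (fun g1 g2 =>
    act w g1 (fun w' => act v g2 (fun v' => K (w' ++ v') - K (v' ++ w')))) g))).
  under eq_sw => g1 g2 do rewrite IHt //.
  rewrite -(functional_sw _ _ (functional_ev t h1)); congr (ev t h1 _).
  apply/funext => w; rewrite [RHS](functional_sw _ _ (functional_ev u h2)).
  apply: eq_sw => g1 g2.
  rewrite -(functional_exchange (functional_act w g1) _ (functional_ev u h2)).
  by congr (act w g1 _); apply/funext => w'; rewrite IHu.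
congr (ev t h1 _); apply/funext => w; congr (ev u h2 _); apply/funext => v.
rewrite !act_cat // -[X in _ - X](swC (f := fun a b =>
  act v a (fun v' => act w b (fun w' => K (v' ++ w'))))) //; last first.
  split=> [b|a].
    apply: act_linear => v1 p v2; apply: (functional_linear (functional_act w b)) => w'.
    exact: (letter_linear_catr w' Kl).
  apply: (functional_linear (functional_act v a)) => v'.
  by apply: act_linear; apply: letter_linear_catl.
rewrite /sw -sumrB; apply: eq_bigr => q _.
rewrite (functional_exchange (functional_act v q.2) _ (functional_act w q.1)).
rewrite -(functionalB (functional_act w q.1)); congr (act w q.1 _).
by apply/funext => w'; rewrite (functionalB (functional_act v q.2)).
Qed.

End Evaluation.

(** * Cyclic invariant functionals kill the relations of HLie *)

Section Invariance.
Variables (k : fieldType) (H : hopfAlgebra k).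
Hypothesis cocomm : cocommutative H.
Local Notation S := (@antipode k H).
Local Notation eps := (@counit k H).
Variable M : lmodType k.
Local Notation word := (seq (nat * H)).
Implicit Types (K : word -> M) (t : term H).

(** These are the functions on trees that descend to HLie. *)
Definition HLie_invariant (f : tree H -> M) :=
  forall r, HLie_rel r -> fglift f r = 0.

Lemma mlin_cat p q (f : seq H -> M) :
  (forall v, size v = q -> mlin p (fun u => f (u ++ v))) ->
  (forall u, size u = p -> mlin q (fun v => f (u ++ v))) -> mlin (p + q) f.
Proof.
move=> fp fq s t st; case: (ltnP (size s) p) => sp.
  rewrite -(cat_take_drop (p - (size s).+1) t) => c a b.
  have st1 : size (take (p - (size s).+1) t) = (p - (size s).+1)%N.
    by rewrite size_takel // leq_subLR addSn st leq_addr.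
  rewrite -!cat_cons !catA; apply: fp; last by rewrite st1 -addSn subnKC.
  by rewrite size_drop -(addnK (size s).+1 (size t)) addnC addSn st -subnDA subnKC // addKn.
rewrite -(cat_take_drop p s) => c a b; rewrite -!catA.
apply: fq; first by rewrite size_takel.
by apply: (@addnI p); rewrite size_drop addnS addnA subnKC.
Qed.

Lemma beads_cat (u v : seq H) (ts : seq (term H)) : size u = size (take (size u) ts) ->
  beads (u ++ v) ts = beads u (take (size u) ts) ++ beads v (drop (size u) ts).
Proof.
move=> su; rewrite -{1}(cat_take_drop (size u) ts) /beads zip_cat //.
by rewrite map_cat.
Qed.

Lemma size_beads (u : seq H) (ts : seq (term H)) : size u = size ts -> size (beads u ts) = size ts.
Proof. by move=> us; rewrite size_map size_zip us minnn. Qed.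

Lemma graft_beads_cat p q (u v : seq H) (ts : seq (term H)) : size u = arity p ->
  size ts = (arity p + arity q)%N ->
  graft (Bracket p q) (beads (u ++ v) ts) =
  Br (graft p (beads u (take (arity p) ts))) (graft q (beads v (drop (arity p) ts))).
Proof.
move=> up tsz; have ut : size (take (size u) ts) = size u.
  by rewrite size_takel // tsz up leq_addr.
rewrite /= beads_cat // -up; congr (Br _ _).
  by congr graft; rewrite take_size_cat // size_beads.
by congr graft; rewrite drop_size_cat // size_beads.
Qed.

Lemma ev_graft_mlin o (ts : seq (term H)) h K : letter_linear K -> size ts = arity o ->
  mlin (arity o) (fun w => ev (graft o (beads w ts)) h K).
Proof.
elim: o ts h K => [|p IHp q IHq] ts h K Kl.
  case: ts => [|t [|//]] // _ [|//] [|//] _ /=.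
  by apply: (linear_comp (ev_linear t Kl)); linear_auto.
move=> tsz.
have E u v : size u = arity p -> ev (graft (Bracket p q) (beads (u ++ v) ts)) h K =
    sw (fun x y => ev (graft p (beads u (take (arity p) ts))) x (fun w =>
      ev (graft q (beads v (drop (arity p) ts))) y (fun w' =>
        K (w ++ w') - K (w' ++ w)))) h.
  by move=> up; rewrite graft_beads_cat.
apply: (mlin_cat (p := arity p) (q := arity q)) => [v vs|u us] s t st.
  under eq_fun => a do rewrite (E _ _ (etrans _ st)) ?size_cat /= ?addnS //.
  apply: linear_sw => x y; apply: (IHp _ _ _ _ _ s t) => //.
    exact: letter_linear_ev_comm.
  by rewrite size_takel // tsz leq_addr.
under eq_fun => a do rewrite E //.
apply: linear_sw => x y; apply: (functional_linear (functional_ev M _ x)) => w.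
apply: (IHq _ _ _ _ _ s t) => //; last by rewrite size_drop tsz addKn.
exact: letter_linear_comm.
Qed.

Lemma functional_itsw (W : Type) (L : (W -> M) -> M) n (K : seq H -> W -> M) h :
  functional L ->
  L (fun w => itsw n (fun u => K u w) h) = itsw n (fun u => L (K u)) h.
Proof.
move=> Lf; elim: n K h => [|n IHn] K h /=; first by rewrite functionalZ.
by rewrite functional_sw //; apply: eq_sw => a b; apply: IHn.
Qed.

Lemma ev_Br1 s t K : letter_linear K -> ev (Br s t) 1 K =
  ev s 1 (fun w => ev t 1 (fun v => K (w ++ v) - K (v ++ w))).
Proof.
move=> Kl; rewrite /= sw1 //; split=> [b|a].
  exact/ev_linear/letter_linear_ev_comm.
apply: (functional_linear (functional_ev M _ a)) => w.
exact/ev_linear/letter_linear_comm.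
Qed.

(** An element acts on a commutator through its coproduct, so splitting its legs between the two
    subtrees gives an induction on the shape. This is what [HLie_distr] requires. *)
Lemma ev_graft o (ts : seq (term H)) h K : letter_linear K -> size ts = arity o ->
  itsw (arity o) (fun w => ev (graft o (beads w ts)) 1 K) h = ev (graft o ts) h K.
Proof.
elim: o ts h K => [|p IHp q IHq] ts h K Kl.
  case: ts => [|t [|//]] // _ /=.
  rewrite (sw_counitr (g := fun a => ev t (1 * a) K)) ?mul1r //.
  by apply: (linear_comp (ev_linear t Kl)); linear_auto.
move=> tsz; rewrite itsw_cat; last exact: (ev_graft_mlin (o := Bracket p q)).
rewrite [RHS]/=; apply: eq_sw => x y.
have st : size (take (arity p) ts) = arity p by rewrite size_takel // tsz leq_addr.
have sd : size (drop (arity p) ts) = arity q by rewrite size_drop tsz addKn.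
have Kr b := letter_linear_ev_comm (graft q (drop (arity p) ts)) b Kl.
rewrite -IHp //; apply: eq_itsw => u us.
transitivity (itsw (arity q) (fun v => ev (graft p (beads u (take (arity p) ts))) 1
    (fun w1 => ev (graft q (beads v (drop (arity p) ts))) 1
      (fun w2 => K (w1 ++ w2) - K (w2 ++ w1)))) y).
  by apply: eq_itsw => v vs; rewrite graft_beads_cat // ev_Br1.
rewrite -functional_itsw; last exact: functional_ev.
congr (ev _ 1 _); apply/funext => w; apply: IHq => //.
exact: letter_linear_comm.
Qed.

Lemma ev_antisym s t K : letter_linear K ->
  ev (Br s t) 1 K = - ev (Br t s) 1 K.
Proof.
move=> Kl; rewrite !ev_Br1 //.
rewrite (functional_exchange (functional_ev M s 1) _ (functional_ev M t 1)).
rewrite -(functionalN (functional_ev M t 1)); congr (ev t 1 _).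
apply/funext => w; rewrite -(functionalN (functional_ev M s 1)).
by congr (ev s 1 _); apply/funext => v; rewrite opprB.
Qed.

Lemma ev_BrBr s t u K : letter_linear K -> ev (Br (Br s t) u) 1 K =
  ev s 1 (fun a => ev t 1 (fun b => ev u 1 (fun c =>
    (K (a ++ b ++ c) - K (c ++ a ++ b)) - (K (b ++ a ++ c) - K (c ++ b ++ a))))).
Proof.
move=> Kl; rewrite ev_Br1 // ev_Br1; last exact: letter_linear_ev_comm.
congr (ev s 1 _); apply/funext => a; congr (ev t 1 _); apply/funext => b.
rewrite -(functionalB (functional_ev M u 1)); congr (ev u 1 _).
by apply/funext => c; rewrite !catA.
Qed.

(** Jacobi for commutators in the tensor algebra; the exchanges put the three evaluations in the
    order s, t, u, so that words can be compared. *)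
Lemma ev_Jacobi s t u K : letter_linear K ->
  ev (Br (Br s t) u) 1 K + ev (Br (Br t u) s) 1 K + ev (Br (Br u s) t) 1 K = 0.
Proof.
move=> Kl; rewrite !ev_BrBr //.
have ex (s' t' : term H) f := functional_exchange (functional_ev M s' 1) f (functional_ev M t' 1).
have -> : forall f : word -> word -> word -> M,
    ev t 1 (fun b => ev u 1 (fun c => ev s 1 (f b c))) =
    ev s 1 (fun a => ev t 1 (fun b => ev u 1 (fun c => f b c a))).
  move=> f; rewrite [RHS]ex; congr (ev t 1 _); apply/funext => b; exact: ex.
have -> : forall f : word -> word -> word -> M,
    ev u 1 (fun c => ev s 1 (fun a => ev t 1 (f c a))) =
    ev s 1 (fun a => ev t 1 (fun b => ev u 1 (fun c => f c a b))).
  move=> f; rewrite ex; congr (ev s 1 _); apply/funext => b; exact: ex.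
rewrite -!(functionalD (functional_ev M s 1)).
have f0 (s' : term H) := functional0 (functional_ev M s' 1).
rewrite -[RHS](f0 s); congr (ev s 1 _); apply/funext => a.
rewrite -!(functionalD (functional_ev M t 1)).
rewrite -[RHS](f0 t); congr (ev t 1 _); apply/funext => b.
rewrite -!(functionalD (functional_ev M u 1)).
rewrite -[RHS](f0 u); congr (ev u 1 _); apply/funext => c.
have sum0 (x y z : M) : x - y + (z - x) + (y - z) = 0.
  by rewrite [x - y + _]addrC subrKA subrKA subrr.
rewrite [X in X + _]addrACA [LHS]addrACA sum0 add0r -!opprD.
by rewrite subrKA subrKA subrr oppr0.
Qed.

Section Pairing.
Variable K : word -> M.
Hypotheses (Kl : letter_linear K) (Kcyc : forall w v, K (w ++ v) = K (v ++ w)).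
Hypothesis Kinv : forall w g, act w g K = eps g *: K w.

Definition pairing (T : tree H) : M :=
  ev T.1 1 (fun w => ev T.2 1 (fun v => K (w ++ v))).

(** Insert h2 S(h3), which sums to a counit. Then h1 and h2 act together on a concatenation, where
    the invariance of [K] removes them, and S(h3) acting on v remains. *)
Lemma act_antipode w v h :
  act w h (fun w' => K (w' ++ v)) = act v (S h) (fun v' => K (w ++ v')).
Proof.
pose Z := sw (fun h1 r => sw (fun h2 h3 => act w h1 (fun w' =>
  act v (h2 * S h3) (fun v' => K (w' ++ v')))) r) h.
transitivity Z.
  rewrite -[LHS](sw_counitr (g := fun h => act w h (fun w' => K (w' ++ v)))); last first.
    by apply: act_linear; apply: letter_linear_catr.
  apply: eq_sw => h1 r.
  rewrite (sw_antipoder (g := fun x => act w h1 (fun w' =>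
    act v x (fun v' => K (w' ++ v'))))); last first.
    apply: (functional_linear (functional_act M w h1)) => w'.
    by apply: act_linear; apply: letter_linear_catl.
  congr (_ *: act w h1 _); apply/funext => w'; rewrite act1 //.
  exact: letter_linear_catl.
rewrite /Z -(swA (f := fun h1 h2 h3 => act w h1 (fun w' =>
  act v (h2 * S h3) (fun v' => K (w' ++ v'))))); last first.
  split=> [b c|a c|a b].
  - apply: act_linear => w1 p w2; apply: (functional_linear (functional_act M v _)) => v'.
    exact: (letter_linear_catr v' Kl).
  - apply: (functional_linear (functional_act M w a)) => w'.
    by apply: (linear_comp (act_linear v (letter_linear_catl w' Kl))); linear_auto.
  apply: (functional_linear (functional_act M w a)) => w'.
  by apply: (linear_comp (act_linear v (letter_linear_catl w' Kl))); linear_auto.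
rewrite -[RHS](sw_counitl (g := fun h => act v (S h) (fun v' => K (w ++ v')))); last first.
  by apply: (linear_comp (act_linear v (letter_linear_catl w Kl))); linear_auto.
apply: eq_sw => s h3.
transitivity (act v (S h3) (fun v'' => act (w ++ v'') s K)); last first.
  rewrite -(functionalZ (functional_act M v (S h3))); congr (act v _ _).
  by apply/funext => v''; rewrite Kinv.
transitivity (act v (S h3) (fun v'' => sw (fun a b => act w a (fun w' =>
    act v'' b (fun v' => K (w' ++ v')))) s)); last first.
  by congr (act v _ _); apply/funext => v''; rewrite act_cat.
rewrite (functional_sw _ _ (functional_act M v (S h3))); apply: eq_sw => h1 h2.
rewrite -(functional_exchange (functional_act M w h1) _ (functional_act M v (S h3))).
congr (act w h1 _); apply/funext => w'; rewrite act_mul //.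
exact: letter_linear_catl.
Qed.

Lemma ev_antipode t u h :
  ev t h (fun w => ev u 1 (fun v => K (w ++ v))) =
  ev t 1 (fun w => ev u (S h) (fun v => K (w ++ v))).
Proof.
have Ku := letter_linear_ev u 1 Kl.
rewrite -{1}(mulr1 h) ev_act //; congr (ev t 1 _); apply/funext => w.
rewrite -(mulr1 (S h)) ev_act //; last exact: letter_linear_catl.
rewrite (functional_exchange (functional_act M w h) _ (functional_ev M u 1)).
congr (ev u 1 _); apply/funext => v; exact: act_antipode.
Qed.

(** Flip is the cyclicity of [K], shift the invariance of a trace form under commutators, and the
    antipode relation comes from [act_antipode]. The other relations hold already for [ev]. *)
Lemma pairing_invariant : HLie_invariant pairing.
Proof.
have fl := @fglift_lin k (tree H) M pairing.
have Kr u := letter_linear_ev u 1 Kl.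
move=> _ [s t|s t u|s t u|s t u v|c g h t u|g h t u|t u|h t u|h o ts u tsz];
  rewrite ?(linB fl) ?(linD fl) ?(linZ fl) ?fgliftU.
- apply/eqP; rewrite subr_eq0; apply/eqP; rewrite /pairing /=.
  rewrite (functional_exchange (functional_ev M s 1) _ (functional_ev M t 1)).
  congr (ev t 1 _); apply/funext => w.
  by congr (ev s 1 _); apply/funext => v; rewrite Kcyc.
- apply/eqP; rewrite subr_eq0; apply/eqP; rewrite /pairing [_.1]/= [_.2]/=.
  rewrite ev_Br1 //; congr (ev s 1 _); apply/funext => a.
  rewrite ev_Br1; last exact: letter_linear_catl.
  congr (ev t 1 _); apply/funext => b; rewrite -(functionalB (functional_ev M u 1)).
  congr (ev u 1 _); apply/funext => c; rewrite -!catA; congr (_ - _).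
  by rewrite Kcyc catA.
- by rewrite /pairing [_.1]/= ev_antisym // addNr.
- exact: ev_Jacobi.
- rewrite /pairing /= !mul1r (ev_linear t (Kr u)).
  by rewrite [_ *: _ + _]addrC addrK subrr.
- by rewrite /pairing /= mulrA subrr.
- by rewrite /pairing /= mul1r subrr.
- by rewrite /pairing /= !mul1r ev_antipode subrr.
rewrite mext_comp; last exact: fglift_lin.
apply/eqP; rewrite subr_eq0; apply/eqP; rewrite /pairing [_.1]/= [_.2]/=.
rewrite (mext_iterDelta (f := fun w => ev (graft o (beads w ts)) 1
  (fun w => ev u 1 (fun v => K (w ++ v))))).
- by rewrite ev_graft //= mul1r.
- exact: ev_graft_mlin.
by move=> w; rewrite /= fgliftU.
Qed.

End Pairing.
End Invariance.

(** * The weight of a one-vertex graph with two edges *)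

Section Weight.
Variables (k : fieldType) (H : hopfAlgebra k).
Hypothesis cocomm : cocommutative H.
Local Notation S := (@antipode k H).
Local Notation eps := (@counit k H).
Variable M : lmodType k.
Variable F : H -> H -> M.
Hypotheses (Fl : bilin F) (Finv : conj_invariant F).
Hypotheses (FC : forall a b, F a b = F b a) (FS : forall a b, F (S a) b = - F a b).
Local Notation word := (seq (nat * H)).
Implicit Types (e : nat * nat) (w : word).

Definition match_sign e (x y : nat) : k := ((x, y) == e)%:R - ((y, x) == e)%:R.

Lemma match_signC e x y : match_sign e y x = - match_sign e x y.
Proof. by rewrite /match_sign opprB. Qed.

Lemma match_sign_rev e x y : match_sign (e.2, e.1) x y = - match_sign e x y.
Proof.
by rewrite /match_sign !xpair_eqE opprB ![(_ == e.2) && _]andbC; case: e.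
Qed.

(** Letters 1, 3 and letters 2, 4 are the diagonals of a cyclic word of length four; the summands
    are the two placements of the edges on them. *)
Definition crossing e1 e2 (x1 x2 x3 x4 : nat) : k :=
  match_sign e1 x1 x3 * match_sign e2 x2 x4
  + match_sign e2 x1 x3 * match_sign e1 x2 x4.

(* Nonzero only on the words in which the ends of the two edges alternate. *)
Definition theta_weight e1 e2 w : M :=
  match w with
  | [:: l1; l2; l3; l4] =>
      crossing e1 e2 l1.1 l2.1 l3.1 l4.1
        *: F (l3.2 * S l1.2) (l4.2 * S l2.2)
  | _ => 0
  end.

Lemma theta_weight_letter_linear e1 e2 : letter_linear (theta_weight e1 e2).
Proof.
case=> [|l1 [|l2 [|l3 [|l4 w]]]] p [|m1 [|m2 [|m3 [|m4 v]]]] /=;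
  try (by linear_auto); by case: w => [|l5 w] /=; linear_auto.
Qed.

(** Rotation exchanges the diagonals, which [FC] absorbs, and reverses one of them: [FS] gives a
    sign and [match_sign] the opposite one. *)
Lemma theta_weight_rot e1 e2 l w :
  theta_weight e1 e2 (rcons w l) = theta_weight e1 e2 (l :: w).
Proof.
case: w => [|l2 [|l3 [|l4 [|l5 [|l6 w]]]]] //=.
have -> : F (l4.2 * S l2.2) (l.2 * S l3.2) = - F (l3.2 * S l.2) (l4.2 * S l2.2).
  by rewrite FC -FS antipodeM (antipodeK cocomm).
rewrite scalerN -scaleNr /crossing; congr (_ *: _).
rewrite (match_signC _ l.1 l3.1) (match_signC e1 l.1 l3.1) !mulrN -opprD opprK addrC.
by rewrite ![match_sign _ l2.1 _ * _]mulrC.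
Qed.

Lemma theta_weight_cyclic e1 e2 w v :
  theta_weight e1 e2 (w ++ v) = theta_weight e1 e2 (v ++ w).
Proof.
elim: w v => [|l w IHw] v; first by rewrite cats0.
by rewrite cat_cons -theta_weight_rot rcons_cat IHw -cats1 -catA.
Qed.

Lemma act_eq0 w g (K : word -> M) :
  (forall v, size v = size w -> K v = 0) -> act w g K = 0.
Proof.
elim: w g K => [|p w IHw] g K K0 /=; first by rewrite K0 // scaler0.
by rewrite /sw big1 // => q _; apply: IHw => v vw; apply: K0; rewrite /= vw.
Qed.

(** The legs of g on the ends x, y of an edge turn h_y S(h_x) into g_y h_y S(h_x) S(g_x).
    Cocommutativity orders the legs so that this is a joint conjugation of both holonomies. *)
Lemma theta_weight_inv e1 e2 w g :
  act w g (theta_weight e1 e2) = eps g *: theta_weight e1 e2 w.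
Proof.
case: w => [|l1 [|l2 [|l3 [|l4 [|l5 w]]]]];
  try by rewrite act_eq0 ?scaler0 // => -[|? [|? [|? []]]].
  set c := crossing e1 e2 l1.1 l2.1 l3.1 l4.1.
  pose G a b x y := c *: F (x * (l3.2 * S l1.2) * S a) (y * (l4.2 * S l2.2) * S b).
  transitivity (sw (fun a r => sw (fun b r' => sw (fun x y => G a b x y) r') r) g).
    apply: eq_sw => a r; apply: eq_sw => b r'; apply: eq_sw => x y.
    rewrite (sw_counitr (g := fun y => c *: F (x * l3.2 * S (a * l1.2)) (y * l4.2 * S (b * l2.2)))).
      by rewrite /G !antipodeM !mulrA.
    by linear_auto.
  rewrite -(swA (f := fun a b r => sw (fun x y => G a b x y) r)); last first.
    by rewrite /G; linear_auto.
  rewrite -(swC (f := fun s r => sw (fun a b => sw (fun x y => G a b x y) r) s)) //; last first.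
    by rewrite /G; linear_auto.
  rewrite /= scalerA mulrC -scalerA -(Finv g) conj2_interchange // (sw_comp (g := fun m => c *: m));
    last first.
    by linear_auto.
  apply: eq_sw => p q; rewrite sw_exchange sw_comp; last by linear_auto.
  by apply: eq_sw => a b; rewrite sw_comp //; linear_auto.
by rewrite act_eq0 ?scaler0 // => -[|? [|? [|? [|? [|]]]]].
Qed.

Definition graph_weight (G : graph H) : M :=
  match G with
  | ([:: T], [:: e1; e2]) => pairing (theta_weight e1 e2) T
  | _ => 0
  end.

Lemma graph_weight_invariant es : HLie_invariant (fun T => graph_weight ([:: T], es)).
Proof.
case: es => [|e1 [|e2 [|e3 es]]] r rr; last first.
- by rewrite fgliftE big1 // => z _; rewrite scaler0.
- apply: (pairing_invariant cocomm) rr.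
  + exact: theta_weight_letter_linear.
  + exact: theta_weight_cyclic.
  exact: theta_weight_inv.
- by rewrite fgliftE big1 // => z _; rewrite scaler0.
by rewrite fgliftE big1 // => z _; rewrite scaler0.
Qed.

Lemma theta_weightC e1 e2 : theta_weight e1 e2 = theta_weight e2 e1.
Proof.
by apply/funext => -[|l1 [|l2 [|l3 [|l4 [|]]]]] //=; rewrite /crossing addrC.
Qed.

Lemma graph_weight_edges vs es es' : perm_eq es es' ->
  graph_weight (vs, es) = graph_weight (vs, es').
Proof.
case: vs => [|T [|]] // ees'; have := perm_size ees'.
case: es ees' => [|e1 [|e2 [|e3 es]]]; case: es' => [|f1 [|f2 [|f3 es']]] //= ees' _.
have /orP[/eqP e1f1|/eqP e1f2] : (e1 == f1) || (e1 == f2).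
  by have := perm_mem ees' e1; rewrite !inE eqxx.
  by move: ees'; rewrite e1f1 perm_cons => /perm_small_eq-/(_ isT)[->].
have f12 : perm_eq [:: f1; f2] [:: f2; f1] by exact/permPl/(perm_catC [:: f1] [:: f2]).
move: (perm_trans ees' f12); rewrite e1f2 perm_cons.
by move=> /perm_small_eq-/(_ isT)[->]; rewrite theta_weightC.
Qed.

Definition rename_word (f : nat -> nat) w : word := [seq (f l.1, l.2) | l <- w].

Lemma ev_rename f (t : term H) h (K : word -> M) :
  ev (rename_term f t) h K = ev t h (fun w => K (rename_word f w)).
Proof.
elim: t h K => [x|g t IHt|t IHt u IHu] h K //=.
apply: eq_sw => a b; rewrite IHt; congr (ev t a _); apply/funext => w.
rewrite IHu; congr (ev u b _); apply/funext => v.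
by rewrite /rename_word !map_cat.
Qed.

Lemma graph_weight_rename f G : injective f ->
  graph_weight (rename f G) = graph_weight G.
Proof.
move=> fi; case: G => -[|T [|U vs]] es //.
case: es => [|e1 [|e2 [|]]] //=; rewrite /pairing /= ev_rename.
congr (ev T.1 1 _); apply/funext => w; rewrite ev_rename.
congr (ev T.2 1 _); apply/funext => v; rewrite /rename_word -map_cat.
have sE e x y : match_sign (f e.1, f e.2) (f x) (f y) = match_sign e x y.
  by rewrite /match_sign !xpair_eqE !(inj_eq fi) -!xpair_eqE; case: e.
by case: (w ++ v) => [|l1 [|l2 [|l3 [|l4 [|]]]]] //=; rewrite /crossing !sE.
Qed.

Lemma theta_weight_rev1 e1 e2 w :
  theta_weight (e1.2, e1.1) e2 w = - theta_weight e1 e2 w.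
Proof.
case: w => [|l1 [|l2 [|l3 [|l4 [|]]]]] //=; rewrite ?oppr0 //.
by rewrite -scaleNr /crossing !match_sign_rev mulNr mulrN opprD.
Qed.

Lemma pairing_opp (K K' : word -> M) T : (forall w, K w = - K' w) ->
  pairing K T = - pairing K' T.
Proof.
move=> KK'; rewrite /pairing -(functionalN (functional_ev M T.1 1)).
congr (ev T.1 1 _); apply/funext => w.
rewrite -(functionalN (functional_ev M T.2 1)).
by congr (ev T.2 1 _); apply/funext => v; rewrite KK'.
Qed.

Lemma graph_weight_reverse vs es x y es' :
  graph_weight (vs, es ++ (y, x) :: es') = - graph_weight (vs, es ++ (x, y) :: es').
Proof.
case: vs => [|T [|U vs]]; rewrite /= ?oppr0 //.
case: es => [|e1 [|e2 [|e3 es]]]; case: es' => [|f1 [|f2 es']] /=; rewrite ?oppr0 //.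
  by apply: pairing_opp => w; rewrite -theta_weight_rev1.
by apply: pairing_opp => w; rewrite !(theta_weightC e1) -theta_weight_rev1.
Qed.

Definition bead_word h x w : word :=
  [seq (l.1, if l.1 == x then l.2 * h else l.2) | l <- w].

Lemma ev_bead_at h x (t : term H) g (K : word -> M) :
  ev (bead_at h x t) g K = ev t g (fun w => K (bead_word h x w)).
Proof.
elim: t g K => [y|b t IHt|t IHt u IHu] g K //=; first by case: ifP.
apply: eq_sw => a b; rewrite IHt; congr (ev t a _); apply/funext => w.
rewrite IHu; congr (ev u b _); apply/funext => v.
by rewrite /bead_word !map_cat.
Qed.

Lemma term_slots_bead_at h x (t : term H) : term_slots (bead_at h x t) = term_slots t.
Proof.
by elim: t => [y|b t IHt|t IHt u IHu] //=; [case: ifP|rewrite IHt IHu].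
Qed.

(** A bead h at x and a bead S(h) at y both turn h_y S(h_x) into h_y S(h) S(h_x); for the edge read
    from y to x this uses S(S(h)) = h. As slots are distinct, a bead changes one letter. *)
Lemma theta_weight_bead h x y e w : x != y -> uniq (map fst w) ->
  x \in map fst w -> y \in map fst w ->
  theta_weight (x, y) e (bead_word h x w) = theta_weight (x, y) e (bead_word (S h) y w).
Proof.
move=> xy; case: w => [|[p1 h1] [|[p2 h2] [|[p3 h3] [|[p4 h4] [|l5 w]]]]] //.
rewrite /= !inE !negb_or => /and4P[/and3P[n12 n13 n14] /andP[n23 n24] n34 _].
have neq := (negbTE n12, negbTE n13, negbTE n14, negbTE n23, negbTE n24, negbTE n34).
have neq' : (p2 == p1) = false /\ (p3 == p1) = false /\ (p4 == p1) = false /\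
    (p3 == p2) = false /\ (p4 == p2) = false /\ (p4 == p3) = false.
  by split; [|split; [|split; [|split; [|split]]]]; rewrite eq_sym neq.
case: neq' => q1 [q2 [q3 [q4 [q5 q6]]]]; have neq2 := (q1, q2, q3, q4, q5, q6).
move=> /or4P[]/eqP xE /or4P[]/eqP yE; subst x y; rewrite ?eqxx // in xy *;
rewrite /crossing /match_sign !xpair_eqE !eqxx ?neq ?neq2 /= ?andbF ?subrr ?mul0r ?mulr0
  ?addr0 ?scale0r //;
by rewrite !antipodeM ?(antipodeK cocomm) !mulrA.
Qed.

Lemma graph_weight_slide h x y T e : x != y ->
  uniq (slots T) -> x \in slots T -> y \in slots T ->
  graph_weight (graph_bead_at h x ([:: T], [:: (x, y); e])) =
  graph_weight (graph_bead_at (S h) y ([:: T], [:: (x, y); e])).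
Proof.
move=> xy Tu xT yT; rewrite /= /pairing /= !ev_bead_at.
apply: eq_ev => w wT; rewrite !ev_bead_at; apply: eq_ev => v vT.
have wvT : perm_eq (map fst (w ++ v)) (slots T) by rewrite map_cat perm_cat.
rewrite /bead_word -!map_cat; apply: theta_weight_bead => //.
- by rewrite (perm_uniq wvT).
- by rewrite (perm_mem wvT).
by rewrite (perm_mem wvT).
Qed.

End Weight.

Section RankTwoGraphs.
Variables (k : fieldType) (H : hopfAlgebra k).

Lemma is_graph21P (G : graph H) :
  reflect (exists T x y z w, [/\ G = ([:: T], [:: (x, y); (z, w)]),
             uniq (slots T) & perm_eq [:: x; y; z; w] (slots T)])
          (is_graph 2 1 G).
Proof.
apply: (iffP idP) => [|[T [x [y [z [w [-> Tu TE]]]]]]].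
  case: G => [[|T [|U vs]] es]; rewrite /is_graph /= ?andbF //.
  case/and5P=> Tu TE _ _ /andP[esz _].
  move: Tu TE; rewrite /half_edges /edge_ends /= cats0 => Tu TE.
  case: es esz TE => [|[x y] [|[z w] [|]]] //= _ TE; by exists T, x, y, z, w.
rewrite /is_graph /half_edges /edge_ends /= cats0 Tu TE -(perm_size TE) /=.
rewrite andbT; apply/andP; split=> //; apply/forallP => i; apply/forallP => j.
by rewrite !ord1 connect0.
Qed.

End RankTwoGraphs.

(** * Normal forms of decorated trees *)

Section Permutations.
Variable T : eqType.
Implicit Types a b c x y z : T.

Lemma perm_eq2 a b x y : perm_eq [:: a; b] [:: x; y] ->
  a = x /\ b = y \/ a = y /\ b = x.
Proof.
move=> abxy; have := perm_mem abxy a; rewrite !inE eqxx /= => /esym/orP[]/eqP aE.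
  by left; move: abxy; rewrite aE perm_cons => /perm_small_eq-/(_ isT)[->].
right; have xy : perm_eq [:: x; y] [:: y; x] by apply/permPl/(perm_catC [:: x] [:: y]).
by move: (perm_trans abxy xy); rewrite aE perm_cons => /perm_small_eq-/(_ isT)[->].
Qed.

Lemma perm_eq3 a b c x y z : perm_eq [:: a; b; c] [:: x; y; z] ->
  [\/ a = x /\ perm_eq [:: b; c] [:: y; z],
      a = y /\ perm_eq [:: b; c] [:: x; z] |
      a = z /\ perm_eq [:: b; c] [:: x; y]].
Proof.
move=> abc; have := perm_mem abc a; rewrite !inE eqxx /= => /esym/or3P[]/eqP aE.
- by constructor 1; move: abc; rewrite aE perm_cons.
- constructor 2; have xy : perm_eq [:: x; y; z] [:: y; x; z].
    by apply/permPl/(perm_catCA [:: x] [:: y] [:: z]).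
  by move: (perm_trans abc xy); rewrite aE perm_cons.
constructor 3; have xy : perm_eq [:: x; y; z] [:: z; x; y].
  by apply/permPl/(perm_catC [:: x; y] [:: z]).
by move: (perm_trans abc xy); rewrite aE perm_cons.
Qed.

End Permutations.

Section Terms.
Variables (k : fieldType) (H : hopfAlgebra k).
Local Notation term := (term H).
Implicit Types (s c t u v : term).

Fixpoint subst (x : nat) (u t : term) : term :=
  match t with
  | Slot y => if y == x then u else Slot H y
  | Bead g s => Bead g (subst x u s)
  | Br s v => Br (subst x u s) (subst x u v)
  end.

Lemma subst_notin x u t : x \notin term_slots t -> subst x u t = t.
Proof.
elim: t => [y|g t IHt|s IHs t IHt] /=.
- by rewrite inE eq_sym => /negbTE->.
- by move=> /IHt->.
by rewrite mem_cat negb_or => /andP[/IHs-> /IHt->].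
Qed.

Lemma subst_slot x t : subst x (Slot H x) t = t.
Proof.
by elim: t => [y|g t IHt|s IHs t IHt] /=; [case: eqP => // ->|rewrite IHt|rewrite IHs IHt].
Qed.

Lemma subst_graft x u o ts : size ts = arity o ->
  subst x u (graft o ts) = graft o [seq subst x u t | t <- ts].
Proof.
elim: o ts => [|p IHp q IHq] ts /=; first by case: ts => [|t []].
move=> tsz; rewrite IHp ?IHq ?map_take ?map_drop //.
  by rewrite size_drop tsz addKn.
by rewrite size_takel // tsz leq_addr.
Qed.

Lemma subst_beads x u (hs : seq H) ts :
  [seq subst x u t | t <- beads hs ts] = beads hs [seq subst x u t | t <- ts].
Proof. by elim: hs ts => [|h hs IHhs] [|t ts] //=; congr cons; apply: IHhs. Qed.

Lemma term_slots_reroot x s c : x \in term_slots s ->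
  perm_eq (x :: term_slots (reroot x s c)) (term_slots s ++ term_slots c).
Proof.
elim: s c => [y|g t IHt|s IHs t IHt] c /=.
- by rewrite inE => /eqP->.
- exact: IHt.
rewrite mem_cat; case: ifP => [xs _|_ /= xt].
  by apply: perm_trans (IHs _ xs) _; rewrite /= catA.
apply: perm_trans (IHt _ xt) _ => /=.
by rewrite catA perm_catC catA.
Qed.

Lemma term_slots_root_at x (T : tree H) : x \in slots T ->
  perm_eq (x :: term_slots (root_at x T)) (slots T).
Proof.
rewrite /slots /root_at mem_cat; case: ifP => [xs _|_ /= xt].
  exact: term_slots_reroot.
by rewrite perm_sym perm_catC perm_sym; apply: term_slots_reroot.
Qed.

(** Pushing beads towards the leaves preserves this shape, so it records the slots of a normal
    form. *)
Fixpoint strip t : term :=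
  match t with
  | Slot x => Slot H x
  | Bead _ s => strip s
  | Br s u => Br (strip s) (strip u)
  end.

Fixpoint normal t : bool :=
  match t with
  | Bead _ (Slot _) => true
  | Br s u => normal s && normal u
  | _ => false
  end.

Lemma term_slots_strip t : term_slots (strip t) = term_slots t.
Proof. by elim: t => [y|g t IHt|s IHs t IHt] //=; rewrite IHs IHt. Qed.

Lemma size_term_slots_gt0 t : (0 < size (term_slots t))%N.
Proof.
by elim: t => [y|g t IHt|s IHs t IHt] //=; rewrite size_cat addn_gt0 IHs.
Qed.

Lemma normal1 t : normal t -> size (term_slots t) = 1%N ->
  exists a x, t = Bead a (Slot H x).
Proof.
case: t => [|a [x|//|//]|s u] //=; first by move=> _ _; exists a, x.
rewrite size_cat => _; have := size_term_slots_gt0 s; have := size_term_slots_gt0 u.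
by case: (size _) => [|?] //; case: (size _) => [|?] //; rewrite addSn addnS.
Qed.

Lemma normal2 t : normal t -> size (term_slots t) = 2 ->
  exists a x b y, t = Br (Bead a (Slot H x)) (Bead b (Slot H y)).
Proof.
case: t => [|a [x|//|//]|s u] //= /andP[sn un].
rewrite size_cat; have := size_term_slots_gt0 s; have := size_term_slots_gt0 u.
case su: (size (term_slots s)) => [|[|n]] //; case uu: (size (term_slots u)) => [|[|m]] //;
  rewrite ?addnS // => _ _ _.
have [a [x ->]] := normal1 sn su; have [b [y ->]] := normal1 un uu.
by exists a, x, b, y.
Qed.

Lemma normal3 t : normal t -> size (term_slots t) = 3 ->
  exists a x b y d z,
    let p := Br (Bead a (Slot H x)) (Bead b (Slot H y)) in
    let q := Bead d (Slot H z) in t = Br p q \/ t = Br q p.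
Proof.
case: t => [|a [x|//|//]|s u] //= /andP[sn un].
rewrite size_cat; have := size_term_slots_gt0 s; have := size_term_slots_gt0 u.
case su: (size (term_slots s)) => [|[|[|n]]] //;
  case uu: (size (term_slots u)) => [|[|[|m]]] //; rewrite ?addnS // => _ _ _.
  have [d [z ->]] := normal1 sn su; have [a [x [b [y ->]]]] := normal2 un uu.
  by exists a, x, b, y, d, z; right.
have [d [z ->]] := normal1 un uu; have [a [x [b [y ->]]]] := normal2 sn su.
by exists a, x, b, y, d, z; left.
Qed.

End Terms.

(** * Consequences of the relations for an invariant function *)

Section Invariants.
Variables (k : fieldType) (H : hopfAlgebra k).
Local Notation S := (@antipode k H).
Variables (M : lmodType k) (f : tree H -> M).
Hypothesis fi : HLie_invariant f.
Implicit Types (s c t u v : term H).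

Let fl := @fglift_lin k (tree H) M f.

Lemma inv_flip s t : f (s, t) = f (t, s).
Proof.
have := fi (HLie_flip s t); rewrite (linB fl) !fgliftU => /eqP.
by rewrite subr_eq0 => /eqP.
Qed.

Lemma inv_shift s t u : f (Br s t, u) = f (s, Br t u).
Proof.
have := fi (HLie_shift s t u); rewrite (linB fl) !fgliftU => /eqP.
by rewrite subr_eq0 => /eqP.
Qed.

Lemma inv_antisym s t u : f (Br s t, u) = - f (Br t s, u).
Proof.
have := fi (HLie_antisym s t u); rewrite (linD fl) !fgliftU => /eqP.
by rewrite addr_eq0 => /eqP.
Qed.

Lemma inv_IHX s t u v :
  f (Br (Br s t) u, v) + f (Br (Br t u) s, v) + f (Br (Br u s) t, v) = 0.
Proof. by have := fi (HLie_IHX s t u v); rewrite !(linD fl) !fgliftU. Qed.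

Lemma inv_linear t u : linear (fun h => f (Bead h t, u)).
Proof.
move=> c g h; have := fi (HLie_linear c g h t u).
rewrite !(linB fl) (linZ fl) !fgliftU => /eqP.
by rewrite -addrA -opprD subr_eq0 => /eqP.
Qed.

Lemma inv_mul g h t u : f (Bead g (Bead h t), u) = f (Bead (g * h) t, u).
Proof.
have := fi (HLie_mul g h t u); rewrite (linB fl) !fgliftU => /eqP.
by rewrite subr_eq0 => /eqP.
Qed.

Lemma inv_one t u : f (Bead 1 t, u) = f (t, u).
Proof.
have := fi (HLie_one t u); rewrite (linB fl) !fgliftU => /eqP.
by rewrite subr_eq0 => /eqP.
Qed.

Lemma inv_antipode h t u : f (Bead h t, u) = f (t, Bead (S h) u).
Proof.
have := fi (HLie_antipode h t u); rewrite (linB fl) !fgliftU => /eqP.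
by rewrite subr_eq0 => /eqP.
Qed.

Lemma inv_swap s t u : f (s, Br t u) = f (t, Br u s).
Proof. by rewrite inv_flip inv_shift. Qed.

Lemma inv_mul_l g h s t u :
  f (Br (Bead g (Bead h s)) t, u) = f (Br (Bead (g * h) s) t, u).
Proof. by rewrite !inv_shift inv_mul. Qed.

Lemma inv_mul_r g h s t u :
  f (Br t (Bead g (Bead h s)), u) = f (Br t (Bead (g * h) s), u).
Proof. by rewrite !(inv_antisym t) inv_mul_l. Qed.

Lemma inv_one_l s t u : f (Br (Bead 1 s) t, u) = f (Br s t, u).
Proof. by rewrite !inv_shift inv_one. Qed.

Lemma inv_one_r s t u : f (Br t (Bead 1 s), u) = f (Br t s, u).
Proof. by rewrite !(inv_antisym t) inv_one_l. Qed.

Lemma inv_beads_bilin s t u :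
  bilin (fun a b => f (Br (Bead a s) (Bead b t), u)).
Proof.
split=> [b|a].
  by move=> c x y; rewrite !inv_shift; apply: inv_linear.
have E b : f (Br (Bead a s) (Bead b t), u) = f (Bead b t, Br u (Bead a s)).
  by rewrite inv_shift inv_swap.
by move=> c x y; rewrite !E; apply: inv_linear.
Qed.

Lemma inv_distr h s t u :
  f (Bead h (Br s t), u) = sw (fun a b => f (Br (Bead a s) (Bead b t), u)) h.
Proof.
have := fi (@HLie_distr k H h (Bracket Input Input) [:: s; t] u erefl).
rewrite (linB fl) fgliftU mext_comp; last exact: fglift_lin.
move=> /eqP; rewrite subr_eq0 => /eqP; rewrite [graft _ _]/= => ->.
have fb := inv_beads_bilin s t u.
rewrite (mext_iterDelta (f := fun w => f (Br (Bead w`_0 s) (Bead w`_1 t), u))).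
- rewrite /=; apply: eq_sw => a b.
  by rewrite (sw_counitr (g := fun b => f (Br (Bead a s) (Bead b t), u))) //; apply: fb.2.
- by case=> [|a [|b w]] [|c [|d v]] //= _; [apply: fb.1|apply: fb.2].
by case=> -[|a [|b [|]]] //= i; rewrite fgliftU.
Qed.

(** Each step of [reroot] moves the distinguished edge past one bead or trivalent vertex, as the
    relations allow; joining u to the root reached at x is grafting u at the leaf x. *)
Lemma inv_reroot x s c u : uniq (term_slots s) -> x \in term_slots s ->
  f (reroot x s c, u) = f (subst x u s, c).
Proof.
elim: s c => [y|h t IHt|s IHs t IHt] c /=.
- by rewrite inE => _ /eqP->; rewrite eqxx inv_flip.
- by move=> tu xt; rewrite IHt // inv_antipode.
rewrite cat_uniq mem_cat => /and3P[su st tu].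
case: ifP => [xs _|_ /= xt].
  rewrite IHs // (@subst_notin _ _ x u t) ?inv_shift //.
  by apply: contra st => xt; apply/hasP; exists x.
rewrite IHt // (@subst_notin _ _ x u s); last first.
  by apply: contra st => xs; apply/hasP; exists x.
by rewrite [RHS]inv_shift [RHS]inv_swap.
Qed.

Lemma inv_root_at x (T : tree H) u : uniq (slots T) -> x \in slots T ->
  f (root_at x T, u) = f (subst x u T.1, subst x u T.2).
Proof.
case: T => s t; rewrite /slots /root_at /= cat_uniq mem_cat => /and3P[su st tu].
case: ifP => [xs _|_ /= xt]; rewrite inv_reroot //.
  rewrite (@subst_notin _ _ x u t) //.
  by apply: contra st => xt; apply/hasP; exists x.
rewrite (@subst_notin _ _ x u s) 1?inv_flip //.
by apply: contra st => xs; apply/hasP; exists x.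
Qed.

Section Span.
Variable Z : {pred M}.
Hypothesis Zs : submod_closed Z.

Lemma submod_sum I (r : seq I) (F : I -> M) :
  (forall i, F i \in Z) -> \sum_(i <- r) F i \in Z.
Proof.
case: Zs => Z0 ZP FZ; elim: r => [|i r IHr]; first by rewrite big_nil.
by rewrite big_cons -[F i]scale1r ZP.
Qed.

Lemma submodN x : x \in Z -> - x \in Z.
Proof.
by case: Zs => Z0 ZP xZ; rewrite -scaleN1r -[_ *: _]addr0 ZP.
Qed.

(** Beads merge by [inv_mul] and pass a vertex by [inv_distr]. Each branch is made distinguished in
    turn, the rest of the tree taking the place of [u] in the induction. *)
Lemma inv_normal_bead h t u :
  (forall t', normal t' -> strip t' = strip t -> f (t', u) \in Z) ->
  f (Bead h t, u) \in Z.
Proof.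
elim: t h u => [x|g t IHt|s IHs t IHt] h u HZ.
- exact: HZ.
- by rewrite inv_mul; apply: IHt.
rewrite inv_distr; apply: submod_sum => p.
rewrite inv_shift; apply: IHs => s' s'n s's.
rewrite inv_swap; apply: IHt => t' t'n t't.
rewrite inv_swap inv_swap -inv_shift; apply: HZ; first by rewrite /= s'n.
by rewrite /= s's t't.
Qed.

(** A bead 1 inserted at the root is pushed upwards, so that every leaf ends with a bead. *)
Lemma inv_normal t u :
  (forall t', normal t' -> strip t' = strip t -> f (t', u) \in Z) ->
  f (t, u) \in Z.
Proof. by rewrite -inv_one; apply: inv_normal_bead. Qed.

Lemma inv_normal_root x T ys : uniq (slots T) -> perm_eq (x :: ys) (slots T) ->
  (forall t, normal t -> perm_eq (term_slots t) ys -> f (t, Slot H x) \in Z) ->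
  f T \in Z.
Proof.
(* Grafting the slot x at itself changes nothing, so T is equivalent to its rerooting at x joined to
   the bare slot x. *)
move=> Tu Tx HZ; have xT : x \in slots T by rewrite -(perm_mem Tx) mem_head.
have := inv_root_at (Slot H x) Tu xT; rewrite !subst_slot -surjective_pairing => <-.
apply: inv_normal => t tn ts; apply: HZ => //.
rewrite -(perm_cons x) (perm_trans _ (_ : perm_eq (slots T) _)) 1?perm_sym //.
by rewrite -term_slots_strip ts term_slots_strip perm_sym term_slots_root_at.
Qed.

Lemma inv_normal2 x y T : uniq (slots T) -> perm_eq [:: x; y] (slots T) ->
  (forall a, f (Bead a (Slot H x), Slot H y) \in Z) -> f T \in Z.
Proof.
move=> Tu Txy HZ; apply: (inv_normal_root (x := y) (ys := [:: x])) => // [|t tn tx].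
  by apply: perm_trans Txy; apply/permPl/(perm_catC [:: y] [:: x]).
have [a [x' tE]] := normal1 tn (perm_size tx).
by move: tx; rewrite tE => /perm_small_eq-/(_ isT)[->].
Qed.

Lemma inv_normal3 x y z T : uniq (slots T) -> perm_eq [:: x; y; z] (slots T) ->
  (forall a b, f (Br (Bead a (Slot H x)) (Bead b (Slot H y)), Slot H z) \in Z) ->
  f T \in Z.
Proof.
move=> Tu Txy HZ; apply: (inv_normal_root (x := z) (ys := [:: x; y])) => // [|t tn tx].
  by apply: perm_trans Txy; apply/permPl/(perm_catC [:: z] [:: x; y]).
have [a [x' [b [y' tE]]]] := normal2 tn (perm_size tx).
move: tx; rewrite tE => /perm_eq2[] [-> ->]; first exact: HZ.
by rewrite inv_antisym; apply/submodN/HZ.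
Qed.

(** Up to orientation, a trivalent tree with four leaves is a splitting of them into two pairs; the
    three cases are indexed by the leaf paired with w, whose bead has been pushed to the others. *)
Lemma inv_normal4 x y z w (T : tree H) : uniq (slots T) ->
  perm_eq [:: x; y; z; w] (slots T) ->
  let lf h p := Bead h (Slot H p) in
  (forall a b d, f (Br (Br (lf a x) (lf b y)) (lf d z), Slot H w) \in Z) ->
  (forall a b d, f (Br (Br (lf a x) (lf b z)) (lf d y), Slot H w) \in Z) ->
  (forall a b d, f (Br (Br (lf a y) (lf b z)) (lf d x), Slot H w) \in Z) ->
  f T \in Z.
Proof.
move=> Tu Txy lf Hz Hy Hx.
have swap p q r a b d : f (Br (Br (lf a p) (lf b q)) (lf d r), Slot H w) \in Z ->
    f (Br (Br (lf b q) (lf a p)) (lf d r), Slot H w) \in Z.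
  by rewrite ![f (Br (Br _ _) _, _)]inv_shift inv_antisym => /submodN; rewrite opprK.
have HZ p q r a b d : perm_eq [:: r; p; q] [:: x; y; z] ->
    f (Br (Br (lf a p) (lf b q)) (lf d r), Slot H w) \in Z.
  by move=> /perm_eq3[[->]|[->]|[->]] /perm_eq2[] [-> ->];
    do [exact: Hx|exact: Hy|exact: Hz
      |apply: swap; exact: Hx|apply: swap; exact: Hy|apply: swap; exact: Hz].
apply: (inv_normal_root (x := w) (ys := [:: x; y; z])) => // [|t tn tx].
  by apply: perm_trans Txy; apply/permPl/(perm_catC [:: w] [:: x; y; z]).
have [a [p [b [q [d [r /= [] tE]]]]]] := normal3 tn (perm_size tx);
  move: tx; rewrite tE /= => tx; last by rewrite inv_antisym; apply/submodN/HZ.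
apply: HZ; apply: perm_trans tx; by apply/permPl/(perm_catC [:: r] [:: p; q]).
Qed.

End Span.

Lemma inv_normal4_eq0 x y z w (T : tree H) : uniq (slots T) ->
  perm_eq [:: x; y; z; w] (slots T) ->
  let lf h p := Bead h (Slot H p) in
  (forall a b d, f (Br (Br (lf a x) (lf b y)) (lf d z), Slot H w) = 0) ->
  (forall a b d, f (Br (Br (lf a x) (lf b z)) (lf d y), Slot H w) = 0) ->
  (forall a b d, f (Br (Br (lf a y) (lf b z)) (lf d x), Slot H w) = 0) ->
  f T = 0.
Proof.
move=> Tu TE lf Hz Hy Hx; apply/eqP.
by apply: (inv_normal4 (@pred0_submod_closed k M) Tu TE) => a b d; rewrite inE ?Hz ?Hy ?Hx.
Qed.

(** Grafting u at a leaf is compatible with every relation at the distinguished edge. So one vertex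
    of a two-vertex graph can be reduced while the other, inside u, stays fixed. *)
Lemma inv_subst x u : HLie_invariant (fun T => f (subst x u T.1, subst x u T.2)).
Proof.
pose g T := f (subst x u T.1, subst x u T.2).
have gl := @fglift_lin k (tree H) M g; rewrite -/g.
move=> _ [s t|s t v|s t v|s t v w|c a h t v|a h t v|t v|h t v|h o ts v tsz];
  rewrite ?(linB gl) ?(linD gl) ?(linZ gl) ?fgliftU /g /=.
- by rewrite inv_flip subrr.
- by rewrite inv_shift subrr.
- by rewrite inv_antisym addNr.
- exact: inv_IHX.
- by rewrite inv_linear [_ *: _ + _]addrC addrK subrr.
- by rewrite inv_mul subrr.
- by rewrite inv_one subrr.
- by rewrite inv_antipode subrr.
have := fi (HLie_distr h (subst x u v) (etrans (size_map (subst x u) ts) tsz)).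
rewrite (linB fl) fgliftU (mext_comp _ _ fl) (mext_comp _ _ gl) -subst_graft // => <-; congr (_ - _); congr (mext _ _); apply/funext => hs /=.
by rewrite !fgliftU /g /= subst_graft ?subst_beads // size_map size_zip size_tuple tsz minnn.
Qed.

End Invariants.

Arguments graph_weight : simpl never.

(** * Weights of boundaries *)

Section Boundary.
Variables (k : fieldType) (H : hopfAlgebra k).
Hypothesis cocomm : cocommutative H.
Local Notation S := (@antipode k H).
Variable M : lmodType k.
Variable F : H -> H -> M.
Hypotheses (Fl : bilin F) (Finv : conj_invariant F).
Hypotheses (FC : forall a b, F a b = F b a) (FS : forall a b, F (S a) b = - F a b).
Hypothesis F3 : forall a b, F a b + sw (fun a1 a2 => F (S a1 * b) (S a2)) a
  + sw (fun b1 b2 => F (S b1) (S b2 * a)) b = 0.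

Local Notation gw T es := (graph_weight F ([:: T], es)).
Local Notation lf h x := (Bead h (Slot H x)).
Implicit Types (T U : tree H) (e : nat * nat) (X Y : seq nat).

Let gwi es : HLie_invariant (fun T => gw T es).
Proof. exact: graph_weight_invariant. Qed.

Lemma ev_leaf a x (K : seq (nat * H) -> M) : ev (lf a x) 1 K = K [:: (x, a)].
Proof. by rewrite /= mul1r. Qed.

Lemma gw_Br e1 e2 a b c d x y z w :
  gw (Br (lf a x) (lf b y), Br (lf c z) (lf d w)) [:: e1; e2] =
  theta_weight F e1 e2 [:: (x, a); (y, b); (z, c); (w, d)]
  - theta_weight F e1 e2 [:: (x, a); (y, b); (w, d); (z, c)]
  - (theta_weight F e1 e2 [:: (y, b); (x, a); (z, c); (w, d)]
     - theta_weight F e1 e2 [:: (y, b); (x, a); (w, d); (z, c)]).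
Proof.
have tl := theta_weight_letter_linear Fl e1 e2.
rewrite /graph_weight /pairing [_.1]/= [_.2]/= ev_Br1; last exact: letter_linear_ev.
rewrite !ev_leaf !ev_Br1; try exact: letter_linear_catl.
by rewrite !ev_leaf.
Qed.

(** Among the four words of the product of commutators, x z y w and z x w y alternate; as [F] is
    symmetric they contribute equally, hence 2. *)
Lemma gw_theta a b c d x y z w : uniq [:: x; y; z; w] ->
  gw (Br (lf a x) (lf b z), Br (lf c y) (lf d w)) [:: (x, y); (z, w)] =
  2%:R *: F (c * S a) (d * S b).
Proof.
rewrite /= !inE !negb_or => /and4P[/and3P[n12 n13 n14] /andP[n23 n24] n34 _].
have [m12 [m13 [m14 [m23 [m24 m34]]]]] : (y == x) = false /\ (z == x) = false /\
    (w == x) = false /\ (z == y) = false /\ (w == y) = false /\ (w == z) = false.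
  by split; [|split; [|split; [|split; [|split]]]]; rewrite eq_sym; apply: negbTE.
rewrite [LHS]gw_Br /= /crossing /match_sign !xpair_eqE !eqxx.
rewrite !(negbTE n12, negbTE n13, negbTE n14, negbTE n23, negbTE n24, negbTE n34).
rewrite !(m12, m13, m14, m23, m24, m34) /= !(subr0, mulr0, mul0r, addr0, add0r,
  mul1r, scale0r, sub0r, opprK, oppr0).
by rewrite [F (d * _) _]FC -scalerDl.
Qed.

(** In all four words x and y are neighbours, so the ends of the edges never alternate. *)
Lemma gw_dumbbell a b c d x y z w : uniq [:: x; y; z; w] ->
  gw (Br (lf a x) (lf b y), Br (lf c z) (lf d w)) [:: (x, y); (z, w)] = 0.
Proof.
rewrite /= !inE !negb_or => /and4P[/and3P[n12 n13 n14] /andP[n23 n24] n34 _].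
have [m12 [m13 [m14 [m23 [m24 m34]]]]] : (y == x) = false /\ (z == x) = false /\
    (w == x) = false /\ (z == y) = false /\ (w == y) = false /\ (w == z) = false.
  by split; [|split; [|split; [|split; [|split]]]]; rewrite eq_sym; apply: negbTE.
rewrite [LHS]gw_Br /= /crossing /match_sign !xpair_eqE !eqxx.
rewrite !(negbTE n12, negbTE n13, negbTE n14, negbTE n23, negbTE n24, negbTE n34).
by rewrite !(m12, m13, m14, m23, m24, m34) /= !(subr0, mulr0, mul0r, addr0, add0r,
  mul1r, scale0r, sub0r, opprK, oppr0).
Qed.

Lemma gw_theta_bead_l a h c x y z w : uniq [:: x; y; z; w] ->
  gw (Br (lf a x) (Slot H z), Bead h (Br (lf c y) (Slot H w))) [:: (x, y); (z, w)] =
  2%:R *: sw (fun h1 h2 => F (h1 * (c * S a)) h2) h.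
Proof.
move=> xu; rewrite (inv_flip (gwi _)) (inv_distr (gwi _)) sw_comp; last by linear_auto.
apply: eq_sw => h1 h2.
rewrite (inv_mul_l (gwi _)) (inv_flip (gwi _)) -(inv_one_r (gwi _)).
by rewrite gw_theta // antipode1 mulr1 mulrA.
Qed.

Lemma gw_theta_bead_r a h c x y z w : uniq [:: x; y; z; w] ->
  gw (Br (Slot H z) (lf a x), Bead h (Br (Slot H w) (lf c y))) [:: (x, y); (z, w)] =
  2%:R *: sw (fun h1 h2 => F h1 (h2 * (c * S a))) h.
Proof.
move=> xu; rewrite (inv_flip (gwi _)) (inv_distr (gwi _)) sw_comp; last by linear_auto.
have zu : uniq [:: z; w; x; y].
  by rewrite -(perm_uniq (_ : perm_eq [:: x; y; z; w] _)) //; apply/permPl/(perm_catC [:: x; y]).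
have ees : perm_eq [:: (x, y); (z, w)] [:: (z, w); (x, y)].
  by apply/permPl/(perm_catC [:: (x, y)]).
apply: eq_sw => h1 h2; rewrite (graph_weight_edges _ _ ees).
rewrite (inv_mul_r (gwi _)) (inv_flip (gwi _)) -(inv_one_l (gwi _)).
by rewrite gw_theta // antipode1 mulr1 mulrA.
Qed.

Lemma gw_bead_bead h g t u es :
  gw (Bead (S h) t, Bead (S g) u) es = gw (t, Bead (h * S g) u) es.
Proof.
rewrite (inv_antipode (gwi _)) (antipodeK cocomm) (inv_flip (gwi _)).
by rewrite (inv_mul (gwi _)) (inv_flip (gwi _)).
Qed.

(* The boundary of a graph with vertices [T], [U], edges [e1], [e2], [e3], paired with [F].
   [X] and [Y] are the slots of [T] and [U]; they are kept separate so that [T] and [U]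
   can be replaced by combinations of trees with the same slots. *)
Definition edge_term X Y T U es e : M :=
  if (e.1 \in X) && (e.2 \in Y) then gw (root_at e.1 T, root_at e.2 U) es
  else if (e.1 \in Y) && (e.2 \in X) then - gw (root_at e.2 T, root_at e.1 U) es
  else 0.

Definition bsum X Y e1 e2 e3 T U : M :=
  edge_term X Y T U [:: e2; e3] e1 + edge_term X Y T U [:: e1; e3] e2
  + edge_term X Y T U [:: e1; e2] e3.

Lemma edge_term_perm X Y T U es es' e : perm_eq es es' ->
  edge_term X Y T U es e = edge_term X Y T U es' e.
Proof. by move=> ees'; rewrite /edge_term !(graph_weight_edges _ _ ees'). Qed.

Lemma bsum_swap12 X Y e1 e2 e3 T U : bsum X Y e1 e2 e3 T U = bsum X Y e2 e1 e3 T U.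
Proof.
rewrite /bsum [edge_term _ _ _ _ _ e1 + _]addrC; congr (_ + _).
by apply: edge_term_perm; apply/permPl/(perm_catC [:: e1] [:: e2]).
Qed.

Lemma bsum_swap23 X Y e1 e2 e3 T U : bsum X Y e1 e2 e3 T U = bsum X Y e1 e3 e2 T U.
Proof.
rewrite /bsum addrAC; congr (_ + _ + _).
by apply: edge_term_perm; apply/permPl/(perm_catC [:: e2] [:: e3]).
Qed.

Lemma edge_term_rev X Y T U es x y es' e :
  edge_term X Y T U (es ++ (y, x) :: es') e = - edge_term X Y T U (es ++ (x, y) :: es') e.
Proof.
rewrite /edge_term !(graph_weight_reverse _ _ _ x y).
by case: ifP => // _; case: ifP => // _; rewrite oppr0.
Qed.

(** If the reversed edge is contracted, the sign comes from exchanging source and target in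
    [edge_term]; otherwise it comes from the weight. *)
Lemma bsum_rev1 X Y x y e2 e3 T U : (forall z, z \in X -> z \notin Y) ->
  bsum X Y (y, x) e2 e3 T U = - bsum X Y (x, y) e2 e3 T U.
Proof.
move=> XY; rewrite /bsum !opprD; congr (_ + _ + _).
- rewrite /edge_term /= ![(y \in _) && _]andbC.
  case: ifP => [/andP[xY yX]|_]; first by rewrite (negbTE (XY _ yX)) andbF opprK.
  by case: ifP => _; rewrite ?opprK ?oppr0.
- exact: (edge_term_rev _ _ _ _ [::]).
exact: (edge_term_rev _ _ _ _ [::]).
Qed.

Lemma bsumC X Y e1 e2 e3 T U : (forall z, z \in X -> z \notin Y) ->
  bsum X Y e1 e2 e3 T U = - bsum Y X e1 e2 e3 U T.
Proof.
move=> XY; rewrite /bsum !opprD.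
have E es e : edge_term X Y T U es e = - edge_term Y X U T es e.
  rewrite /edge_term; case: ifP => [/andP[xX yY]|_].
    by rewrite (negbTE (XY _ xX)) /= opprK (inv_flip (gwi _)).
  by case: ifP => _; rewrite ?oppr0 // (inv_flip (gwi _)).
by rewrite !E.
Qed.

(* Rooting T at a slot x and gluing u there is the same, modulo the relations
   of HLie, as substituting u for x in T, and the latter makes sense for every T. *)
Definition bsum_subst X Y e1 e2 e3 U T : M :=
  let s es e :=
    if (e.1 \in X) && (e.2 \in Y) then
      gw (subst e.1 (root_at e.2 U) T.1, subst e.1 (root_at e.2 U) T.2) es
    else if (e.1 \in Y) && (e.2 \in X) then
      - gw (subst e.2 (root_at e.1 U) T.1, subst e.2 (root_at e.1 U) T.2) es
    else 0 in
  s [:: e2; e3] e1 + s [:: e1; e3] e2 + s [:: e1; e2] e3.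

Lemma bsum_substE X Y e1 e2 e3 T U : uniq (slots T) -> perm_eq X (slots T) ->
  bsum X Y e1 e2 e3 T U = bsum_subst X Y e1 e2 e3 U T.
Proof.
move=> Tu XT; rewrite /bsum /bsum_subst /edge_term.
have E x u es : x \in X ->
    gw (root_at x T, u) es = gw (subst x u T.1, subst x u T.2) es.
  by move=> xX; rewrite (inv_root_at (gwi es)) // -(perm_mem XT).
congr (_ + _ + _);
  by case: ifP => [/andP[xX _]|_]; [|case: ifP => // /andP[_ xX]]; rewrite E.
Qed.

Lemma HLie_invariant_lin (f g : tree H -> M) c : HLie_invariant f ->
  HLie_invariant g -> HLie_invariant (fun T => c *: f T + g T).
Proof.
move=> fi gi r rr.
have -> : fglift (fun T => c *: f T + g T) r = c *: fglift f r + fglift g r.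
  rewrite !fgliftE scaler_sumr -big_split; apply: eq_bigr => T _.
  by rewrite /= scalerDr !scalerA mulrC.
by rewrite fi // gi // scaler0 addr0.
Qed.

Lemma bsum_subst_invariant X Y e1 e2 e3 U :
  HLie_invariant (bsum_subst X Y e1 e2 e3 U).
Proof.
have Z : HLie_invariant (fun _ : tree H => 0 : M).
  by move=> r _; rewrite fgliftE big1 // => T _; rewrite scaler0.
have D (f g : tree H -> M) : HLie_invariant f -> HLie_invariant g ->
    HLie_invariant (fun T => f T + g T).
  move=> fi gi; have := HLie_invariant_lin 1 fi gi.
  by under eq_fun => T do rewrite scale1r.
have N (f : tree H -> M) : HLie_invariant f -> HLie_invariant (fun T => - f T).
  move=> fi; have := HLie_invariant_lin (-1) fi Z.
  by under eq_fun => T do rewrite scaleN1r addr0.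
rewrite /bsum_subst; apply: (D); first apply: (D).
- case: ((e1.1 \in X) && (e1.2 \in Y)); first exact: (inv_subst (gwi _)).
  by case: ((e1.1 \in Y) && (e1.2 \in X)); [apply/N/(inv_subst (gwi _))|].
- case: ((e2.1 \in X) && (e2.2 \in Y)); first exact: (inv_subst (gwi _)).
  by case: ((e2.1 \in Y) && (e2.2 \in X)); [apply/N/(inv_subst (gwi _))|].
case: ((e3.1 \in X) && (e3.2 \in Y)); first exact: (inv_subst (gwi _)).
by case: ((e3.1 \in Y) && (e3.2 \in X)); [apply/N/(inv_subst (gwi _))|].
Qed.

(** The boundary sum is an invariant function of T, so T can be taken to be a tripod with beads on
    two leaves. *)
Lemma bsum_reduce3 X Y x y z e1 e2 e3 T U :
  uniq (slots T) -> perm_eq X (slots T) -> perm_eq X [:: x; y; z] ->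
  (forall a b, bsum X Y e1 e2 e3 (Br (lf a x) (lf b y), Slot H z) U = 0) ->
  bsum X Y e1 e2 e3 T U = 0.
Proof.
move=> Tu XT Xxyz H0; rewrite bsum_substE //; apply/eqP.
apply: (inv_normal3 (@bsum_subst_invariant X Y e1 e2 e3 U) (@pred0_submod_closed k M) Tu
  (x := x) (y := y) (z := z)) => [|a b].
  by rewrite perm_sym in Xxyz; apply: perm_trans Xxyz XT.
rewrite inE -bsum_substE ?H0 //.
by rewrite -(perm_uniq Xxyz) (perm_uniq XT).
Qed.

Lemma bsum_reduce2 X Y x y e1 e2 e3 T U :
  uniq (slots T) -> perm_eq X (slots T) -> perm_eq X [:: x; y] ->
  (forall a, bsum X Y e1 e2 e3 (lf a x, Slot H y) U = 0) ->
  bsum X Y e1 e2 e3 T U = 0.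
Proof.
move=> Tu XT Xxy H0; rewrite bsum_substE //; apply/eqP.
apply: (inv_normal2 (@bsum_subst_invariant X Y e1 e2 e3 U) (@pred0_submod_closed k M) Tu
  (x := x) (y := y)) => [|a].
  by rewrite perm_sym in Xxy; apply: perm_trans Xxy XT.
rewrite inE -bsum_substE ?H0 //.
by rewrite -(perm_uniq Xxy) (perm_uniq XT).
Qed.

Lemma root_at_corolla1 a b x y z : root_at x (Br (lf a x) (lf b y), Slot H z) =
  Bead (S a) (Br (lf b y) (Slot H z)).
Proof. by rewrite /root_at /= !inE eqxx. Qed.

Lemma root_at_corolla2 a b x y z : x != y ->
  root_at y (Br (lf a x) (lf b y), Slot H z) = Bead (S b) (Br (Slot H z) (lf a x)).
Proof. by move=> xy; rewrite /root_at /= !inE eqxx orbT eq_sym (negbTE xy). Qed.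

Lemma root_at_corolla3 a b x y z : x != z -> y != z ->
  root_at z (Br (lf a x) (lf b y), Slot H z) = Br (lf a x) (lf b y).
Proof.
move=> xz yz; rewrite /root_at /= !inE eq_sym (negbTE xz).
by rewrite eq_sym (negbTE yz).
Qed.

Lemma uniq2 (x y : nat) : uniq [:: x; y] -> x != y.
Proof. by rewrite /= inE andbT. Qed.

(** Let A = c S(a) and B = d S(b) be the holonomies of the first two edges. Contracting edges 1, 2,
    3 gives twice the second, third and first term of relation (3) at A, B. *)
Lemma bsum_theta a b c d x1 x2 x3 y1 y2 y3 : uniq [:: x1; y1; x2; y2; x3; y3] ->
  bsum [:: x1; x2; x3] [:: y1; y2; y3] (x1, y1) (x2, y2) (x3, y3)
    (Br (lf a x1) (lf b x2), Slot H x3) (Br (lf c y1) (lf d y2), Slot H y3) = 0.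
Proof.
move=> Eu; have mu m : uniq (mask m [:: x1; y1; x2; y2; x3; y3]) by apply: mask_uniq.
have X12 := uniq2 (mu [:: true; false; true]).
have X13 := uniq2 (mu [:: true; false; false; false; true]).
have X23 := uniq2 (mu [:: false; false; true; false; true]).
have Y12 := uniq2 (mu [:: false; true; false; true]).
have Y13 := uniq2 (mu [:: false; true; false; false; false; true]).
have Y23 := uniq2 (mu [:: false; false; false; true; false; true]).
rewrite /bsum /edge_term /= !inE !eqxx ?orbT /=.
rewrite !root_at_corolla1 !root_at_corolla2 // !root_at_corolla3 //.
rewrite !gw_bead_bead.
rewrite gw_theta_bead_l; last exact: (mu [:: false; false; true; true; true; true]).
rewrite gw_theta_bead_r; last exact: (mu [:: true; true; false; false; true; true]).
rewrite gw_theta; last exact: (mu [:: true; true; true; true]).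
have SE p q : p * S q = S (q * S p) by rewrite antipodeM antipodeK.
rewrite (SE a) (SE b) !(antipode_Delta cocomm); try by linear_auto.
by rewrite -!scalerDr addrC addrA F3 scaler0.
Qed.

Lemma edge_term_inside X Y T U es e : (forall z, z \in X -> z \notin Y) ->
  (e.1 \in X) && (e.2 \in X) || (e.1 \in Y) && (e.2 \in Y) ->
  edge_term X Y T U es e = 0.
Proof.
move=> XY; rewrite /edge_term => /orP[] /andP[e1 e2].
  by rewrite (negbTE (XY _ e1)) (negbTE (XY _ e2)) andbF.
have [e1X|_] := boolP (e.1 \in X); first by rewrite (negbTE (XY _ e1X)) in e1.
have [e2X|_] := boolP (e.2 \in X); first by rewrite (negbTE (XY _ e2X)) in e2.
by rewrite andbF.
Qed.

Lemma bsum_dumbbell a b c d x1 x2 x3 y1 y2 y3 :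
  let X := [:: x1; x2; x3] in let Y := [:: y1; y2; y3] in
  (forall z, z \in X -> z \notin Y) -> uniq X -> uniq Y ->
  bsum X Y (x1, x2) (y1, y2) (x3, y3)
    (Br (lf a x1) (lf b x2), Slot H x3) (Br (lf c y1) (lf d y2), Slot H y3) = 0.
Proof.
move=> X Y XY Xu Yu; rewrite /bsum.
rewrite edge_term_inside //; last by rewrite /= !inE !eqxx ?orbT.
rewrite edge_term_inside //; last by rewrite /= !inE !eqxx ?orbT.
rewrite /edge_term /= !inE !eqxx ?orbT /= !add0r.
have X13 := uniq2 (mask_uniq Xu [:: true; false; true]).
have X23 := uniq2 (mask_uniq Xu [:: false; true; true]).
have Y13 := uniq2 (mask_uniq Yu [:: true; false; true]).
have Y23 := uniq2 (mask_uniq Yu [:: false; true; true]).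
rewrite !root_at_corolla3 // gw_dumbbell //.
have XYu : uniq (X ++ Y).
  rewrite cat_uniq Xu Yu andbT andTb; apply/hasPn => z zY; apply/negP => zX.
  by have := XY _ zX; rewrite zY.
exact: (mask_uniq XYu [:: true; true; false; true; true]).
Qed.

Lemma rename_subst f x y h t : f y = x ->
  {in term_slots t, forall z, z != x -> f z = z} ->
  rename_term f (subst x (Bead h (Slot H y)) t) = bead_at h x t.
Proof.
move=> fyx; elim: t => [z|g t IHt|s IHs t IHt] /= ft.
- by case: (eqVneq z x) => [->|zx] /=; rewrite ?fyx // ft // inE.
- by rewrite IHt.
by rewrite IHs ?IHt // => z zt; apply: ft; rewrite mem_cat zt ?orbT.
Qed.

(** Graphs are renamed along maps injective on all natural numbers; a transposition renames one slot
    in this way. *)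
Definition transpose (x y z : nat) : nat :=
  if z == x then y else if z == y then x else z.

Lemma transpose_inj x y : injective (transpose x y).
Proof.
suff K : involutive (transpose x y) by apply: can_inj K.
move=> z; rewrite /transpose.
case: (eqVneq z x) => [->|zx]; first by rewrite eqxx; case: eqP.
case: (eqVneq z y) => [->|zy]; first by rewrite eqxx.
by rewrite (negbTE zx) (negbTE zy).
Qed.

(** Contracting an edge at a bivalent vertex grafts a bead with the slot y at x; renaming y to x
    gives back T with a bead at x. *)
Lemma gw_subst_rename x y h T e p : uniq (slots T) -> x \in slots T ->
  y \notin slots T ->
  [/\ e.1 \in slots T, e.2 \in slots T & p \in slots T] ->
  [/\ e.1 != x, e.2 != x & p != x] ->
  gw (root_at x T, Bead h (Slot H y)) [:: e; (p, y)] =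
  graph_weight F (graph_bead_at h x ([:: T], [:: e; (p, x)])).
Proof.
move=> Tu xT yT [e1 e2 pT] [n1 n2 n3]; rewrite (inv_root_at (gwi _)) //.
have fix_ z : z \in slots T -> z != x -> transpose y x z = z.
  move=> zT zx; rewrite /transpose (negbTE zx).
  by case: eqP => // zy; rewrite -zy zT in yT.
have fy : transpose y x y = x by rewrite /transpose eqxx.
rewrite -(graph_weight_rename _ _ (@transpose_inj y x)) /rename /=.
rewrite (fix_ e.1) // (fix_ e.2) // (fix_ p) // fy !rename_subst // => z zT; apply: fix_;
  rewrite mem_cat zT ?orbT //.
Qed.

Lemma bsum_bivalent a x1 x2 x3 x4 y1 y2 T :
  let X := [:: x1; x2; x3; x4] in let Y := [:: y1; y2] in
  (forall z, z \in X -> z \notin Y) -> uniq (slots T) -> perm_eq X (slots T) -> y1 != y2 ->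
  bsum X Y (x1, x2) (x3, y1) (x4, y2) T (lf a y1, Slot H y2) = 0.
Proof.
move=> X Y XY Tu XT Y12; rewrite /bsum.
rewrite edge_term_inside //; last by rewrite /= !inE !eqxx ?orbT.
rewrite /edge_term /= !inE !eqxx ?orbT /= !add0r.
have Xu : uniq X by rewrite (perm_uniq XT).
have -> : root_at y1 (lf a y1, Slot H y2) = Bead (S a) (Slot H y2).
  by rewrite /root_at /= !inE eqxx.
have -> : root_at y2 (lf a y1, Slot H y2) = Bead a (Slot H y1).
  by rewrite /root_at /= !inE eq_sym (negbTE Y12).
have inT z : z \in X -> z \in slots T by rewrite (perm_mem XT).
have notT z : z \in Y -> z \notin slots T.
  by rewrite -(perm_mem XT); apply: contraL => /XY.
have N13 := uniq2 (mask_uniq Xu [:: true; false; true]).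
have N14 := uniq2 (mask_uniq Xu [:: true; false; false; true]).
have N23 := uniq2 (mask_uniq Xu [:: false; true; true]).
have N24 := uniq2 (mask_uniq Xu [:: false; true; false; true]).
have N34 := uniq2 (mask_uniq Xu [:: false; false; true; true]).
have [T1 T2 T3 T4] : [/\ x1 \in slots T, x2 \in slots T, x3 \in slots T & x4 \in slots T].
  by split; apply: inT; rewrite !inE eqxx ?orbT.
have [U1 U2] : y1 \notin slots T /\ y2 \notin slots T.
  by split; apply: notT; rewrite !inE eqxx ?orbT.
rewrite gw_subst_rename //; last by split=> //=; rewrite eq_sym.
rewrite gw_subst_rename //.
have sw12 e e' : perm_eq [:: e; e'] [:: e'; e] by apply/permPl/(perm_catC [:: e]).
rewrite /graph_bead_at /= !(graph_weight_edges _ _ (sw12 (x1, x2) _)).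
have := graph_weight_slide cocomm F a (x1, x2) _ Tu T4 T3.
rewrite eq_sym => /(_ N34); rewrite /graph_bead_at /= => <-.
(* The two contractions direct the edge between x3 and x4 oppositely, hence the opposite signs. *)
by rewrite (graph_weight_reverse _ _ [::]) addNr.
Qed.

Arguments edge_term : simpl never.

Lemma eq_bsum X X' Y Y' e1 e2 e3 T U : X =i X' -> Y =i Y' ->
  bsum X Y e1 e2 e3 T U = bsum X' Y' e1 e2 e3 T U.
Proof. by move=> XX' YY'; rewrite /bsum /edge_term !XX' !YY'. Qed.

(** * Case analysis on two-vertex graphs of rank two *)

Definition two_vertices X Y e1 e2 e3 T U :=
  [/\ uniq (X ++ Y), perm_eq X (slots T), perm_eq Y (slots U),
      perm_eq [:: e1.1; e1.2; e2.1; e2.2; e3.1; e3.2] (X ++ Y)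
    & (1 < size X)%N && (1 < size Y)%N].

Section Cases.
Variables (X Y : seq nat) (e1 e2 e3 : nat * nat) (T U : tree H).
Hypothesis XYT : two_vertices X Y e1 e2 e3 T U.

Lemma two_vertices_disjoint z : z \in X -> z \notin Y.
Proof.
case: XYT => XYu _ _ _ _ zX; move: XYu; rewrite cat_uniq => /and3P[_ XY _].
by apply: contra XY => zY; apply/hasP; exists z.
Qed.

Lemma two_vertices_disjointC z : z \in Y -> z \notin X.
Proof. by apply: contraL => /two_vertices_disjoint. Qed.

Lemma two_verticesC : two_vertices Y X e1 e2 e3 U T.
Proof.
case: XYT => XYu XT YU E sz; have XYC : perm_eq (Y ++ X) (X ++ Y) by rewrite perm_catC.
split=> //; [by rewrite (perm_uniq XYC)| |by rewrite andbC].
by rewrite perm_sym in XYC; apply: perm_trans E XYC.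
Qed.

Lemma two_vertices_perm f1 f2 f3 :
  perm_eq [:: f1.1; f1.2; f2.1; f2.2; f3.1; f3.2] [:: e1.1; e1.2; e2.1; e2.2; e3.1; e3.2] ->
  two_vertices X Y f1 f2 f3 T U.
Proof. by case: XYT => XYu XT YU E sz ef; split=> //; apply: perm_trans ef E. Qed.

Lemma two_vertices_swap12 : two_vertices X Y e2 e1 e3 T U.
Proof.
apply: two_vertices_perm.
by apply/permPl/(perm_catCA [:: e2.1; e2.2] [:: e1.1; e1.2]).
Qed.

Lemma two_vertices_swap23 : two_vertices X Y e1 e3 e2 T U.
Proof.
apply: two_vertices_perm; rewrite !perm_cons.
by apply/permPl/(perm_catC [:: e3.1; e3.2]).
Qed.

Lemma two_vertices_rev1 : two_vertices X Y (e1.2, e1.1) e2 e3 T U.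
Proof.
apply: two_vertices_perm.
by apply/permPl/(perm_catCA [:: e1.2] [:: e1.1]).
Qed.

Let ends := [:: e1.1; e1.2; e2.1; e2.2; e3.1; e3.2].

Lemma two_vertices_ends z : z \in ends -> (z \in Y) = (z \notin X).
Proof.
case: XYT => XYu _ _ E _; rewrite (perm_mem E) mem_cat => zXY.
have [zX|zX] := boolP (z \in X); first exact/negbTE/two_vertices_disjoint.
by rewrite (negbTE zX) in zXY.
Qed.

Lemma two_vertices_filter : perm_eq [seq z <- ends | z \in X] X.
Proof.
case: XYT => XYu _ _ E _; apply: perm_trans (perm_filter _ E) _.
rewrite filter_cat (_ : [seq z <- Y | z \in X] = [::]) ?cats0.
  by rewrite (eq_in_filter (a2 := predT)) ?filter_predT.
apply/eqP; rewrite -(negbK (_ == _)) -has_filter; apply/hasPn => z zY.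
by apply/negP => /two_vertices_disjoint; rewrite zY.
Qed.

Lemma two_vertices_filterC : perm_eq [seq z <- ends | z \notin X] Y.
Proof.
case: XYT => XYu _ _ E _; apply: perm_trans (perm_filter _ E) _.
rewrite filter_cat (_ : [seq z <- X | z \notin X] = [::]) /=.
  rewrite (eq_in_filter (a2 := predT)) ?filter_predT // => z zY.
  by apply/negP => /two_vertices_disjoint; rewrite zY.
apply/eqP; rewrite -(negbK (_ == _)) -has_filter; apply/hasPn => z zX.
by rewrite zX.
Qed.

Lemma two_vertices_uniq : uniq (slots T) /\ uniq (slots U).
Proof.
case: XYT => XYu XT YU _ _; move: XYu; rewrite cat_uniq => /and3P[Xu _ Yu].
by rewrite -(perm_uniq XT) -(perm_uniq YU).
Qed.

Lemma bsum_case_theta :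
  [/\ e1.1 \in X, e2.1 \in X & e3.1 \in X] ->
  [/\ e1.2 \notin X, e2.2 \notin X & e3.2 \notin X] ->
  bsum X Y e1 e2 e3 T U = 0.
Proof.
move=> [x1 x2 x3] [y1 y2 y3].
have := two_vertices_filter; rewrite /ends /= x1 x2 x3 (negbTE y1) (negbTE y2) (negbTE y3) => X3.
have := two_vertices_filterC; rewrite /ends /= x1 x2 x3 y1 y2 y3 /= => Y3.
have [Tu Uu] := two_vertices_uniq; have [XYu XT YU E _] := XYT.
have [dis disC] := (two_vertices_disjoint, two_vertices_disjointC).
apply: (bsum_reduce3 Tu XT (x := e1.1) (y := e2.1) (z := e3.1)) => [|a b];
  first by rewrite perm_sym; exact: X3.
rewrite bsumC //; apply/eqP; rewrite oppr_eq0; apply/eqP.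
apply: (bsum_reduce3 Uu YU (x := e1.2) (y := e2.2) (z := e3.2)) => [|c d];
  first by rewrite perm_sym; exact: Y3.
rewrite bsumC //; apply/eqP; rewrite oppr_eq0; apply/eqP.
rewrite -(eq_bsum _ _ _ _ _ (perm_mem X3) (perm_mem Y3)).
move: E; rewrite perm_sym => /perm_uniq; rewrite XYu => /esym.
case: (e1) (e2) (e3) => [? ?] [? ?] [? ?]; exact: bsum_theta.
Qed.

Lemma bsum_case_dumbbell :
  [/\ e1.1 \in X, e1.2 \in X & e3.1 \in X] ->
  [/\ e2.1 \notin X, e2.2 \notin X & e3.2 \notin X] ->
  bsum X Y e1 e2 e3 T U = 0.
Proof.
move=> [x1 x2 x3] [y1 y2 y3].
have := two_vertices_filter; rewrite /ends /= x1 x2 x3 (negbTE y1) (negbTE y2) (negbTE y3) => X3.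
have := two_vertices_filterC; rewrite /ends /= x1 x2 x3 y1 y2 y3 /= => Y3.
have [Tu Uu] := two_vertices_uniq; have [XYu XT YU E _] := XYT.
have [dis disC] := (two_vertices_disjoint, two_vertices_disjointC).
apply: (bsum_reduce3 Tu XT (x := e1.1) (y := e1.2) (z := e3.1)) => [|a b];
  first by rewrite perm_sym; exact: X3.
rewrite bsumC //; apply/eqP; rewrite oppr_eq0; apply/eqP.
apply: (bsum_reduce3 Uu YU (x := e2.1) (y := e2.2) (z := e3.2)) => [|c d];
  first by rewrite perm_sym; exact: Y3.
rewrite bsumC //; apply/eqP; rewrite oppr_eq0; apply/eqP.
rewrite -(eq_bsum _ _ _ _ _ (perm_mem X3) (perm_mem Y3)).
have dis' z : z \in [:: e1.1; e1.2; e3.1] -> z \notin [:: e2.1; e2.2; e3.2].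
  by rewrite (perm_mem X3) (perm_mem Y3); apply: dis.
have X3u : uniq [:: e1.1; e1.2; e3.1] by rewrite (perm_uniq X3) (perm_uniq XT).
have Y3u : uniq [:: e2.1; e2.2; e3.2] by rewrite (perm_uniq Y3) (perm_uniq YU).
case: (e1) (e2) (e3) dis' X3u Y3u => [? ?] [? ?] [? ?]; exact: bsum_dumbbell.
Qed.

Lemma bsum_case_bivalent :
  [/\ e1.1 \in X, e1.2 \in X, e2.1 \in X & e3.1 \in X] ->
  e2.2 \notin X -> e3.2 \notin X -> bsum X Y e1 e2 e3 T U = 0.
Proof.
move=> [x1 x2 x3 x4] y1 y2.
have := two_vertices_filter; rewrite /ends /= x1 x2 x3 x4 (negbTE y1) (negbTE y2) => X4.
have := two_vertices_filterC; rewrite /ends /= x1 x2 x3 x4 y1 y2 /= => Y2.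
have [Tu Uu] := two_vertices_uniq; have [XYu XT YU E _] := XYT.
have [dis disC] := (two_vertices_disjoint, two_vertices_disjointC).
rewrite bsumC //; apply/eqP; rewrite oppr_eq0; apply/eqP.
apply: (bsum_reduce2 Uu YU (x := e2.2) (y := e3.2)) => [|a]; first by rewrite perm_sym; exact: Y2.
rewrite bsumC //; apply/eqP; rewrite oppr_eq0; apply/eqP.
rewrite -(eq_bsum _ _ _ _ _ (perm_mem X4) (perm_mem Y2)).
have dis' z : z \in [:: e1.1; e1.2; e2.1; e3.1] -> z \notin [:: e2.2; e3.2].
  by rewrite (perm_mem X4) (perm_mem Y2); apply: dis.
have XT' := perm_trans X4 XT.
have Y12 : e2.2 != e3.2 by apply: uniq2; rewrite (perm_uniq Y2) (perm_uniq YU).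
case: (e1) (e2) (e3) dis' XT' Y12 => [? ?] [? ?] [? ?] dis' XT' Y12.
exact: (bsum_bivalent).
Qed.

End Cases.

Section Reversals.
Variables (X Y : seq nat) (e1 e2 e3 : nat * nat) (T U : tree H).
Hypothesis XYT : two_vertices X Y e1 e2 e3 T U.

Lemma bsum_rev1_eq0 :
  bsum X Y (e1.2, e1.1) e2 e3 T U = 0 -> bsum X Y e1 e2 e3 T U = 0.
Proof.
rewrite bsum_rev1; last exact: two_vertices_disjoint XYT.
by rewrite -surjective_pairing => /eqP; rewrite oppr_eq0 => /eqP.
Qed.

Lemma bsum_rev2_eq0 :
  bsum X Y e1 (e2.2, e2.1) e3 T U = 0 -> bsum X Y e1 e2 e3 T U = 0.
Proof.
rewrite bsum_swap12 bsum_rev1; last exact: two_vertices_disjoint XYT.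
by rewrite -surjective_pairing bsum_swap12 => /eqP; rewrite oppr_eq0 => /eqP.
Qed.

Lemma bsum_rev3_eq0 :
  bsum X Y e1 e2 (e3.2, e3.1) T U = 0 -> bsum X Y e1 e2 e3 T U = 0.
Proof.
rewrite bsum_swap23 bsum_swap12 bsum_rev1; last exact: two_vertices_disjoint XYT.
rewrite -surjective_pairing bsum_swap12 bsum_swap23 => /eqP.
by rewrite oppr_eq0 => /eqP.
Qed.

Lemma two_vertices_rev2 : two_vertices X Y e1 (e2.2, e2.1) e3 T U.
Proof.
by apply: two_vertices_swap12; apply: two_vertices_rev1; apply: two_vertices_swap12.
Qed.

Lemma two_vertices_rev3 : two_vertices X Y e1 e2 (e3.2, e3.1) T U.
Proof.
apply: two_vertices_swap23; apply: two_vertices_swap12; apply: two_vertices_rev1.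
by apply: two_vertices_swap12; apply: two_vertices_swap23.
Qed.

End Reversals.

Lemma bsum_case_bivalentC X Y e1 e2 e3 T U : two_vertices X Y e1 e2 e3 T U ->
  [/\ e1.1 \notin X, e1.2 \notin X, e2.2 \notin X & e3.2 \notin X] ->
  e2.1 \in X -> e3.1 \in X -> bsum X Y e1 e2 e3 T U = 0.
Proof.
move=> XYT [x1 x2 x3 x4] y1 y2.
rewrite bsumC; last exact: two_vertices_disjoint XYT.
apply/eqP; rewrite oppr_eq0; apply/eqP.
have YXT := two_verticesC XYT; have YXT2 := two_vertices_rev2 YXT.
apply: (bsum_rev2_eq0 YXT); apply: (bsum_rev3_eq0 YXT2).
have inY := two_vertices_ends XYT; have disj := two_vertices_disjoint XYT.
apply: (bsum_case_bivalent (two_vertices_rev3 YXT2)) => /=; try exact: disj.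
by split; rewrite inY // !inE eqxx ?orbT.
Qed.

(** With the third edge across, these are a theta graph, a loop at either end of a double edge, and
    a dumbbell. *)
Lemma bsum_case X Y e1 e2 e3 T U : two_vertices X Y e1 e2 e3 T U ->
  (e3.1 \in X) && (e3.2 \notin X) ->
  [|| [&& e1.1 \in X, e1.2 \notin X, e2.1 \in X & e2.2 \notin X],
      [&& e1.1 \in X, e1.2 \in X, e2.1 \in X & e2.2 \notin X],
      [&& e1.1 \notin X, e1.2 \notin X, e2.1 \in X & e2.2 \notin X]
    | [&& e1.1 \in X, e1.2 \in X, e2.1 \notin X & e2.2 \notin X]] ->
  bsum X Y e1 e2 e3 T U = 0.
Proof.
move=> XYT /andP[x3 y3] /or4P[] /and4P[x1 y1 x2 y2].
- exact: bsum_case_theta XYT _ _.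
- exact: bsum_case_bivalent XYT _ _ _.
- exact: bsum_case_bivalentC XYT _ _ _.
exact: bsum_case_dumbbell XYT _ _.
Qed.

Lemma bsum_eq0_directed X Y e1 e2 e3 T U : two_vertices X Y e1 e2 e3 T U ->
  [/\ e1.2 \in X -> e1.1 \in X, e2.2 \in X -> e2.1 \in X & e3.2 \in X -> e3.1 \in X] ->
  [|| (e1.1 \in X) != (e1.2 \in X), (e2.1 \in X) != (e2.2 \in X)
    | (e3.1 \in X) != (e3.2 \in X)] -> bsum X Y e1 e2 e3 T U = 0.
Proof.
move=> XYT; have [_ _ _ _] := XYT.
(* Valences of at least two exclude two loops at the same vertex; reordering the edges brings every
   other distribution of the ends to [bsum_case]. *)
have /perm_size := two_vertices_filter XYT; have /perm_size := two_vertices_filterC XYT.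
move=> <- <-.
have XYT' := two_vertices_swap12 XYT.
have XYT23 := two_vertices_swap23 XYT.
have XYT231 := two_vertices_swap12 XYT23.
have XYT3 := two_vertices_swap23 XYT'.
have XYT321 := two_vertices_swap12 XYT3.
case x1: (e1.1 \in X); case y1: (e1.2 \in X); case x2: (e2.1 \in X);
case y2: (e2.2 \in X); case x3: (e3.1 \in X); case y3: (e3.2 \in X);
  rewrite /= ?x1 ?y1 ?x2 ?y2 ?x3 ?y3 //= => _ [] // i1 i2 i3;
  do ?[by have := i1 isT|by have := i2 isT|by have := i3 isT] => _.
all: first
  [ by apply: (bsum_case XYT); rewrite ?x1 ?x2 ?x3 ?y1 ?y2 ?y3
  | by rewrite bsum_swap12; apply: (bsum_case XYT'); rewrite ?x1 ?x2 ?x3 ?y1 ?y2 ?y3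
  | by rewrite bsum_swap23; apply: (bsum_case XYT23); rewrite ?x1 ?x2 ?x3 ?y1 ?y2 ?y3
  | by rewrite bsum_swap23 bsum_swap12; apply: (bsum_case XYT231);
       rewrite ?x1 ?x2 ?x3 ?y1 ?y2 ?y3
  | by rewrite bsum_swap12 bsum_swap23; apply: (bsum_case XYT3);
       rewrite ?x1 ?x2 ?x3 ?y1 ?y2 ?y3
  | by rewrite bsum_swap12 bsum_swap23 bsum_swap12; apply: (bsum_case XYT321);
       rewrite ?x1 ?x2 ?x3 ?y1 ?y2 ?y3 ].
Qed.

(** Reversing an edge only changes the sign, so crossing edges may be directed from X to Y. *)
Lemma bsum_eq0 X Y e1 e2 e3 T U : two_vertices X Y e1 e2 e3 T U ->
  [|| (e1.1 \in X) != (e1.2 \in X), (e2.1 \in X) != (e2.2 \in X)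
    | (e3.1 \in X) != (e3.2 \in X)] -> bsum X Y e1 e2 e3 T U = 0.
Proof.
wlog d1 : e1 / e1.2 \in X -> e1.1 \in X.
  move=> IH XYT cr; have [x1|x1] := boolP (e1.1 \in X); first exact: IH.
  apply: (bsum_rev1_eq0 XYT); apply: (IH _ _ (two_vertices_rev1 XYT)) => /=.
    by rewrite (negbTE x1).
  by rewrite eq_sym.
wlog d2 : e2 / e2.2 \in X -> e2.1 \in X.
  move=> IH XYT cr; have [x2|x2] := boolP (e2.1 \in X); first exact: IH.
  apply: (bsum_rev2_eq0 XYT); apply: (IH _ _ (two_vertices_rev2 XYT)) => /=.
    by rewrite (negbTE x2).
  by rewrite [(e2.2 \in X) == _]eq_sym.
wlog d3 : e3 / e3.2 \in X -> e3.1 \in X.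
  move=> IH XYT cr; have [x3|x3] := boolP (e3.1 \in X); first exact: IH.
  apply: (bsum_rev3_eq0 XYT); apply: (IH _ _ (two_vertices_rev3 XYT)) => /=.
    by rewrite (negbTE x3).
  by rewrite [(e3.2 \in X) == _]eq_sym.
by move=> XYT; apply: bsum_eq0_directed.
Qed.

(** Without an edge across, the first vertex alone is closed under adjacency and cannot reach the
    second. *)
Lemma connected_crossing T U es : connected ([:: T; U], es) ->
  {in es, forall e, (e.1 \in slots T ++ slots U) && (e.2 \in slots T ++ slots U)} ->
  uniq (slots T ++ slots U) ->
  has (fun e => (e.1 \in slots T) != (e.2 \in slots T)) es.
Proof.
move=> /andP[_ /forallP/(_ ord0)/forallP/(_ (Ordinal (isT : 1 < 2)%N)) con] ends TUu.
apply: contraLR con => /hasPn nocross.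
have cl : closed (@adjacent k H ([:: T; U], es)) (pred1 ord0).
  have dis z : z \in slots T -> z \notin slots U.
    move: TUu; rewrite cat_uniq => /and3P[_ TU _] zT.
    by apply: contra TU => zU; apply/hasP; exists z.
  move=> i j /hasP[e ees]; have := nocross e ees; rewrite negbK => /eqP eT.
  rewrite !inE; case: i => -[|[|//]] i; case: j => -[|[|//]] j //=;
    rewrite !(tnth_nth T) /=.
  - case/orP=> /andP[e1 e2].
      by rewrite e1 in eT; have := dis _ (esym eT); rewrite e2.
    by rewrite e2 in eT; have := dis _ eT; rewrite e1.
  case/orP=> /andP[e1 e2].
    by rewrite e2 in eT; have := dis _ eT; rewrite e1.
  by rewrite e1 in eT; have := dis _ (esym eT); rewrite e2.
by apply/negP => /(closed_connect cl); rewrite !inE.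
Qed.

Lemma graph_weight_boundary G : is_graph 2 2 G ->
  fglift (graph_weight F) (boundary << G >>) = 0.
Proof.
case: G => -[|T [|U [|V vs]]] es; rewrite /is_graph /= ?andbF //.
case/and5P=> uG pG /and3P[sT sU _] cG /andP[/eqP[es3] _].
case: es es3 pG cG uG => [|e1 [|e2 [|e3 [|]]]] // _.
rewrite /edge_ends /half_edges /= cats0 => pG cG uG.
set X := slots T; set Y := slots U.
have XYT : two_vertices X Y e1 e2 e3 T U by split=> //; rewrite sT sU.
have inXY e : e \in [:: e1; e2; e3] -> (e.1 \in X ++ Y) && (e.2 \in X ++ Y).
  by rewrite -!(perm_mem pG) !inE => /or3P[]/eqP->; rewrite !eqxx ?orbT.
have cross := connected_crossing cG inXY uG.
rewrite /= orbF in cross.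
rewrite -(bsum_eq0 XYT cross).
pose g e : M := edge_term X Y T U (rem e [:: e1; e2; e3]) e.
rewrite /boundary fgliftU (lin_sum (fglift_lin _)).
transitivity (\sum_(e <- [:: e1; e2; e3]) g e).
  rewrite [LHS]big_mkcond; apply: eq_big_seq => e eE.
  rewrite (linZ (fglift_lin _)) fgliftU /g.
  have /andP[] := inXY e eE; rewrite !(mem_cat _ X Y) => e1XY e2XY.
  have dis := two_vertices_disjoint XYT.
  have disC := two_vertices_disjointC XYT.
  have vE z : z \in X -> vertex_of ([:: T; U], [:: e1; e2; e3]) z = 0%N.
    by move=> zX; rewrite /vertex_of /= -/X zX.
  have vE' z : z \in Y -> vertex_of ([:: T; U], [:: e1; e2; e3]) z = 1%N.
    by move=> zY; rewrite /vertex_of /= -/X -/Y (negbTE (disC _ zY)) zY.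
  case/orP: e1XY => x1; case/orP: e2XY => x2.
  - by rewrite !vE //= edge_term_inside // x1 x2.
  (* From vertex 0 to vertex 1 the exponent of the sign is 0 + 1 + 1; in the opposite direction,
     treated next, it is 1 + 0 + 0. *)
  - rewrite /contract_sign /contract (vE _ x1) (vE' _ x2) /= sqrrN expr1n scale1r.
    by rewrite /edge_term x1 x2.
  - rewrite /contract_sign /contract (vE' _ x1) (vE _ x2) /= expr1 scaleN1r.
    rewrite /edge_term x1 x2 (negbTE (disC _ x1)) /=.
    by rewrite (inv_flip (gwi _)).
  by rewrite !vE' //= edge_term_inside // x1 x2 orbT.
rewrite !big_cons big_nil addr0 addrA /bsum /g.
have Eu : uniq [:: e1.1; e1.2; e2.1; e2.2; e3.1; e3.2] by rewrite (perm_uniq pG).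
have n12 := uniq2 (mask_uniq Eu [:: true; false; true]).
have n13 := uniq2 (mask_uniq Eu [:: true; false; false; false; true]).
have n23 := uniq2 (mask_uniq Eu [:: false; false; true; false; true]).
have neq (e f : nat * nat) : e.1 != f.1 -> (e == f) = false.
  by move=> ef; apply/eqP => E; rewrite E eqxx in ef.
by rewrite /= !eqxx !(neq e1 e2, neq e1 e3, neq e2 e3).
Qed.

Lemma graph_weight_size vs es : (1 < size vs)%N -> graph_weight F (vs, es) = 0.
Proof. by case: vs => [|T [|U vs]]. Qed.

Lemma graph_weight_rel r : graph_rel r -> fglift (graph_weight F) r = 0.
Proof.
have gl := @fglift_lin k (graph H) M (graph_weight F).
case=> [f G fi|vs es es' ees'|vs T U ws es|vs es x y es'|vs ws es s sr];
  rewrite ?(linB gl) ?(linD gl) ?fgliftU.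
- by rewrite graph_weight_rename // subrr.
- by rewrite (graph_weight_edges _ _ ees') subrr.
- by rewrite !graph_weight_size ?addr0 // size_cat /= !addnS.
- by rewrite graph_weight_reverse addNr || rewrite graph_weight_reverse addrN.
rewrite (fglift_comp _ _ gl).
(* The weight sees a relation at a vertex only when that vertex is the only one. *)
have [vws|vws] := eqVneq (size (vs ++ ws)) 0.
  case: vs vws => [|//] /=; case: ws => [|//] _.
  by rewrite -(gwi es sr); apply: eq_fglift => T _ /=; rewrite fgliftU.
rewrite fgliftE big1 // => T _ /=.
by rewrite fgliftU graph_weight_size ?scaler0 // size_cat /= addnS -size_cat ltnS lt0n.
Qed.

Lemma graph_weight_slide_rel r : slide_rel r -> graph_span 2 1 r ->
  fglift (graph_weight F) r = 0.
Proof.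
have gl := @fglift_lin k (graph H) M (graph_weight F).
case=> h x y G xyG sp; rewrite (linB gl) !fgliftU.
(* If the two graphs coincide the relation is 0 and its support says nothing; otherwise the first
   graph lies in the support, hence has one vertex and rank two. *)
have [->|AB] := eqVneq (graph_bead_at h x G) (graph_bead_at (S h) y G).
  by rewrite subrr.
have /is_graph21P[T' [x1 [y1 [z [w [GE Tu TE]]]]]] : is_graph 2 1 (graph_bead_at h x G).
  apply: sp; rewrite mem_dom coeffB !coeffU !mul1r eqxx.
  by rewrite [_ == graph_bead_at h x G]eq_sym (negbTE AB) subr0 oner_neq0.
case: G xyG GE {AB sp} => -[|T [|//]] es //= xyG [TE' esE].
have sE : slots T' = slots T by rewrite -TE' /slots /= !term_slots_bead_at.
rewrite sE in Tu TE; apply/eqP; rewrite subr_eq0; apply/eqP.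
have Eu : uniq [:: x1; y1; z; w] by rewrite (perm_uniq TE).
have inT q : q \in [:: x1; y1; z; w] -> q \in slots T by rewrite (perm_mem TE).
move: xyG; rewrite esE !inE => /orP[]/eqP[-> ->].
  apply: (graph_weight_slide cocomm) => //; [|by apply: inT; rewrite !inE eqxx ?orbT..].
  exact: uniq2 (mask_uniq Eu [:: true; true]).
have sw e e' : perm_eq [:: e; e'] [:: e'; e] by apply/permPl/(perm_catC [:: e]).
rewrite /graph_bead_at /= !(graph_weight_edges _ _ (sw (x1, y1) _)).
apply: (graph_weight_slide cocomm) => //; [|by apply: inT; rewrite !inE eqxx ?orbT..].
exact: uniq2 (mask_uniq Eu [:: false; false; true; true]).
Qed.

Lemma graph_weight_lspan r :
  r \in lspan (@chain_rel k H 2 1 `|` @boundary k H @` @graph_span k H 2 2) ->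
  fglift (graph_weight F) r = 0.
Proof.
have gl := @fglift_lin k (graph H) M (graph_weight F).
apply: (lspan_eq0 gl) => x [[[xr|xr] sp]|[y ysp <-]].
- exact: graph_weight_rel.
- exact: graph_weight_slide_rel.
rewrite [boundary y]fgliftE (lin_sum gl) big1_seq // => G /andP[_ Gy].
rewrite (linZ gl) (_ : \sum_(_ <- _ | _) _ = boundary << G >>); last first.
  by rewrite /boundary fgliftU.
by rewrite (graph_weight_boundary) ?scaler0 //; apply: ysp.
Qed.

End Boundary.

(** * The tautological bilinear form on the quotient of the coinvariants *)

Section WeightQuotient.
Variables (k : fieldType) (H : hopfAlgebra k).
Hypothesis cocomm : cocommutative H.
Local Notation S := (@antipode k H).
Local Notation Q := (quotmod (@operator_images k H)).

Definition qbar (a b : H) : Q := \pi_Q (hbar a b).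

Let piQ := @pi_linear k _ (@operator_images k H).

Lemma bilin_qbar : bilin qbar.
Proof.
by have hl := bilin_hbar H; split=> [b|a]; apply: (linear_comp piQ); linear_auto.
Qed.

Lemma qbar_inv : conj_invariant qbar.
Proof.
move=> h a b; rewrite -(linZ piQ) -(hbar_inv h a b) /conj2.
rewrite (sw_comp _ _ piQ); apply: eq_sw => x y.
rewrite (sw_comp _ _ piQ); apply: eq_sw => p q.
by rewrite (sw_comp _ _ piQ).
Qed.

Lemma qbarC a b : qbar a b = qbar b a.
Proof.
apply/eqP; rewrite -subr_eq0 -(linB piQ) -(tau_hbar cocomm a b); apply/eqP.
by apply: pi0; left; left; exists (hbar a b).
Qed.

Lemma qbarS a b : qbar (S a) b = - qbar a b.
Proof.
apply/eqP; rewrite -addr_eq0 addrC -(linD piQ) -(delta_hbar cocomm a b); apply/eqP.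
by apply: pi0; left; right; exists (hbar a b).
Qed.

Lemma qbar3 a b : qbar a b + sw (fun a1 a2 => qbar (S a1 * b) (S a2)) a
  + sw (fun b1 b2 => qbar (S b1) (S b2 * a)) b = 0.
Proof.
rewrite -!(sw_comp _ _ piQ) -(gamma2_hbar cocomm) -(gamma_hbar cocomm).
rewrite -!(linD piQ) addrAC.
by apply: pi0; right; exists (hbar a b).
Qed.

End WeightQuotient.

(** * Classes of one-vertex graphs *)

Section Supported.
Variables (k : fieldType) (K : choiceType).

(** A support condition as a submodule, so that the side condition [graph_span] in [chain_rel] can
    be checked term by term. *)
Definition supported (A : pred K) : {pred {freeg K / k}} :=
  fun D => all A (dom D).

Lemma supported_submod_closed A : submod_closed (supported A).
Proof.
split=> [|c D E /allP DA /allP EA]; first by rewrite /supported unfold_in dom0.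
apply/allP => x /domD_subset; rewrite mem_cat => /orP[/domZ_subset|].
  exact: DA.
exact: EA.
Qed.

HB.instance Definition _ A := GRing.isSubmodClosed.Build k {freeg K / k}
  (supported A) (supported_submod_closed A).

Lemma supportedU (A : pred K) x : A x -> << x >> \in supported A.
Proof. by move=> Ax; rewrite unfold_in /supported domU1 /= Ax. Qed.

End Supported.

Lemma supported_fglift (k : fieldType) (K L : choiceType) (A : pred L)
  (f : K -> {freeg L / k}) (D : {freeg K / k}) :
  {in dom D, forall z, f z \in supported A} -> fglift f D \in supported A.
Proof.
by move=> fA; rewrite fgliftE big_seq rpred_sum // => z zD; rewrite rpredZ ?fA.
Qed.

Section GraphClasses.
Variables (k : fieldType) (H : hopfAlgebra k).
Hypothesis cocomm : cocommutative H.
Local Notation S := (@antipode k H).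
Local Notation lf h x := (Bead h (Slot H x)).
Implicit Types (T U : tree H).

(** The set spanned in [boundaries], taken in the module of all chains, so that single graphs have
    classes before cycles are considered. *)
Definition null_chains : set {freeg (graph H) / k} :=
  @chain_rel k H 2 1 `|` @boundary k H @` @graph_span k H 2 2.
Local Notation P := (quotmod null_chains).
Let piP := @pi_linear k _ null_chains.

(* Junk value 0 outside the connected one-vertex graphs of rank two. *)
Definition graph_class (G : graph H) : P :=
  if is_graph 2 1 G then \pi_P << G >> else 0.
Local Notation cl := graph_class.

Lemma is_graph21E T es : is_graph 2 1 ([:: T], es) =
  [&& uniq (slots T), perm_eq (edge_ends ([:: T], es)) (slots T) & size es == 2].
Proof.
apply/is_graph21P/and3P=> [[T' [x [y [z [w [[-> ->] Tu TE]]]]]] //|[Tu TE]].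
case: es TE => [|[x y] [|[z w] [|]]] // TE _.
by exists T, x, y, z, w.
Qed.

Lemma term_slots_graft o (w : seq H) (ts : seq (term H)) :
  size w = arity o -> size ts = arity o ->
  term_slots (graft o (beads w ts)) = term_slots (graft o ts).
Proof.
elim: o w ts => [|p IHp q IHq] w ts.
  by case: w => [|a [|]] //; case: ts => [|t [|]].
move=> wsz tsz; rewrite -(cat_take_drop (arity p) w).
have up : size (take (arity p) w) = arity p by rewrite size_takel // wsz leq_addr.
rewrite graft_beads_cat //= IHp ?IHq //.
- by rewrite size_drop wsz addKn.
- by rewrite size_drop tsz addKn.
by rewrite size_takel // tsz leq_addr.
Qed.

(** The relations are homogeneous in the slots, so the test in [graph_class] gives one answer for
    all trees of a relation. *)
Lemma HLie_rel_slots r : HLie_rel r ->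
  exists X, r \in supported (fun T : tree H => perm_eq (slots T) X).
Proof.
case=> [s t|s t u|s t u|s t u v|c g h t u|g h t u|t u|h t u|h o ts u tsz].
- exists (slots (s, t)); rewrite rpredB ?supportedU //.
  by rewrite /slots /= perm_catC.
- by exists (slots (s, Br t u)); rewrite rpredB ?supportedU // /slots /= catA.
- exists (slots (Br s t, u)); rewrite rpredD ?supportedU //.
  by rewrite /slots /= perm_cat2r perm_catC.
- exists (slots (Br (Br s t) u, v)); rewrite !rpredD ?supportedU // /slots /= perm_cat2r.
    by rewrite perm_catC catA.
  by rewrite -catA perm_catC.
- by exists (slots (t, u)); rewrite !rpredB ?rpredZ ?supportedU.
- by exists (slots (t, u)); rewrite !rpredB ?supportedU.
- by exists (slots (t, u)); rewrite !rpredB ?supportedU.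
- by exists (slots (t, u)); rewrite !rpredB ?supportedU.
exists (slots (graft o ts, u)); rewrite rpredB ?supportedU //.
apply: supported_fglift => w _; apply: supportedU.
by rewrite /slots /= term_slots_graft ?size_tuple.
Qed.

Lemma graph_class_vertex es r : HLie_rel r ->
  fglift (fun T => cl ([:: T], es)) r = 0.
Proof.
move=> rr; have [X /allP rX] := HLie_rel_slots rr.
pose b := [&& uniq X, perm_eq (edge_ends ([:: (Slot H 0, Slot H 0)], es)) X & size es == 2].
have bE T : T \in dom r -> is_graph 2 1 ([:: T], es) = b.
  by move=> /rX TX; rewrite is_graph21E (perm_uniq TX) (permPr TX).
have [bT|bF] := boolP b; last first.
  by rewrite fgliftE big1_seq // => T /andP[_ Tr]; rewrite /cl bE // (negbTE bF) scaler0.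
have -> : fglift (fun T => cl ([:: T], es)) r =
    \pi_P (fglift (fun T => << ([:: T], es) >>) r).
  rewrite (fglift_comp _ _ piP); apply: eq_fglift => T Tr.
  by rewrite /cl bE // bT.
apply: pi0; left; split; first by left; apply: (graph_vertex [::] [::]).
have /allP G21 : fglift (fun T => << ([:: T], es) >>) r \in supported (@is_graph k H 2 1).
  by apply: supported_fglift => T Tr; apply: supportedU; rewrite bE.
by move=> G; apply: G21.
Qed.

Lemma graph_class_eq c G G' :
  graph_rel (<< G >> + c *: << G' >>) \/ slide_rel (<< G >> + c *: << G' >>) ->
  is_graph 2 1 G = is_graph 2 1 G' -> cl G = - (c *: cl G').
Proof.
move=> rel GG'; rewrite /cl -GG'; case: ifP => [Gv|]; last by rewrite scaler0 oppr0.
apply/eqP; rewrite -addr_eq0 -(linZ piP) -(linD piP); apply/eqP/pi0; left.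
split; first by case: rel; [left|right].
have /allP : << G >> + c *: << G' >> \in supported (@is_graph k H 2 1).
  by rewrite rpredD ?rpredZ ?supportedU // -GG'.
by move=> sup G''; apply: sup.
Qed.

Lemma graph_class_invariant es : HLie_invariant (fun T => cl ([:: T], es)).
Proof. by move=> r; apply: graph_class_vertex. Qed.

Let cli := graph_class_invariant.

Lemma graph_class_edges T es es' : perm_eq es es' ->
  cl ([:: T], es) = cl ([:: T], es').
Proof.
move=> ees'; have := @graph_class_eq (-1) ([:: T], es) ([:: T], es').
rewrite !scaleN1r opprK; apply; first by left; apply: graph_edges.
have E : perm_eq (edge_ends ([:: T], es)) (edge_ends ([:: T], es')).
  by apply: perm_flatten; apply: perm_map.
by rewrite !is_graph21E (permPl E) (perm_size ees').
Qed.

Lemma graph_class_reverse T es x y es' :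
  cl ([:: T], es ++ (y, x) :: es') = - cl ([:: T], es ++ (x, y) :: es').
Proof.
have := @graph_class_eq 1 ([:: T], es ++ (y, x) :: es') ([:: T], es ++ (x, y) :: es').
rewrite !scale1r; apply; first by left; apply: graph_reverse.
have E : perm_eq (edge_ends ([:: T], es ++ (y, x) :: es'))
    (edge_ends ([:: T], es ++ (x, y) :: es')).
  rewrite /edge_ends !map_cat !flatten_cat perm_cat2l /=.
  by apply/permPl/(perm_catCA [:: y] [:: x]).
by rewrite !is_graph21E (permPl E) !size_cat.
Qed.

Lemma term_slots_rename f (t : term H) :
  term_slots (rename_term f t) = map f (term_slots t).
Proof. by elim: t => [y|b t IHt|t IHt u IHu] //=; rewrite map_cat IHt IHu. Qed.

Lemma graph_class_rename f T es : injective f ->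
  cl (rename f ([:: T], es)) = cl ([:: T], es).
Proof.
move=> fi; have := @graph_class_eq (-1) ([:: T], es) (rename f ([:: T], es)).
rewrite !scaleN1r opprK => ->; [by []|by left; apply: graph_iso|].
rewrite !is_graph21E size_map.
have -> : slots (rename_term f T.1, rename_term f T.2) = map f (slots T).
  by rewrite /slots /= !term_slots_rename map_cat.
have -> : edge_ends ([:: (rename_term f T.1, rename_term f T.2)],
    [seq (f e.1, f e.2) | e <- es]) = map f (edge_ends ([:: T], es)).
  by rewrite /edge_ends map_flatten /= -!map_comp.
rewrite map_inj_uniq //; congr [&& _, _ & _].
by apply/idP/idP; [apply: perm_map|apply: perm_map_inj].
Qed.

Lemma graph_class_slide h x y T es : (x, y) \in es ->
  cl (graph_bead_at h x ([:: T], es)) = cl (graph_bead_at (S h) y ([:: T], es)).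
Proof.
move=> xy; have := @graph_class_eq (-1) (graph_bead_at h x ([:: T], es))
  (graph_bead_at (S h) y ([:: T], es)).
rewrite !scaleN1r opprK; apply; first by right; apply: slide.
by rewrite !is_graph21E /slots /= !term_slots_bead_at.
Qed.

Lemma is_graph22I T U e1 e2 e3 : uniq (slots T ++ slots U) ->
  perm_eq [:: e1.1; e1.2; e2.1; e2.2; e3.1; e3.2] (slots T ++ slots U) ->
  (1 < size (slots T))%N -> (1 < size (slots U))%N ->
  e3.1 \in slots T -> e3.2 \in slots U -> is_graph 2 2 ([:: T; U], [:: e1; e2; e3]).
Proof.
move=> uTU pTU sT sU e3T e3U; rewrite /is_graph /half_edges /edge_ends /= cats0.
rewrite uTU pTU sT sU /= andbT; apply/andP; split=> //.
apply/forallP => i; apply/forallP => j.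
have adj i' j' : i' != j' -> adjacent (G := ([:: T; U], [:: e1; e2; e3])) i' j'.
  move=> ij; apply/hasP; exists e3; first by rewrite !inE eqxx !orbT.
  move: ij; case: i' => -[|[|//]] i'; case: j' => -[|[|//]] j' // _;
    by rewrite !(tnth_nth T) /= e3T e3U ?orbT.
have [->|ij] := eqVneq i j; first exact: connect0.
exact/connect1/adj.
Qed.

(** One transposition per new slot extends the renaming; this moves a graph to standard labels. *)
Lemma exists_renaming (s t : seq nat) : uniq s -> uniq t -> size s = size t ->
  exists2 f, injective f & map f s = t.
Proof.
elim: s t => [|x s IHs] [|y t] //=; first by exists id.
move=> /andP[xs su] /andP[yt tu] [st]; have [f fi fs] := IHs t su tu st.
exists (transpose (f x) y \o f); first exact: inj_comp (@transpose_inj _ _) fi.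
rewrite /= /transpose eqxx; congr cons; rewrite map_comp fs -[RHS]map_id.
apply/eq_in_map => z zt; case: eqP => [zx|_]; last by case: eqP => // zy; rewrite -zy zt in yt.
by move: zt; rewrite -fs zx mem_map // (negbTE xs).
Qed.

Definition theta_class (a b : H) : P :=
  cl ([:: (Br (Slot H 0) (Slot H 1), Br (lf a 2) (lf b 3))], [:: (0, 2); (1, 3)]%N).
Local Notation L := theta_class.

(** Sliding a and b along their edges multiplies the beads at the other ends by S(a) and S(b) on the
    right. *)
Lemma graph_class_theta a b c d x y z w : uniq [:: x; y; z; w] ->
  cl ([:: (Br (lf a x) (lf b z), Br (lf c y) (lf d w))], [:: (x, y); (z, w)]) =
  L (c * S a) (d * S b).
Proof.
move=> xu; have [f fi [fx fy fz fw]] := exists_renaming xu (isT : uniq [:: 0; 2; 1; 3]%N) erefl.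
rewrite -(graph_class_rename _ _ fi) /rename /= fx fy fz fw.
set es := [:: (0, 2); (1, 3)]%N.
have -> : ([:: (Br (lf a 0) (lf b 1), Br (lf c 2) (lf d 3))], es) =
  graph_bead_at a 0 ([:: (Br (Slot H 0) (lf b 1), Br (lf c 2) (lf d 3))], es) by [].
rewrite (@graph_class_slide _ _ 2) // /graph_bead_at /=.
rewrite (inv_flip (cli es)) (inv_mul_l (cli es)) (inv_flip (cli es)).
have -> : ([:: (Br (Slot H 0) (lf b 1), Br (lf (c * S a) 2) (lf d 3))], es) =
  graph_bead_at b 1 ([:: (Br (Slot H 0) (Slot H 1), Br (lf (c * S a) 2) (lf d 3))], es) by [].
rewrite (@graph_class_slide _ _ 3) // /graph_bead_at /=.
by rewrite (inv_flip (cli es)) (inv_mul_r (cli es)) (inv_flip (cli es)).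
Qed.

Lemma pi_boundary G : is_graph 2 2 G -> \pi_P (boundary << G >>) = 0.
Proof.
move=> G22; apply: pi0; right; exists << G >> => //.
by move=> G'; rewrite domU1 inE => /eqP->.
Qed.

Lemma graph_class_dumbbell a b c d x y z w : uniq [:: x; y; z; w] ->
  cl ([:: (Br (lf a x) (lf b y), Br (lf c z) (lf d w))], [:: (x, y); (z, w)]) = 0.
Proof.
move=> xu; have [f fi [fx fy fz fw]] := exists_renaming xu (isT : uniq [:: 0; 1; 2; 3]%N) erefl.
rewrite -(graph_class_rename _ _ fi) /rename /= fx fy fz fw.
(* The bridge from 4 to 5 is the only edge that is not a loop, and contracting it gives the dumbbell
   tree. *)
pose G : graph H := ([:: (Br (lf a 0) (lf b 1), Slot H 4); (Br (lf c 2) (lf d 3), Slot H 5)],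
  [:: (0, 1); (2, 3); (4, 5)]%N).
have G22 : is_graph 2 2 G by apply: is_graph22I.
have := pi_boundary G22; rewrite /boundary fgliftU !big_cons big_nil /=.
rewrite addr0.
have -> : contract_sign G (4, 5)%N = 1 by rewrite /contract_sign /= sqrrN expr1n.
by rewrite scale1r /cl; case: ifP.
Qed.

Lemma theta_class_distr h s t u v es :
  cl ([:: (Br s t, Bead h (Br u v))], es) =
  sw (fun a b => cl ([:: (Br s t, Br (Bead a u) (Bead b v))], es)) h.
Proof.
rewrite (inv_flip (cli es)) (inv_distr (cli es)); apply: eq_sw => a b.
exact: (inv_flip (cli es)).
Qed.

Lemma bilin_theta_class : bilin L.
Proof.
split=> [b|a] c x y; rewrite /L !(inv_flip (cli _) (Br (Slot H 0) (Slot H 1))).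
  exact: (inv_beads_bilin (cli _) _ _ _).1.
exact: (inv_beads_bilin (cli _) _ _ _).2.
Qed.

(** A bead c above the bracket of a and b distributes to the left of both. Moved through the
    distinguished edge it becomes S(c) on the other bracket, and sliding its legs along the two
    edges puts c on the right. *)
Lemma balanced_theta_class : balanced L.
Proof.
move=> c a b; set es := [:: (0, 2); (1, 3)]%N.
transitivity (cl ([:: (Br (Slot H 0) (Slot H 1), Bead c (Br (lf a 2) (lf b 3)))], es)).
  rewrite theta_class_distr; apply: eq_sw => x y.
  rewrite [RHS](inv_flip (cli es)) (inv_mul_l (cli es)) (inv_mul_r (cli es)).
  by rewrite (inv_flip (cli es)).
rewrite (inv_flip (cli es)) (inv_antipode (cli es)) theta_class_distr.
have fl := inv_beads_bilin (cli es) (Slot H 0) (Slot H 1) (Br (lf a 2) (lf b 3)).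
rewrite (antipode_Delta cocomm); last first.
  split=> [y|x] d p q; rewrite !(inv_flip (cli es) (Br (lf a 2) (lf b 3)));
    [exact: fl.1|exact: fl.2].
apply: eq_sw => x y; rewrite (inv_flip (cli es)) graph_class_theta //.
by rewrite !(antipodeK cocomm).
Qed.

(** Exchanging slots 0, 1 and slots 2, 3 exchanges the edges and reverses both trivalent vertices;
    the two signs cancel. *)
Lemma theta_classC a b : L a b = L b a.
Proof.
pose f := transpose 0 1 \o transpose 2 3.
have fi : injective f by apply: inj_comp; apply: transpose_inj.
rewrite {1}/theta_class -(graph_class_rename _ _ fi) /rename /=.
rewrite (graph_class_edges _ (es' := [:: (0, 2); (1, 3)]%N)); last first.
  by apply/permPl/(perm_catC [:: (1, 3)%N]).
rewrite (inv_antisym (cli _)) (inv_flip (cli _)) (inv_antisym (cli _)) opprK.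
by rewrite (inv_flip (cli _)).
Qed.

(** In this IHX relation one summand is L(a, b), one is L(S(a), b) because the first edge is read
    backwards, and one brackets the two ends of that edge and vanishes as a dumbbell. *)
Lemma theta_classS a b : L (S a) b = - L a b.
Proof.
set es := [:: (0, 2); (1, 3)]%N.
have := inv_IHX (cli es) (Slot H 0) (Slot H 1) (lf a 2) (lf b 3).
rewrite (inv_shift (cli es)) -/(L a b).
have -> : cl ([:: (Br (Br (Slot H 1) (lf a 2)) (Slot H 0), lf b 3)], es) = L (S a) b.
  rewrite (inv_shift (cli es)) (inv_antisym (cli es)).
  rewrite (graph_class_reverse _ [::] 2 0) opprK.
  rewrite -(inv_one_r (cli _)) (inv_flip (cli _)) -(inv_one_l (cli _)) (inv_flip (cli _)).
  by rewrite graph_class_theta // antipode1 mul1r mulr1.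
have -> : cl ([:: (Br (Br (lf a 2) (Slot H 0)) (Slot H 1), lf b 3)], es) = 0.
  rewrite (inv_shift (cli es)) (inv_antisym (cli es)).
  rewrite -(inv_one_l (cli _)) (inv_flip (cli _)) -(inv_one_l (cli _)) (inv_flip (cli _)).
  by rewrite graph_class_dumbbell ?oppr0.
by rewrite addr0 addrC => /eqP; rewrite addr_eq0 => /eqP.
Qed.

(** Contracting the edges (1,4), (2,5), (3,6) of [G] gives the second, third and first summand. *)
Lemma theta_class3 a b : L a b + sw (fun a1 a2 => L (S a1 * b) (S a2)) a
  + sw (fun b1 b2 => L (S b1) (S b2 * a)) b = 0.
Proof.
pose G : graph H := ([:: (Br (Slot H 1) (Slot H 2), Slot H 3);
  (Br (lf a 4) (lf b 5), Slot H 6)], [:: (1, 4); (2, 5); (3, 6)]%N).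
have G22 : is_graph 2 2 G by apply: is_graph22I.
have := pi_boundary G22; rewrite /boundary fgliftU !big_cons big_nil /=.
rewrite addr0 /contract_sign /= sqrrN expr1n !scale1r !(linD piP).
have clE G' : is_graph 2 1 G' -> \pi_P << G' >> = cl G' by rewrite /cl => ->.
have v1 T es : uniq (slots T) -> perm_eq (edge_ends ([:: T], es)) (slots T) ->
    size es = 2 -> is_graph 2 1 ([:: T], es).
  by move=> Tu TE es2; rewrite is_graph21E Tu TE es2.
rewrite !clE; try by apply: v1.
rewrite /contract /= /compose /root_at /= !theta_class_distr.
have sl := graph_class_theta.
have one_l x s u es : cl ([:: (Br (Slot H x) s, u)], es) = cl ([:: (Br (lf 1 x) s, u)], es).
  by rewrite (inv_one_l (cli es)).
have one_r x s u es : cl ([:: (Br s (Slot H x), u)], es) = cl ([:: (Br s (lf 1 x), u)], es).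
  by rewrite (inv_one_r (cli es)).
have -> : sw (fun x y => cl ([:: (Br (Slot H 2) (Slot H 3),
    Br (Bead x (lf b 5)) (lf y 6))], [:: (2, 5); (3, 6)]%N)) (S a) =
  sw (fun a1 a2 => L (S a1 * b) (S a2)) a.
  rewrite -(antipode_Delta cocomm (f := fun x y => L (x * b) y)); last first.
    by have Ll := bilin_theta_class; linear_auto.
  apply: eq_sw => x y; rewrite one_l one_r (inv_flip (cli _)) (inv_mul_l (cli _)).
  by rewrite (inv_flip (cli _)) sl // antipode1 !mulr1.
have -> : sw (fun x y => cl ([:: (Br (Slot H 3) (Slot H 1),
    Br (lf x 6) (Bead y (lf a 4)))], [:: (1, 4); (3, 6)]%N)) (S b) =
  sw (fun b1 b2 => L (S b1) (S b2 * a)) b.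
  rewrite -(antipode_Delta cocomm (f := fun x y => L x (y * a))); last first.
    by have Ll := bilin_theta_class; linear_auto.
  apply: eq_sw => x y; rewrite one_l one_r (inv_flip (cli _)) (inv_mul_r (cli _)).
  rewrite (graph_class_edges _ (es' := [:: (3, 6); (1, 4)]%N)); last first.
    by apply/permPl/(perm_catC [:: (1, 4)%N]).
  by rewrite (inv_flip (cli _)) sl // antipode1 !mulr1.
rewrite one_l one_r sl // antipode1 !mulr1 => E.
by rewrite -addrA addrC -addrA.
Qed.

End GraphClasses.

(** * The two maps and their composite *)

Section Isomorphism.
Variables (k : fieldType) (H : hopfAlgebra k).
Hypotheses (char0 : [pchar k] =i pred0) (cocomm : cocommutative H).
Local Notation lf h x := (Bead h (Slot H x)).
Local Notation P := (quotmod (@null_chains k H)).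
Local Notation Q := (quotmod (@operator_images k H)).
Local Notation cl := (@graph_class k H).
Local Notation L := (@theta_class k H).
Local Notation gw := (graph_weight (@qbar k H)).

Let piP := @pi_linear k _ (@null_chains k H).
Let piQ := @pi_linear k _ (@operator_images k H).
Let Ll := @bilin_theta_class k H.

Definition hbar_class : Hbar H 2 -> P := @qlift k _ _ (@conj_rel k H 2) (sweedler L).

Lemma theta_class_inv x : @conj_rel k H 2 x -> sweedler L x = 0.
Proof.
apply: (conj_rel_eq0 Ll).1.
by apply/(conj_balanced cocomm Ll)/balanced_theta_class.
Qed.

Lemma hbar_class_linear : linear hbar_class.
Proof. by apply: qlift_linear theta_class_inv; apply: sweedler_linear. Qed.

Lemma hbar_class_hbar a b : hbar_class (hbar a b) = L a b.
Proof.
rewrite /hbar_class qliftE ?sweedler_tens //; last exact: theta_class_inv.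
exact: sweedler_linear.
Qed.

Lemma hbar_class_images x : operator_images x -> hbar_class x = 0.
Proof.
have hl := hbar_class_linear.
move=> /sub_lspan; rewrite (lspan_operator_images cocomm).
apply: (lspan_eq0 hl) => _ [a [b []]] ->.
- by rewrite (linB hl) !hbar_class_hbar theta_classC subrr.
- by rewrite (linD hl) !hbar_class_hbar theta_classS // addrN.
rewrite explicit_relation3 // !(linD hl) gamma2_hbar // gamma_hbar //.
rewrite !(sw_comp _ _ hl) -[RHS](theta_class3 cocomm a b) hbar_class_hbar.
by congr (_ + _ + _); apply: eq_sw => c d; rewrite hbar_class_hbar.
Qed.

Definition qbar_class : Q -> P := @qlift k _ _ (@operator_images k H) hbar_class.

Lemma qbar_class_linear : linear qbar_class.
Proof. exact: qlift_linear hbar_class_linear hbar_class_images. Qed.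

Lemma qbar_class_qbar a b : qbar_class (qbar a b) = L a b.
Proof.
by rewrite /qbar_class qliftE ?hbar_class_hbar //;
  [exact: hbar_class_linear|exact: hbar_class_images].
Qed.

Let bl := @bilin_qbar k H.
Let binv := @qbar_inv k H.
Let bC := @qbarC k H cocomm.
Let bS := @qbarS k H cocomm.
Let b3 := @qbar3 k H cocomm.

(** Both sides are invariant in the tree, so the three splittings of the slots suffice: a dumbbell,
    where both vanish, and two thetas that differ by the reversal of an edge. *)
Lemma qbar_class_weight G : is_graph 2 1 G -> qbar_class (gw G) = 2%:R *: cl G.
Proof.
have ql := qbar_class_linear.
move=> /is_graph21P[T [x [y [z [w [-> Tu TE]]]]]].
pose f es T := qbar_class (gw ([:: T], es)) - 2%:R *: cl ([:: T], es).
have fi es : HLie_invariant (f es).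
  move=> r rr.
  have -> : fglift (f es) r = qbar_class (fglift (fun T => gw ([:: T], es)) r)
      - 2%:R *: fglift (fun T => cl ([:: T], es)) r.
    rewrite (fglift_comp _ _ ql) !fgliftE scaler_sumr -sumrB.
    by apply: eq_bigr => T' _; rewrite /f scalerBr !scalerA mulrC.
  rewrite (graph_weight_invariant cocomm bl binv bC bS) // (lin0 ql).
  by rewrite (@graph_class_invariant k H es) // scaler0 subrr.
apply/eqP; rewrite -subr_eq0 -/(f _ _).
have Eu : uniq [:: x; y; z; w] by rewrite (perm_uniq TE).
have rev x' y' es T' : f ((y', x') :: es) T' = - f ((x', y') :: es) T'.
  rewrite /f (graph_weight_reverse _ _ [::]) (graph_class_reverse _ [::]).
  by rewrite (linN ql) scalerN opprD.
have theta x' y' z' w' a b d : uniq [:: x'; y'; z'; w'] ->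
    f [:: (x', y'); (z', w')] (Br (Br (lf a x') (lf b z')) (lf d y'), Slot H w') = 0.
  move=> u; set es := [:: _; _].
  rewrite (inv_shift (fi es)) (inv_flip (fi es)) -(inv_one_r (fi es)) (inv_flip (fi es)).
  rewrite /f gw_theta // graph_class_theta // (linZ ql) qbar_class_qbar.
  by rewrite subrr.
suff : f [:: (x, y); (z, w)] T = 0 by move=> ->.
refine (inv_normal4_eq0 (fi [:: (x, y); (z, w)]) Tu TE _ _ _) => a b d.
- rewrite (inv_shift (fi _)) (inv_flip (fi _)) -(inv_one_r (fi _)) (inv_flip (fi _)).
  rewrite /f gw_dumbbell // graph_class_dumbbell // (lin0 ql) scaler0 subrr //.
- exact: theta.
rewrite rev; apply/eqP; rewrite oppr_eq0; apply/eqP/theta.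
by rewrite -(perm_uniq (_ : perm_eq [:: x; y; z; w] _)) //; apply/permPl/(perm_catCA [:: x] [:: y]).
Qed.

Lemma qbar_class_chain x : @graph_span k H 2 1 x ->
  qbar_class (fglift gw x) = 2%:R *: \pi_P x.
Proof.
move=> xs; rewrite (fglift_comp _ _ qbar_class_linear) fgliftE.
rewrite -[X in \pi_P X]freeg_sumE (lin_sum piP) scaler_sumr; apply: eq_big_seq => G Gx.
have Gv := xs G Gx.
by rewrite freegUZ (linZ piP) /= qbar_class_weight // /graph_class Gv !scalerA mulrC.
Qed.

Lemma two_neq0 : 2%:R != 0 :> k.
Proof. by have := char0 2; rewrite !inE /= => ->. Qed.

Definition homology_weight (x : scrH 2 H) : Q :=
  fglift gw (chain_of_cycle (repr x)).

Lemma chain_linear : linear (@chain_of_cycle k H 2 1).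
Proof. by move=> c a b. Qed.

Lemma homology_weight_lin : linear homology_weight.
Proof.
have cl' := linear_comp (@fglift_lin k (graph H) Q gw) chain_linear.
apply: (qlift_linear cl') => x xb.
exact: (graph_weight_lspan cocomm bl binv bC bS b3).
Qed.

Lemma homology_weight_pi z :
  homology_weight (\pi_(scrH 2 H) z) = fglift gw (chain_of_cycle z).
Proof.
have cl' := linear_comp (@fglift_lin k (graph H) Q gw) chain_linear.
apply: (qliftE cl') => x xb.
exact: (graph_weight_lspan cocomm bl binv bC bS b3).
Qed.

(** By [qbar_class_chain] a cycle of weight 0 has twice its class equal to 0. Dividing by 2, it lies
    in the span of [null_chains], which is membership in [boundaries]. *)
Lemma homology_weight_inj : injective homology_weight.
Proof.
move=> u v uv; apply/eqP; rewrite -subr_eq0.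
have: homology_weight (u - v) = 0 by rewrite (linB homology_weight_lin) uv subrr.
rewrite -[u - v]reprK homology_weight_pi; move: (repr _) => z z0.
have zs : graph_span 2 1 (chain_of_cycle z).
  by case: z {z0} => c /= /andP[/asboolP].
have := qbar_class_chain zs; rewrite z0 (lin0 qbar_class_linear) => /esym/eqP.
rewrite scaler_eq0 (negbTE two_neq0) /= pi_eq0 => zn.
by apply/eqP; apply: pi0.
Qed.

Definition theta_graph (a b : H) : graph H :=
  ([:: (Br (Slot H 0) (Slot H 1), Br (lf a 2) (lf b 3))], [:: (0, 2); (1, 3)]%N).

(** Both edges are loops, so the boundary is an empty sum. The scalar 1/2 compensates the 2 of
    [gw_theta]. *)
Lemma theta_graph_cycle a b :
  2%:R^-1 *: << theta_graph a b >> \in @is_cycle k H 2 1.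
Proof.
rewrite rpredZ //; apply/andP; split.
  by apply/asboolP => G; rewrite domU1 inE => /eqP->; rewrite is_graph21E.
by rewrite /boundary fgliftU !big_cons big_nil /= rpred0.
Qed.

(** The image is a submodule, so it is enough to reach the classes of pure tensors. *)
Lemma homology_weight_surj q : exists x, homology_weight x = q.
Proof.
pose Z : {pred Q} := fun q => `[< exists x, homology_weight x = q >].
suff : q \in Z by move=> /asboolP.
have hl := homology_weight_lin.
have Zs : submod_closed Z.
  split=> [|c _ _ /asboolP[x <-] /asboolP[y <-]]; apply/asboolP.
    by exists 0; rewrite (lin0 hl).
  by exists (c *: x + y); rewrite hl.
rewrite -[q]reprK -[repr q]reprK.
have pl : linear (fun t : tpow H 2 => \pi_Q (\pi_(Hbar H 2) t)).
  by move=> c x y; rewrite (@piHbar_linear k H) piQ.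
apply: (tens_rect pl Zs) => a b.
apply/asboolP; exists (\pi_(scrH 2 H) (Cycle (theta_graph_cycle a b))).
rewrite homology_weight_pi /= (linZ (fglift_lin _)) fgliftU.
rewrite -(inv_one_r (graph_weight_invariant cocomm bl binv bC bS _)).
rewrite -(inv_one_l (graph_weight_invariant cocomm bl binv bC bS _)).
rewrite gw_theta // antipode1 !mulr1 scalerA mulVf ?scale1r //.
exact: two_neq0.
Qed.

Lemma homology_weight_bij : exists f : {linear scrH 2 H -> Q}, bijective f.
Proof.
have [f fE] := linear_packed homology_weight_lin; exists f; rewrite fE.
have [g gK] := choice homology_weight_surj.
by exists g => // x; apply: homology_weight_inj; rewrite gK.
Qed.

End Isomorphism.

Theorem theorem4p9 (k : fieldType) (char0 : [pchar k] =i pred0)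
    (H : hopfAlgebra k) (cocomm : cocommutative H) :
  (exists f : {linear scrH 2 H -> quotmod (@operator_images k H)}, bijective f)
  /\ lspan (@operator_images k H) =i lspan (@explicit_relations k H).
Proof. by split; [apply: homology_weight_bij|apply: lspan_operator_images]. Qed.
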